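(* Let $\delta\in(0,1)$. There exists a constant $C(\delta)=\exp(O(1/\delta))$ (i.e. $C(\delta)\le \exp(K/\delta)$ for a universal constant $K$) such that the following holds. For every anti-ferromagnetic two-spin system $(G=(V,E),\beta,\gamma,\lambda)$ with $n=|V|$ vertices and maximum degree $\Delta\ge 3$ which satisfies the uniqueness criterion with gap $\delta$, the modified log-Sobolev constant of the Glauber dynamics on its Gibbs distribution satisfies $$\rho^{\mathrm{GD}}\ge \frac{1}{C(\delta)\,n},$$ and consequently, for every $\epsilon\in(0,1)$, the mixing time of the Glauber dynamics satisfies $$T_{\mathrm{mix}}(\epsilon)\le C(\delta)\,n\left(2\log n+\log\log\alpha+\log\log\left(\lambda+\lambda^{-1}\right)+\log\frac{1}{2\epsilon^2}\right),$$ where $\alpha=\gamma+\gamma^{-1}+2$ if $\beta=0$ and $\alpha=\beta^{-1}+2$ if $\beta>0$.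
   Context: A two-spin system on a graph $G=(V,E)$ with parameters $\beta,\gamma,\lambda\ge 0$ has Gibbs distribution $\mu(\sigma)\propto \beta^{m_+(\sigma)}\gamma^{m_-(\sigma)}\lambda^{n_+(\sigma)}$ for $\sigma\in\{-1,+1\}^V$, where $m_{\pm}(\sigma)$ is the number of edges both of whose endpoints have spin $\pm1$ and $n_+(\sigma)$ the number of vertices with spin $+1$. The system is anti-ferromagnetic if $0\le\beta\le\gamma$, $\gamma>0$, $\lambda>0$ and $\beta\gamma<1$. For an integer $d\ge1$, $(\beta,\gamma,\lambda)$ (anti-ferromagnetic) is $d$-unique with gap $\delta\in(0,1)$ if $\frac{d(1-\beta\gamma)\hat x_d}{(\beta\hat x_d+1)(\hat x_d+\gamma)}\le 1-\delta$, where $\hat x_d>0$ is the unique fixed point of $F_d(x)=\lambda\left(\frac{\beta x+1}{x+\gamma}\right)^d$. Uniqueness criterion with gap $\delta$: $G$ has maximum degree $\Delta\ge3$ and either (i) $\gamma\le1$ and $(\beta,\gamma,\lambda)$ is $(\Delta-1)$-unique with gap $\delta$, or (ii) $\gamma>1$, $(\beta,\gamma,\lambda)$ is $(\Delta-1)$-unique with gap $\delta$, and $G$ is $\Delta$-regular. Glauber dynamics on a distribution $\mu$ over $\{-1,+1\}^V$ with support $\Omega(\mu)$: from $\sigma\in\Omega(\mu)$, pick $v\in V$ uniformly at random and resample $\sigma_v$ from the conditional marginal of $\mu$ at $v$ given $\sigma_{V\setminus\{v\}}$. With transition matrix $P$, the modified log-Sobolev constant is $\rho^{\mathrm{GD}}(\mu)=\inf\{\langle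 f,(I-P)\log f\rangle_\mu/\mathrm{Ent}_\mu(f): f:\Omega(\mu)\to\mathbb R_{\ge0},\ \mathrm{Ent}_\mu(f)\ne0\}$, where $\langle f,g\rangle_\mu=\sum_\sigma\mu(\sigma)f(\sigma)g(\sigma)$, $\mathrm{Ent}_\mu(f)=\mathbb E_\mu[f\log f]-\mathbb E_\mu[f]\log\mathbb E_\mu[f]$, and $0\log0=0$. The mixing time is $T_{\mathrm{mix}}(\epsilon)=\max_{X_0\in\Omega(\mu)}\min\{t: d_{\mathrm{TV}}(X_t,\mu)\le\epsilon\}$ for the chain $(X_t)$. *)

(* Defs.v *)
From HB Require Import structures.
From mathcomp Require Import all_boot all_order all_algebra.
From mathcomp Require Import boolp classical_sets reals sequences exp.
Set Implicit Arguments. Unset Strict Implicit. Unset Printing Implicit Defensive.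
Import Order.TTheory GRing.Theory Num.Theory.
Local Open Scope ring_scope.

Section TwoSpin.
Variables (R : realType) (V : finType) (e : rel V).

Definition simple_graph := symmetric e /\ irreflexive e.

(* configurations sigma : V -> {-1,+1}; true encodes +1, false encodes -1 *)
Definition config := {ffun V -> bool}.

Definition edges : {set {set V}} :=
  [set A : {set V} | [exists u, exists v, e u v && (A == [set u; v])]].

Definition deg (v : V) : nat := #|[set u | e v u]|.
Definition max_deg : nat := \max_(v : V) deg v.
Definition regular (d : nat) := forall v : V, deg v = d.

Definition plus_set (s : config) : {set V} := [set v | s v].
Definition minus_set (s : config) : {set V} := [set v | ~~ s v].
Definition m_plus (s : config) : nat := #|[set A in edges | A \subset plus_set s]|.
Definition m_minus (s : config) : nat := #|[set A in edges | A \subset minus_set s]|.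
Definition n_plus (s : config) : nat := #|plus_set s|.

Variables (beta gamma lambda : R).

Definition weight (s : config) : R :=
  beta ^+ m_plus s * gamma ^+ m_minus s * lambda ^+ n_plus s.
Definition partition_fn : R := \sum_(s : config) weight s.
Definition gibbs (s : config) : R := weight s / partition_fn.

Definition setspin (s : config) (v : V) (b : bool) : config :=
  [ffun u => if u == v then b else s u].

(* Glauber transition matrix: choose v uniformly, resample from the
   conditional marginal at v given the other spins. *)
Definition glauber (s t : config) : R :=
  (#|V|%:R)^-1 * \sum_(v : V)
     (if [forall u, (u != v) ==> (t u == s u)]
      then gibbs t / (gibbs (setspin s v true) + gibbs (setspin s v false))
      else 0).

Definition in_support (s : config) := 0 < gibbs s.

Definition expect (f : config -> R) : R := \sum_(s : config) gibbs s * f s.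
Definition entropy (f : config -> R) : R :=
  expect (fun s => f s * ln (f s)) - expect f * ln (expect f).
Definition dirichlet (f : config -> R) : R :=
  \sum_(s : config) gibbs s * f s *
     (ln (f s) - \sum_(t : config) glauber s t * ln (f t)).

Definition mlsi_const : R :=
  inf [set r : R | exists f : config -> R,
         (forall s, in_support s -> 0 < f s) /\ entropy f != 0 /\
         r = dirichlet f / entropy f]%classic.

Fixpoint law (x : config) (t : nat) : config -> R :=
  match t with
  | 0%N => fun s => if s == x then 1 else 0
  | t'.+1 => fun s => \sum_(r : config) law x t' r * glauber r s
  end.

Definition dTV (p q : config -> R) : R := 2^-1 * \sum_(s : config) `|p s - q s|.

Definition hit_time (eps : R) (x : config) : R :=
  inf [set (t%:R : R) | t in [set t : nat | dTV (law x t) gibbs <= eps]]%classic.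
Definition mixing_time (eps : R) : R :=
  sup [set hit_time eps x | x in [set x | in_support x]]%classic.

End TwoSpin.

Definition antiferro {R : realType} (beta gamma lambda : R) :=
  [/\ 0 <= beta, beta <= gamma, 0 < gamma, 0 < lambda & beta * gamma < 1].

Definition Fd {R : realType} (beta gamma lambda : R) (d : nat) (x : R) : R :=
  lambda * ((beta * x + 1) / (x + gamma)) ^+ d.

Definition d_unique {R : realType} (beta gamma lambda : R) (d : nat) (delta : R) :=
  exists xh : R, [/\ 0 < xh, Fd beta gamma lambda d xh = xh,
    (forall y, 0 < y -> Fd beta gamma lambda d y = y -> y = xh) &
    d%:R * (1 - beta * gamma) * xh / ((beta * xh + 1) * (xh + gamma)) <= 1 - delta].

Definition uniqueness_criterion {R : realType} (V : finType) (e : rel V)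
    (beta gamma lambda delta : R) :=
  (3 <= max_deg e)%N /\
  ((gamma <= 1 /\ d_unique beta gamma lambda (max_deg e).-1 delta) \/
   (1 < gamma /\ d_unique beta gamma lambda (max_deg e).-1 delta /\
    regular e (max_deg e))).

Definition alpha_param {R : realType} (beta gamma : R) : R :=
  if beta == 0 then gamma + gamma^-1 + 2 else beta^-1 + 2.

(* Main.v *)
(* After the change of variables b = beta gamma, the plus spins (or, when the
   fixed point xh satisfies beta xh^2 > gamma, the minus spins) form a
   repulsive lattice gas with weights b^(edges inside A) prod_(v in A) r_v,
   r_v <= Lam, for which the uniqueness gap reads D h(xh) <= 1 - delta with
   b xh^2 <= 1 and h(x) = (1 - b) x / ((b x + 1)(x + 1)).

   The tree recursion contracts in the potential sqrt(h), which bounds the total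
   influence of every site in every pinned or thinned gas by a constant over
   delta.  Integrating along exponential tilts turns this spectral independence
   into entropic independence with constant kappa = O(1 / delta).  Thinning the
   gas to activities th r while revealing a random set of occupied sites then
   costs a factor th^(-kappa) in entropy (field dynamics), and at a small
   universal th the gas is subcritical, so that entropy tensorizes there by
   revealing sites one at a time and comparing with Dobrushin's method.  Local
   entropies only decrease under thinning and pinning, so entropy tensorizes for
   the original system with constant exp(O(1 / delta)); this gives both the
   modified log-Sobolev inequality and entropy decay of the discrete-time
   dynamics, hence the mixing time through a Pinsker-type inequality. *)
Require Import Defs.
From HB Require Import structures.
From mathcomp Require Import boolp classical_sets reals sequences exp.
From mathcomp Require Import topology normedtype derive realfun.
From mathcomp Require Import all_boot all_order all_algebra.
From mathcomp Require Import ring lra.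
Set Implicit Arguments. Unset Strict Implicit. Unset Printing Implicit Defensive.
Import Order.TTheory GRing.Theory Num.Theory.
Import numFieldNormedType.Exports.
Local Open Scope ring_scope.

(** * Elementary inequalities and the lattice gas *)

(** Degrees are unbounded and activities may be arbitrarily small, so a loss of any power of the
    degree or of the least marginal would be fatal. The substitute is the bound
    [D%:R * (1 - b) * Lam <= 10 * expR 5], forced by the gap together with [b * xh ^+ 2 <= 1]: it
    makes marginals comparable to activities up to a universal factor, and error terms are kept
    relative to the activity of their site. For the same reason deviations of occupation
    probabilities are measured by the Poisson form [xi]. The contraction is proved for activities up
    to [Lam * expR (delta / 2)]; this slack is the room for the upward tilts of entropic
    independence, and sites whose density ratio would need a larger tilt are treated by a
    Poisson-type comparison. Hard constraints ([b = 0]) are allowed throughout. Entropies are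
    therefore left unnormalised ([gasEnt], [locEnt], [twoEnt]), so that pinning to a set of weight
    zero contributes zero. *)

Section RealInequalities.
Variable R : realType.
Implicit Types x y a b : R.

(** The relative entropy between Poisson variables of means [x] and [m] is [m * xi (x / m)], a form
    that suits rarely occupied sites. *)
Definition xi x : R := x * ln x - x + 1.

Lemma ln_le_subr1 x : 0 < x -> ln x <= x - 1.
Proof.
move=> x0; have -> : x = 1 + (x - 1) by ring.
by apply: le_trans (le_ln1Dx _) _; lra.
Qed.

Lemma xi_ge0 x : 0 <= x -> 0 <= xi x.
Proof.
rewrite /xi le_eqVlt => /predU1P[<-|x0]; first by rewrite mul0r; lra.
have h := ln_le_subr1 (x := x^-1); rewrite invr_gt0 in h.
have {h} := h x0; rewrite lnV ?posrE// => h.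
have : x * (1 - x^-1) <= x * ln x by rewrite ler_pM2l//; lra.
by rewrite mulrBr mulr1 divff ?gt_eqF//; lra.
Qed.

Lemma xi_le_sqr x : 0 <= x -> xi x <= (x - 1) ^+ 2.
Proof.
rewrite /xi le_eqVlt => /predU1P[<-|x0].
  by rewrite mul0r; lra.
have := ln_le_subr1 x0 => h.
have : x * ln x <= x * (x - 1) by rewrite ler_pM2l.
by rewrite expr2; lra.
Qed.

(* [xi x >= (sqrt x - 1)^2], from [ln y <= y - 1] at [y = 1 / sqrt x]. *)
Lemma dist1_le_xi x a : 0 <= x -> 0 < a ->
  `|x - 1| <= a + (1 + a^-1) * xi x.
Proof.
move=> x0 a0; set s := Num.sqrt x.
have s0 : 0 <= s by apply: sqrtr_ge0.
have sx : s ^+ 2 = x by rewrite sqr_sqrtr.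
have key : (s - 1) ^+ 2 <= xi x.
  move: x0; rewrite le_eqVlt => /predU1P[x0|x0].
    have s00 : s = 0 by rewrite /s -x0 sqrtr0.
    by rewrite s00 -x0 /xi mul0r; lra.
  have sp : 0 < s by rewrite sqrtr_gt0.
  have := ln_le_subr1 (x := s^-1); rewrite invr_gt0 => /(_ sp).
  rewrite lnV ?posrE// => h.
  have -> : xi x = 2 * s ^+ 2 * ln s - s ^+ 2 + 1.
    by rewrite /xi -sx lnXn// mulr2n; ring.
  have : s ^+ 2 * (1 - s^-1) <= s ^+ 2 * ln s.
    by rewrite ler_pM2l ?exprn_gt0//; lra.
  have -> : s ^+ 2 * (1 - s^-1) = s ^+ 2 - s by field; rewrite gt_eqF.
  by rewrite !expr2; lra.
apply: le_trans (_ : a + (1 + a^-1) * (s - 1) ^+ 2 <= _); last first.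
  by rewrite lerD2l ler_wpM2l// addr_ge0// invr_ge0 ltW.
have -> : x - 1 = (s - 1) * (s - 1 + 2) by rewrite -sx; ring.
rewrite normrM; set t := `|s - 1|.
have t2 : (s - 1) ^+ 2 = t ^+ 2 by rewrite /t real_normK// num_real.
have t0 : 0 <= t by apply: normr_ge0.
apply: le_trans (_ : t * (t + 2) <= _).
  by rewrite ler_wpM2l// (le_trans (ler_normD _ _))// /t (@ger0_norm _ 2).
rewrite t2 -subr_ge0.
have -> : a + (1 + a^-1) * t ^+ 2 - t * (t + 2) = a^-1 * (t - a) ^+ 2.
  by field; rewrite gt_eqF.
by rewrite mulr_ge0 ?sqr_ge0// invr_ge0 ltW.
Qed.

End RealInequalities.

Section Gas.
Variables (R : realType) (V : finType) (e : rel V) (b : R).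
Implicit Types (r : V -> R) (A B : {set V}) (F : {set V} -> R) (u v w : V).

Definition nbrs_in A v : nat := #|[set u in A | e v u]|.
Definition edges_in A : nat := #|[set E in edges e | E \subset A]|.

(* Unnormalised weight of the repulsive lattice gas: [A] is the set of occupied
   sites, [r] the activities. *)
Definition gasW r A : R := (\prod_(v in A) r v) * b ^+ edges_in A.
Definition gasM r F : R := \sum_A gasW r A * F A.
Definition gasZ r : R := \sum_A gasW r A.
Definition vacate r v : V -> R := fun u => if u == v then 0 else r u.
(** Conditioning on [v] occupied leaves a gas on the other sites in which each neighbour of [v] pays
    a factor [b]. The activity of [v] becomes 0, so [v] has to be put back by hand, as [v |: A]. *)
Definition occupy r v : V -> R :=
  fun u => if u == v then 0 else r u * b ^+ e v u.

Hypotheses (esym : symmetric e) (eirr : irreflexive e).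
Hypotheses (b_ge0 : 0 <= b) (b_lt1 : b < 1).

Lemma set2_eqr v u u' : u != v -> [set v; u] = [set v; u'] -> u = u'.
Proof.
move=> uv E; have : u \in [set v; u'] by rewrite -E set22.
by rewrite !inE (negPf uv) => /eqP.
Qed.

Lemma edges_inU v B : v \notin B ->
  edges_in (v |: B) = (edges_in B + nbrs_in B v)%N.
Proof.
move=> vB.
pose N := [set u in B | e v u].
have -> : nbrs_in B v = #|[set [set v; u] | u in N]|.
  rewrite card_in_imset// => u u'; rewrite !inE => /andP[uB _] _.
  by apply: set2_eqr; apply: contraNneq vB => <-.
rewrite /edges_in -cardsUI; set I := (_ :&: _).
have -> : I = set0.
  apply/setP => E; rewrite !inE; apply/negP => /andP[/andP[_ /subsetP EB]].
  move=> /imsetP[u _ EE]; move: vB; apply/negP; rewrite negbK.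
  by apply: EB; rewrite EE set21.
rewrite cards0 addn0; congr #|pred_of_set _|; apply/setP => E; rewrite !inE.
apply/andP/orP => [[Ee EB]|[/andP[Ee EB]|]].
- have [vE|vE] := boolP (v \in E); last first.
    left; rewrite Ee; apply/subsetP => x xE.
    have := subsetP EB _ xE; rewrite !inE => /predU1P[xv|//].
    by rewrite xv (negPf vE) in xE.
  right; move: Ee => /existsP[x /existsP[y /andP[xy /eqP EE]]].
  have ne : x != y by apply: contraTneq xy => ->; rewrite eirr.
  move: vE; rewrite EE !inE => /orP[] /eqP vx; subst.
    have yB : y \in B.
      have := subsetP EB y; rewrite !inE eqxx orbT => /(_ isT).
      by rewrite eq_sym (negPf ne).
    by apply/imsetP; exists y => //; rewrite !inE yB.
  have xB : x \in B.
    have := subsetP EB x; rewrite !inE eqxx => /(_ isT).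
    by rewrite (negPf ne).
  apply/imsetP; exists x; first by rewrite !inE xB esym.
  by rewrite setUC.
- by split=> //; apply: subset_trans EB (subsetUr _ _).
- move=> /imsetP[u]; rewrite !inE => /andP[uB vu] ->; split.
    by apply/existsP; exists v; apply/existsP; exists u; rewrite vu eqxx.
  by rewrite subUset !sub1set !inE eqxx uB orbT.
Qed.

Lemma edges_in0 : edges_in set0 = 0%N.
Proof.
apply/eqP; rewrite cards_eq0; apply/eqP/setP => E; rewrite !inE.
apply/negP => /andP[/existsP[x /existsP[y /andP[_ /eqP ->]]]].
by move=> /subsetP/(_ x); rewrite !inE eqxx => /(_ isT).
Qed.

Lemma gasW0 r : gasW r set0 = 1.
Proof. by rewrite /gasW big_set0 edges_in0 mulr1. Qed.

Lemma gasWU r v B : v \notin B ->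
  gasW r (v |: B) = gasW r B * (r v * b ^+ nbrs_in B v).
Proof.
move=> vB; rewrite /gasW big_setU1//= edges_inU// exprD.
by move: (\prod_(i in B) _) (b ^+ edges_in B) (b ^+ nbrs_in B v) => x y z; ring.
Qed.

Lemma gasW_ge0 r A : (forall v, 0 <= r v) -> 0 <= gasW r A.
Proof. by move=> r0; rewrite mulr_ge0 ?prodr_ge0 ?exprn_ge0. Qed.

Lemma gasW_eq0 r v A : r v = 0 -> v \in A -> gasW r A = 0.
Proof. by move=> rv vA; rewrite /gasW (bigD1 v)//= rv !mul0r. Qed.

Lemma eq_gasW r r' A : {in A, r =1 r'} -> gasW r A = gasW r' A.
Proof. by move=> rr'; congr (_ * _); apply: eq_bigr. Qed.

Lemma gasW_vacate r v A : v \notin A -> gasW (vacate r v) A = gasW r A.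
Proof.
move=> vA; apply: eq_gasW => u uA; rewrite /vacate.
by case: eqP => // uv; rewrite uv (negPf vA) in uA.
Qed.

Lemma prod_nbrs v B : v \notin B ->
  \prod_(u in B) b ^+ e v u = b ^+ nbrs_in B v :> R.
Proof.
move=> vB; rewrite prodrXr; congr (_ ^+ _).
rewrite /nbrs_in -sum1_card big_mkcond [RHS]big_mkcond /=.
by apply: eq_bigr => u _; rewrite !inE; case: (u \in B) => //=; case: (e v u).
Qed.

Lemma gasW_occupy r v B : v \notin B ->
  gasW (occupy r v) B = gasW r B * b ^+ nbrs_in B v.
Proof.
move=> vB; rewrite -prod_nbrs// /gasW mulrAC -big_split/=; congr (_ * _).
apply: eq_bigr => u uB; rewrite /occupy; case: eqP => // uv.
by rewrite uv (negPf vB) in uB.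
Qed.

Lemma sum_split_vertex (T : nmodType) v (G : {set V} -> T) :
  \sum_A G A = \sum_(B : {set V} | v \notin B) (G B + G (v |: B)).
Proof.
rewrite (bigID (fun A : {set V} => v \notin A))/= big_split/=; congr (_ + _).
rewrite (reindex_onto (fun B : {set V} => v |: B) (fun A : {set V} => A :\ v))/=; last first.
  by move=> A; rewrite negbK => vA; rewrite setD1K.
apply: eq_bigl => B; rewrite negbK setU11/=.
apply/eqP/idP => [<-|vB]; first by rewrite setD11.
by rewrite setU1K.
Qed.

Lemma gasM_split r F v :
  gasM r F = gasM (vacate r v) F
             + r v * gasM (occupy r v) (fun A => F (v |: A)).
Proof.
rewrite /gasM !(sum_split_vertex v) mulr_sumr -big_split/=.
apply: eq_bigr => B vB; rewrite gasW_vacate//.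
rewrite (@gasW_eq0 (vacate r v) v); last 2 first.
- by rewrite /vacate eqxx.
- exact: setU11.
rewrite (@gasW_eq0 (occupy r v) v (v |: B)); last 2 first.
- by rewrite /occupy eqxx.
- exact: setU11.
rewrite gasW_occupy// gasWU//.
by move: (b ^+ nbrs_in B v) (gasW r B) => x y; ring.
Qed.

Lemma gasZE r : gasZ r = gasM r (fun=> 1).
Proof. by apply: eq_bigr => A _; rewrite mulr1. Qed.

Lemma gasZ_split r v :
  gasZ r = gasZ (vacate r v) + r v * gasZ (occupy r v).
Proof. by rewrite !gasZE (gasM_split _ _ v). Qed.

Lemma eq_gasM r r' F F' : r =1 r' -> F =1 F' -> gasM r F = gasM r' F'.
Proof.
move=> rr' FF'; apply: eq_bigr => A _; rewrite FF'; congr (_ * _).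
by apply: eq_gasW => v _.
Qed.

Lemma eq_gasZ r r' : r =1 r' -> gasZ r = gasZ r'.
Proof. by move=> rr'; rewrite !gasZE; apply: eq_gasM. Qed.

Lemma gasM_ge0 r F : (forall v, 0 <= r v) -> (forall A, 0 <= F A) ->
  0 <= gasM r F.
Proof. by move=> r0 F0; apply: sumr_ge0 => A _; rewrite mulr_ge0 ?gasW_ge0. Qed.

Lemma ler_gasM r F G : (forall v, 0 <= r v) -> (forall A, F A <= G A) ->
  gasM r F <= gasM r G.
Proof.
by move=> r0 FG; apply: ler_sum => A _; rewrite ler_wpM2l ?gasW_ge0.
Qed.

Lemma gasM_gt0 r F : (forall v, 0 <= r v) -> (forall A, 0 < F A) -> 0 < gasM r F.
Proof.
move=> r0 F0; rewrite /gasM (bigD1 set0)//= gasW0 mul1r.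
rewrite ltr_wpDr// sumr_ge0// => A _.
by rewrite mulr_ge0 ?gasW_ge0 ?ltW.
Qed.

Lemma gasZ_gt0 r : (forall v, 0 <= r v) -> 0 < gasZ r.
Proof. by move=> r0; rewrite gasZE; apply: gasM_gt0. Qed.

Lemma gasMD r F G : gasM r (fun A => F A + G A) = gasM r F + gasM r G.
Proof. by rewrite -big_split/=; apply: eq_bigr => A _; rewrite mulrDr. Qed.

Lemma gasMB r F G : gasM r (fun A => F A - G A) = gasM r F - gasM r G.
Proof. by rewrite -sumrB; apply: eq_bigr => A _; rewrite mulrBr. Qed.

Lemma gasMZ r c F : gasM r (fun A => c * F A) = c * gasM r F.
Proof. by rewrite mulr_sumr; apply: eq_bigr => A _; rewrite mulrCA. Qed.

Lemma gasM_sum (I : finType) r (F : I -> {set V} -> R) :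
  gasM r (fun A => \sum_i F i A) = \sum_i gasM r (F i).
Proof.
by rewrite /gasM exchange_big/=; apply: eq_bigr => A _; rewrite mulr_sumr.
Qed.

Lemma vacate_ge0 r v : (forall v, 0 <= r v) -> forall u, 0 <= vacate r v u.
Proof. by move=> r0 u; rewrite /vacate; case: eqP. Qed.

Lemma occupy_ge0 r v : (forall v, 0 <= r v) -> forall u, 0 <= occupy r v u.
Proof.
by move=> r0 u; rewrite /occupy; case: eqP => // _; rewrite mulr_ge0 ?exprn_ge0.
Qed.

Lemma vacate_le r v u : (forall v, 0 <= r v) -> vacate r v u <= r u.
Proof. by move=> r0; rewrite /vacate; case: eqP. Qed.

Lemma occupy_le r v u : (forall v, 0 <= r v) -> occupy r v u <= r u.
Proof.
move=> r0; rewrite /occupy; case: eqP => // _.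
by rewrite ler_piMr// exprn_ile1// ltW.
Qed.

End Gas.

(** * Contraction of the tree recursion *)

Section Contraction.
Variable R : realType.
Variables (b : R) (D : nat) (Lam xh delta : R).
Hypotheses (b_ge0 : 0 <= b) (b_lt1 : b < 1).

(* Influence of an edge on a neighbour with odds [x]. *)
Definition hfun (x : R) : R := (1 - b) * x / ((b * x + 1) * (x + 1)).

Lemma hfun0 : hfun 0 = 0. Proof. by rewrite /hfun mulr0 mul0r. Qed.

Lemma bx1_gt0 (x : R) : 0 <= x -> 0 < b * x + 1.
Proof. by move=> x0; rewrite ltr_wpDl// mulr_ge0. Qed.

Lemma x1_gt0 (x : R) : 0 <= x -> 0 < x + 1.
Proof. by move=> x0; rewrite ltr_wpDl. Qed.

Lemma hfun_ge0 (x : R) : 0 <= x -> 0 <= hfun x.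
Proof.
move=> x0; rewrite divr_ge0 ?mulr_ge0 ?(ltW (bx1_gt0 x0)) ?(ltW (x1_gt0 x0))//.
by rewrite subr_ge0 ltW.
Qed.

Lemma hfun_le (x : R) : 0 <= x -> hfun x <= (1 - b) * x.
Proof.
move=> x0; rewrite ler_pdivrMr ?mulr_gt0 ?bx1_gt0 ?x1_gt0//.
rewrite ler_peMr//; first by rewrite mulr_ge0// subr_ge0 ltW.
have := mulr_ge0 b_ge0 x0; have := mulr_ge0 (mulr_ge0 b_ge0 x0) x0; lra.
Qed.

(** The coordinate in which the tree recursion is additive: the logarithm of the parent's odds is
    that of its activity minus the sum of [logratio] over its children. *)
Definition logratio (x : R) : R := ln ((x + 1) / (b * x + 1)).

Lemma logratio0 : logratio 0 = 0.
Proof. by rewrite /logratio mulr0 !add0r divr1 ln1. Qed.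

Hypotheses (D_ge2 : (2 <= D)%N) (delta01 : 0 < delta < 1).
Hypotheses (xh_gt0 : 0 < xh) (Lam_gt0 : 0 < Lam).
Hypothesis xh_fix : xh = Lam * ((b * xh + 1) / (xh + 1)) ^+ D.
Hypothesis xh_gap : D%:R * hfun xh <= 1 - delta.
Hypothesis xh_small : b * xh ^+ 2 <= 1.

(** The derivative at [xh] of [hfun] in the coordinate [logratio], and also that of [ln (hfun x)] in
    [ln x]. Their agreement makes children and parent cancel in [contraction]; [b * xh ^+ 2 <= 1]
    makes it nonnegative. *)
Definition slope : R := (1 - b * xh ^+ 2) / ((b * xh + 1) * (xh + 1)).

Let xh0 : 0 <= xh. Proof. exact: ltW. Qed.
Let bxh : 0 < b * xh + 1. Proof. exact: bx1_gt0. Qed.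
Let xh1 : 0 < xh + 1. Proof. exact: x1_gt0. Qed.

Lemma slope_ge0 : 0 <= slope.
Proof.
by rewrite divr_ge0 ?mulr_ge0 ?(ltW bxh) ?(ltW xh1)// subr_ge0.
Qed.

Lemma slope_le1 : slope <= 1.
Proof.
rewrite ler_pdivrMr ?mulr_gt0// mul1r.
have := mulr_ge0 b_ge0 xh0; have := mulr_ge0 (mulr_ge0 b_ge0 xh0) xh0.
by move: xh0; rewrite expr2; lra.
Qed.

(* In the coordinate [u = logratio x], [hfun] is the concave function
   [(1 + b - e^-u - b e^u) / (1 - b)]. *)
Lemma hfun_tangent (y : R) : 0 <= y ->
  hfun y <= hfun xh + slope * (logratio y - logratio xh).
Proof.
move=> y0; have by1 := bx1_gt0 y0; have y1 := x1_gt0 y0.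
have b1 : 1 - b != 0 by rewrite subr_eq0 gt_eqF.
set s := logratio y - logratio xh.
pose a := (y + 1) / (b * y + 1); pose a' := (xh + 1) / (b * xh + 1).
have a0 : 0 < a by rewrite divr_gt0.
have a'0 : 0 < a' by rewrite divr_gt0.
have aE : a = a' * expR s.
  rewrite expRB /logratio !lnK ?posrE// -/a -/a'.
  by field; rewrite gt_eqF.
have hE : hfun y = (1 + b - a^-1 - b * a) / (1 - b).
  by rewrite /hfun /a; field; rewrite b1 !gt_eqF.
have hE' : hfun xh = (1 + b - a'^-1 - b * a') / (1 - b).
  by rewrite /hfun /a'; field; rewrite b1 !gt_eqF.
have sE : slope = (a'^-1 - b * a') / (1 - b).
  by rewrite /slope /a'; field; rewrite b1 !gt_eqF.
clearbody a a' s; rewrite hE hE' sE mulrAC -mulrDl ler_pM2r ?invr_gt0 ?subr_gt0//.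
have h1 : a'^-1 * (1 - s) <= a^-1.
  rewrite aE [leRHS]invfM -expRN ler_pM2l ?invr_gt0//.
  exact: expR_ge1Dx.
have h2 : b * a' * (1 + s) <= b * a.
  by rewrite aE [leRHS]mulrA ler_wpM2l ?mulr_ge0 ?(ltW a'0)//; exact: expR_ge1Dx.
lra.
Qed.

(** In the coordinate [s], [(1 - b) / hfun] is a nonnegative combination of the exponentials of [s],
    [0] and [- s], hence log-convex. So [ln (hfun x)] is concave in [ln x], and this is its tangent
    at [xh]. *)
Lemma hfun_log_tangent (s : R) :
  hfun (xh * expR s) <= hfun xh * expR (slope * s).
Proof.
have b1 : 0 < 1 - b by rewrite subr_gt0.
set x := xh * expR s; have x0 : 0 < x by rewrite mulr_gt0 ?expR_gt0.
pose den (y : R) := b * y + (1 + b) + y^-1.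
have hE y : 0 < y -> hfun y = (1 - b) / den y.
  move=> y0; have := bx1_gt0 (ltW y0); have := x1_gt0 (ltW y0) => k1 k2.
  rewrite /hfun /den; field; rewrite !gt_eqF//=.
  have := mulr_ge0 b_ge0 (ltW (mulr_gt0 y0 y0)).
  by have := mulr_ge0 b_ge0 (ltW y0); lra.
have den0 y : 0 < y -> 0 < den y.
  move=> y0; rewrite ltr_wpDl ?invr_gt0// ?addr_ge0 ?mulr_ge0//.
  exact: ltW.
rewrite !hE// -mulrA ler_pM2l// -[expR _]invrK -expRN -invfM.
rewrite lef_pV2 ?posrE ?mulr_gt0 ?den0 ?expR_gt0//.
(* [m] is the mean of the exponents [s], [0], [- s] under the weights [b * xh], [1 + b], [xh^-1], so
   the first-order terms of the three tangents cancel, as in Jensen's inequality. *)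
set m := - (slope * s).
have sE : b * xh - xh^-1 = - (slope * den xh).
  by rewrite /slope /den; field; rewrite !gt_eqF.
have tg z : expR m * (1 + (z - m)) <= expR z.
  have -> : expR z = expR m * expR (z - m) by rewrite -expRD addrC subrK.
  by rewrite ler_pM2l ?expR_gt0//; exact: expR_ge1Dx.
have -> : den x = b * xh * expR s + (1 + b) * expR 0 + xh^-1 * expR (- s).
  by rewrite /den /x expR0 invfM -expRN; ring.
have h1 : b * xh * (expR m * (1 + (s - m))) <= b * xh * expR s.
  by rewrite ler_wpM2l ?mulr_ge0.
have h2 : (1 + b) * (expR m * (1 + (0 - m))) <= (1 + b) * expR 0.
  by rewrite ler_wpM2l ?addr_ge0.
have h3 : xh^-1 * (expR m * (1 + (- s - m))) <= xh^-1 * expR (- s).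
  by rewrite ler_pM2l ?invr_gt0.
have -> : den xh * expR m =
    b * xh * (expR m * (1 + (s - m))) + (1 + b) * (expR m * (1 + (0 - m)))
    + xh^-1 * (expR m * (1 + (- s - m))).
  have -> : b * xh * (expR m * (1 + (s - m)))
      + (1 + b) * (expR m * (1 + (0 - m)))
      + xh^-1 * (expR m * (1 + (- s - m)))
    = expR m * (den xh * (1 - m) + s * (b * xh - xh^-1)).
    by rewrite /den; ring.
  by rewrite sE /m; ring.
lra.
Qed.

Lemma sum_sqr_le (xs : seq R) (F : R -> R) : (size xs <= D)%N ->
  (\sum_(y <- xs) F y) ^+ 2 <= D%:R * \sum_(y <- xs) F y ^+ 2.
Proof.
move=> sz; set s := \sum_(y <- xs) F y; set T := \sum_(y <- xs) _.
have D0 : 0 < D%:R :> R by rewrite ltr0n; case: D D_ge2.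
set c := s / D%:R.
have key : 2 * c * s <= (size xs)%:R * c ^+ 2 + T.
  rewrite /s /T -sum1_size natr_sum mulr_sumr mulr_suml -big_split/=.
  apply: ler_sum => y _; rewrite mul1r -subr_ge0.
  by have -> : c ^+ 2 + F y ^+ 2 - 2 * c * F y = (c - F y) ^+ 2;
     [ring|rewrite sqr_ge0].
have k2 : (size xs)%:R * c ^+ 2 <= D%:R * c ^+ 2.
  by rewrite ler_wpM2r ?sqr_ge0// ler_nat.
have sE : s = c * D%:R by rewrite /c divfK ?gt_eqF.
have k3 : D%:R * c ^+ 2 <= T by move: key k2; rewrite sE; lra.
by rewrite sE; have := ler_wpM2l (ltW D0) k3; lra.
Qed.

Lemma sum_hfun_tangent (xs : seq R) : (size xs <= D)%N ->
  {in xs, forall y, 0 <= y} ->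
  \sum_(y <- xs) hfun y <=
    D%:R * hfun xh + slope * (\sum_(y <- xs) logratio y - D%:R * logratio xh).
Proof.
move=> sz xs0.
have k1 : \sum_(y <- xs) hfun y <= (size xs)%:R * hfun xh
    + slope * (\sum_(y <- xs) logratio y - (size xs)%:R * logratio xh).
  rewrite -sum1_size natr_sum !mulr_suml -sumrB mulr_sumr -big_split/=.
  by rewrite big_seq [leRHS]big_seq; apply: ler_sum => y /xs0 y0;
     rewrite !mul1r; apply: hfun_tangent.
have k2 := hfun_tangent (lexx 0); rewrite hfun0 logratio0 in k2.
(* The tangent inequality at 0 ([k2]) lets absent children be counted as children with odds 0. *)
have k3 : 0 <= (D%:R - (size xs)%:R) * (hfun xh - slope * logratio xh).
  by rewrite mulr_ge0 ?subr_ge0 ?ler_nat//; lra.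
lra.
Qed.

(** Cauchy-Schwarz reduces the square to [D * T]. The two tangents give [T <= 1 + q] and [hfun x <=
    hfun xh * expR (delta / 2) * expR (- q)] with the same [q], and [(1 + q) * expR (- q) <= 1].
    What remains is at most [(1 - delta) * expR (delta / 2)]. *)
Lemma contraction (xs : seq R) (x : R) : (size xs <= D)%N ->
  {in xs, forall y, 0 <= y} -> 0 <= x ->
  x <= Lam * expR (delta / 2) * \prod_(y <- xs) ((b * y + 1) / (y + 1)) ->
  hfun x * (\sum_(y <- xs) Num.sqrt (hfun y)) ^+ 2 <= expR (- (delta / 2)).
Proof.
move=> sz xs0; rewrite le_eqVlt => /predU1P[<- _|x0 xle].
  by rewrite hfun0 mul0r expR_ge0.
have [d0 d1] := andP delta01.
set T := \sum_(y <- xs) hfun y; set U := \sum_(y <- xs) logratio y.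
have k1 : (\sum_(y <- xs) Num.sqrt (hfun y)) ^+ 2 <= D%:R * T.
  apply: le_trans (sum_sqr_le _ sz) _; rewrite ler_wpM2l//.
  rewrite /T big_seq [leRHS]big_seq; apply: ler_sum => y /xs0 y0.
  by rewrite sqr_sqrtr// hfun_ge0.
set q := slope * (U - D%:R * logratio xh).
have k2 : T <= D%:R * hfun xh + q by apply: sum_hfun_tangent.
have prodE : \prod_(y <- xs) ((b * y + 1) / (y + 1)) = expR (- U).
  rewrite /U -sumrN expR_sum big_seq [RHS]big_seq.
  apply: eq_bigr => y /xs0 y0; have := bx1_gt0 y0; have := x1_gt0 y0 => *.
  by rewrite expRN /logratio lnK ?posrE ?divr_gt0// invf_div.
have LamE : Lam = xh * expR (D%:R * logratio xh).
  rewrite {1}xh_fix expRM_natl /logratio lnK ?posrE ?divr_gt0//.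
  rewrite -mulrA -exprMn; have -> : (b * xh + 1) / (xh + 1) *
    ((xh + 1) / (b * xh + 1)) = 1 by field; rewrite !gt_eqF.
  by rewrite expr1n mulr1.
pose s := ln (x / xh).
have xE : x = xh * expR s by rewrite /s lnK ?posrE ?divr_gt0// mulrC divfK ?gt_eqF.
have sle : s <= D%:R * logratio xh + delta / 2 - U.
  rewrite -ler_expR expRD expRD -(ler_pM2l xh_gt0) -xE.
  by rewrite prodE LamE in xle; rewrite !mulrA.
have h1 : hfun x <= hfun xh * (expR (delta / 2) * expR (- q)).
  rewrite xE; apply: le_trans (hfun_log_tangent s) _.
  rewrite ler_wpM2l ?hfun_ge0// -expRD ler_expR.
  have := ler_wpM2l slope_ge0 sle; rewrite /q.
  have : slope * (delta / 2) <= delta / 2.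
    by rewrite ler_piMl ?slope_le1// divr_ge0// ltW.
  lra.
have T0 : 0 <= T.
  by rewrite /T big_seq; apply: sumr_ge0 => y /xs0; apply: hfun_ge0.
have D0 : 0 <= D%:R :> R by [].
have hx0 : 0 <= hfun xh by apply: hfun_ge0.
apply: le_trans (_ : hfun x * (D%:R * T) <= _).
  by rewrite ler_wpM2l// hfun_ge0// ltW.
have k3 : T * expR (- q) <= 1.
  apply: le_trans (_ : (1 + q) * expR (- q) <= _).
    rewrite ler_wpM2r ?expR_ge0//; apply: le_trans k2 _.
    by rewrite lerD2r (le_trans xh_gap)//; lra.
  apply: le_trans (_ : expR q * expR (- q) <= _).
    by rewrite ler_wpM2r ?expR_ge0// expR_ge1Dx.
  by rewrite -expRD subrr expR0.
apply: le_trans (_ : hfun xh * (expR (delta / 2) * expR (- q)) * (D%:R * T) <= _).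
  by rewrite ler_wpM2r// mulr_ge0.
have -> : hfun xh * (expR (delta / 2) * expR (- q)) * (D%:R * T)
  = (D%:R * hfun xh) * expR (delta / 2) * (T * expR (- q)) by ring.
apply: le_trans (_ : (1 - delta) * expR (delta / 2) * 1 <= _).
  apply: ler_pM k3; last by rewrite ler_wpM2r ?expR_ge0.
    exact: mulr_ge0 (mulr_ge0 D0 hx0) (expR_ge0 _).
  exact: mulr_ge0 T0 (expR_ge0 _).
rewrite mulr1; apply: le_trans (_ : expR (- delta) * expR (delta / 2) <= _).
  by rewrite ler_wpM2r ?expR_ge0// expR_ge1Dx.
by rewrite -expRD ler_expR; lra.
Qed.

(** Since [D >= 2], the gap gives [2 * hfun xh <= 1]. If [xh > 4], then [b * xh ^+ 2 <= 1] forces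
    [b * xh <= 1 / 4], and the inequality becomes a bound on [xh] below 4. *)
Lemma xh_le4 : xh <= 4.
Proof.
have [//|x4] := leP xh 4; exfalso.
have [d0 d1] := andP delta01.
have h2 : 2 * hfun xh <= 1.
  apply: le_trans (_ : D%:R * hfun xh <= _); last by move: xh_gap; lra.
  by rewrite ler_wpM2r ?hfun_ge0// ler_nat.
have : 2 * ((1 - b) * xh) <= (b * xh + 1) * (xh + 1).
  have -> : (1 - b) * xh = hfun xh * ((b * xh + 1) * (xh + 1)).
    by rewrite /hfun; field; rewrite !gt_eqF.
  have den0 : 0 <= (b * xh + 1) * (xh + 1).
    exact: mulr_ge0 (ltW bxh) (ltW xh1).
  by have := ler_wpM2r den0 h2; rewrite mul1r -[X in X <= _ -> _]mulrA.
have bx : b * xh <= 4^-1.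
  have : b * xh * 4 <= b * xh * xh by rewrite ler_wpM2l ?mulr_ge0// ltW.
  by move: xh_small; rewrite expr2; lra.
by move: xh_small x4; rewrite expr2; lra.
Qed.

(** Inverting the fixed point equation, [Lam / xh] is the [D]-th power of [1 + hfun xh * (xh + 1)].
    As [D * hfun xh <= 1], it is at most [expR (xh + 1)], and 5 is 4 + 1. *)
Lemma Lam_le_xh : Lam <= xh * expR 5.
Proof.
have [d0 d1] := andP delta01; have x4 := xh_le4.
have D0 : 0 <= D%:R :> R by [].
have -> : Lam = xh * ((xh + 1) / (b * xh + 1)) ^+ D.
  rewrite {1}xh_fix -mulrA -exprMn.
  have -> : (b * xh + 1) / (xh + 1) * ((xh + 1) / (b * xh + 1)) = 1.
    by field; rewrite !gt_eqF.
  by rewrite expr1n mulr1.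
rewrite ler_pM2l//.
have -> : (xh + 1) / (b * xh + 1) = 1 + hfun xh * (xh + 1).
  by rewrite /hfun; field; rewrite !gt_eqF.
apply: le_trans (_ : expR (hfun xh * (xh + 1)) ^+ D <= _).
  apply: lerXn2r; rewrite ?nnegrE ?expR_ge0 ?expR_ge1Dx//.
  exact: addr_ge0 ler01 (mulr_ge0 (hfun_ge0 xh0) (ltW xh1)).
rewrite -expRM_natl ler_expR mulrA.
apply: le_trans (_ : 1 * (xh + 1) <= _); last lra.
by rewrite ler_wpM2r ?(ltW xh1)//; move: xh_gap; lra.
Qed.

Lemma Lam_le : Lam <= 4 * expR 5.
Proof.
by apply: le_trans Lam_le_xh _; rewrite ler_pM2r ?expR_gt0// xh_le4.
Qed.

(** [D * (1 - b) * xh] is [D * hfun xh] times [b * xh ^+ 2 + b * xh + xh + 1], and the latter is at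
    most 1 + 4 + 4 + 1. This degree-free quantity controls the joint effect of all neighbours of a
    site. *)
Lemma D_Lam_le : D%:R * (1 - b) * Lam <= 10 * expR 5.
Proof.
have [d0 d1] := andP delta01; have x4 := xh_le4.
have D0 : 0 <= D%:R :> R by [].
apply: le_trans (_ : D%:R * (1 - b) * (xh * expR 5) <= _).
  by rewrite ler_wpM2l ?Lam_le_xh// mulr_ge0// subr_ge0 ltW.
rewrite mulrA ler_pM2r ?expR_gt0//.
have -> : D%:R * (1 - b) * xh = D%:R * hfun xh * ((b * xh + 1) * (xh + 1)).
  by rewrite /hfun; field; rewrite !gt_eqF.
apply: le_trans (_ : 1 * ((b * xh + 1) * (xh + 1)) <= _).
  by rewrite ler_wpM2r ?mulr_ge0 ?(ltW bxh) ?(ltW xh1)//; move: xh_gap; lra.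
have : b * xh <= xh by rewrite ler_piMl// ltW.
by move: xh_small x4; rewrite expr2; lra.
Qed.

End Contraction.

(** * Total influence *)

Section Influence.
Variables (R : realType) (V : finType) (e : rel V) (b : R).
Implicit Types (r : V -> R) (A B : {set V}) (F : {set V} -> R) (u v w : V).
Hypotheses (esym : symmetric e) (eirr : irreflexive e).
Hypotheses (b_ge0 : 0 <= b) (b_lt1 : b < 1).

Local Notation W := (gasW e b).
Local Notation M := (gasM e b).
Local Notation Z := (gasZ e b).
Local Notation occ := (occupy e b).
Local Notation h := (hfun b).

Definition odds r v : R := r v * Z (occ r v) / Z (vacate r v).
Definition marg r u : R := M r (fun A => (u \in A)%:R) / Z r.
Definition infl r w u : R := marg (occ r w) u - marg (vacate r w) u.
(** The summand 1 stands for the effect of [w] on itself, which [infl] records as 0 because [w] is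
    deleted in both gases. *)
Definition totinf r w : R := 1 + \sum_u `|infl r w u|.
(** Multiplying the neighbours' activities by [b] one at a time leads from [vacate r v] to
    [occupy r v] through one-site changes. *)
Definition scales r (l : seq V) : V -> R := fun u => r u * b ^+ (u \in l).

Lemma eq_marg r r' : r =1 r' -> marg r =1 marg r'.
Proof.
by move=> rr' u; rewrite /marg (eq_gasM e b rr' (frefl _)) (eq_gasZ e b rr').
Qed.

Lemma marg_eq0 r v : r v = 0 -> marg r v = 0.
Proof.
move=> rv; rewrite /marg /gasM big1 ?mul0r// => A _.
by have [vA|vA] := boolP (v \in A); rewrite ?mulr0// (gasW_eq0 e b rv)// mul0r.
Qed.

Lemma infl_self r w : infl r w w = 0.
Proof.
by rewrite /infl !marg_eq0 ?subrr// /occupy /vacate eqxx.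
Qed.

Lemma gasZ_oddsE r w : (forall u, 0 <= r u) ->
  Z r = Z (vacate r w) * (1 + odds r w).
Proof.
move=> r0; have := gasZ_gt0 e b_ge0 (vacate_ge0 w r0) => z0.
rewrite (gasZ_split b esym eirr _ w) /odds.
by field; rewrite gt_eqF.
Qed.

Lemma odds_ge0 r w : (forall u, 0 <= r u) -> 0 <= odds r w.
Proof.
move=> r0; rewrite /odds divr_ge0 ?mulr_ge0//; apply/ltW/gasZ_gt0 => //.
  exact: occupy_ge0.
exact: vacate_ge0.
Qed.

Lemma gasW_le r r' A : (forall u, 0 <= r u <= r' u) -> W r A <= W r' A.
Proof.
move=> rr'; rewrite ler_wpM2r ?exprn_ge0//; apply: ler_prod => u _.
exact: rr'.
Qed.

Lemma odds_le r w : (forall u, 0 <= r u) -> odds r w <= r w.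
Proof.
move=> r0; rewrite /odds ler_pdivrMr ?gasZ_gt0//; last exact: vacate_ge0.
rewrite ler_wpM2l//; apply: ler_sum => A _; apply: gasW_le => u.
rewrite occupy_ge0//= /occupy /vacate; case: eqP => // _.
by rewrite ler_piMr// exprn_ile1// ltW.
Qed.

Lemma marg_split r w u : (forall u, 0 <= r u) ->
  marg r u * (1 + odds r w)
  = marg (vacate r w) u + odds r w * (marg (occ r w) u + (u == w)%:R).
Proof.
move=> r0; have zv := gasZ_gt0 e b_ge0 (vacate_ge0 w r0).
have zo := gasZ_gt0 e b_ge0 (occupy_ge0 e b_ge0 w r0).
have od := odds_ge0 w r0.
rewrite {1}/marg (gasZ_oddsE w r0) invfM mulrA divfK; last first.
  by rewrite gt_eqF// ltr_wpDr.
rewrite (gasM_split b esym eirr r _ w) mulrDl -/(marg _ _); congr (_ + _).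
have -> : M (occ r w) (fun A => (u \in w |: A)%:R)
  = M (occ r w) (fun A => (u \in A)%:R) + (u == w)%:R * Z (occ r w).
  rewrite gasZE -gasMZ -gasMD; apply: eq_bigr => A _.
  have [uw|uw] := eqVneq u w; last by rewrite !inE (negPf uw) mul0r addr0.
  have [wA|wA] := boolP (w \in A).
    by rewrite (gasW_eq0 e b (v := w)) ?mul0r// /occupy eqxx.
  by rewrite uw (negPf wA) setU11 mul1r add0r.
rewrite /odds /marg.
by field; rewrite !gt_eqF.
Qed.

Lemma scales1_vacate r w : vacate (scales r [:: w]) w =1 vacate r w.
Proof.
move=> u; rewrite /vacate /scales inE; case: eqP => // uw.
by rewrite expr0 mulr1.
Qed.

Lemma scales1_occupy r w : occ (scales r [:: w]) w =1 occ r w.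
Proof.
move=> u; rewrite /occupy /scales inE; case: eqP => // uw.
by rewrite expr0 mulr1.
Qed.

Lemma odds_scales1 r w : odds (scales r [:: w]) w = b * odds r w.
Proof.
rewrite /odds (eq_gasZ e b (scales1_vacate r w)).
rewrite (eq_gasZ e b (scales1_occupy r w)) /scales inE eqxx expr1.
by rewrite -!mulrA mulrCA.
Qed.

Lemma scales_ge0 r l : (forall u, 0 <= r u) -> forall u, 0 <= scales r l u.
Proof. by move=> r0 u; rewrite mulr_ge0 ?exprn_ge0. Qed.

Lemma scales_le r l u : (forall u, 0 <= r u) -> scales r l u <= r u.
Proof. by move=> r0; rewrite ler_piMr// exprn_ile1// ltW. Qed.

(** Lowering the odds of [w] from [x] to [b * x] lowers its occupation probability by [x / (1 + x) -
    b * x / (1 + b * x) = hfun x]; every other marginal moves by this amount times the influence of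
    [w]. *)
Lemma marg_scales1 r w u : (forall u, 0 <= r u) ->
  marg (scales r [:: w]) u - marg r u
  = - (h (odds r w) * ((u == w)%:R + infl r w u)).
Proof.
move=> r0; have := marg_split w u r0.
have := marg_split w u (scales_ge0 [:: w] r0).
rewrite odds_scales1 (eq_marg (scales1_vacate r w)) (eq_marg (scales1_occupy r w)).
have := odds_ge0 w r0; rewrite /infl /hfun.
move: (odds r w) (marg (occ r w) u) (marg (vacate r w) u) => x p1 p0 x0.
have bx : 0 <= b * x by rewrite mulr_ge0.
move: (marg _ u) (marg r u) => m' m E' E.
have -> : m = (p0 + x * (p1 + (u == w)%:R)) / (1 + x).
  by rewrite -E mulfK// gt_eqF// ltr_wpDr.
have -> : m' = (p0 + b * x * (p1 + (u == w)%:R)) / (1 + b * x).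
  by rewrite -E' mulfK// gt_eqF// ltr_wpDr.
by field; rewrite !gt_eqF ?ltr_wpDl ?ltr_wpDr.
Qed.

Lemma gasZ_scales1 r w : (forall u, 0 <= r u) ->
  Z (scales r [:: w])
  = Z r * ((b * odds r w + 1) / (odds r w + 1)).
Proof.
move=> r0; rewrite (gasZ_oddsE w r0) (gasZ_oddsE w (scales_ge0 [:: w] r0)).
rewrite odds_scales1 (eq_gasZ e b (scales1_vacate r w)).
by field; rewrite gt_eqF// ltr_wpDl// odds_ge0.
Qed.

Section Telescope.
Variables (r : V -> R) (v0 : V) (l : seq V).
Hypotheses (r0 : forall u, 0 <= r u) (lu : uniq l).

Let act i := scales r (take i l).
Let site i := nth v0 l i.

Lemma scales_take i : (i < size l)%N ->
  act i.+1 =1 scales (act i) [:: site i].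
Proof.
move=> il u; rewrite /act /scales (take_nth v0)// mem_rcons !inE -mulrA -exprD.
congr (_ * _ ^+ _); case: eqP => [->|_]; last by rewrite addn0.
have : nth v0 l i \notin take i l.
  move: lu; rewrite -{1}(cat_take_drop i l) (drop_nth v0)// cat_uniq /=.
  by case/and3P => _; rewrite negb_or => /andP[].
by move/negPf => ->.
Qed.

Let act0 : act 0 =1 r.
Proof. by move=> u; rewrite /act take0 /scales expr0 mulr1. Qed.

Let actl : act (size l) = scales r l.
Proof. by rewrite /act take_size. Qed.

Lemma gasZ_scales : Z (scales r l) =
  Z r * \prod_(0 <= i < size l)
    ((b * odds (act i) (site i) + 1) / (odds (act i) (site i) + 1)).
Proof.
suff gen n : (n <= size l)%N -> Z (act n) = Z r * \prod_(0 <= i < n)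
    ((b * odds (act i) (site i) + 1) / (odds (act i) (site i) + 1)).
  by rewrite -actl; apply: gen.
elim: n => [|n IH] nl; first by rewrite big_geq// mulr1; apply: eq_gasZ.
rewrite big_nat_recr//= mulrA -IH; last exact: ltnW.
by rewrite (eq_gasZ e b (scales_take nl)) gasZ_scales1//; apply: scales_ge0.
Qed.

Lemma sum_marg_scales :
  \sum_u `|marg (scales r l) u - marg r u| <=
  \sum_(0 <= i < size l)
     h (odds (act i) (site i)) * totinf (act i) (site i).
Proof.
have k u : marg (scales r l) u - marg r u =
    \sum_(0 <= i < size l) (marg (act i.+1) u - marg (act i) u).
  by rewrite telescope_sumr// actl (eq_marg act0).
under eq_bigr do rewrite k.
apply: le_trans (_ : \sum_u \sum_(0 <= i < size l)
   `|marg (act i.+1) u - marg (act i) u| <= _).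
  by apply: ler_sum => u _; apply: ler_norm_sum.
rewrite exchange_big/= big_nat_cond [leRHS]big_nat_cond.
apply: ler_sum => i /andP[/andP[_ il] _].
have h0 : 0 <= h (odds (act i) (site i)).
  by apply: hfun_ge0 => //; apply: odds_ge0; apply: scales_ge0.
under eq_bigr => u _.
  rewrite (eq_marg (scales_take il)) marg_scales1; last exact: scales_ge0.
  rewrite normrN normrM (ger0_norm h0); over.
rewrite -mulr_sumr ler_wpM2l// /totinf (bigD1 (site i))//=.
rewrite [X in _ <= _ + X](bigD1 (site i))//= eqxx infl_self addr0 normr0 normr1.
rewrite add0r lerD2l; apply: ler_sum => u /negPf ->.
by rewrite add0r.
Qed.

End Telescope.

(** Dropping neighbours of activity 0 is how a vacated parent disappears from its child's
    neighbourhood, so that the branching number is [Delta.-1]. *)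
Definition active_nbrs r v := [seq w <- enum V | e v w && (r w != 0)].

Lemma occupy_scales r v :
  occ r v =1 scales (vacate r v) (active_nbrs (vacate r v) v).
Proof.
move=> u; rewrite /occupy /scales /vacate mem_filter mem_enum andbT.
have [uv|uv] := eqVneq u v; first by rewrite mul0r.
by have [->|ru] := eqVneq (r u) 0; rewrite ?mul0r// andbT.
Qed.

(** Together with [odds_rec], one level of the tree of self-avoiding walks without building the
    tree: the child [site i] lives in the gas where [v] is deleted and the earlier neighbours are
    already scaled by [b]. *)
Lemma totinf_rec r v (l := active_nbrs (vacate r v) v)
    (act := fun i => scales (vacate r v) (take i l))
    (site := fun i => nth v l i) : (forall u, 0 <= r u) ->
  totinf r v <= 1 + \sum_(0 <= i < size l)
     h (odds (act i) (site i)) * totinf (act i) (site i).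
Proof.
move=> r0; rewrite lerD2l.
have -> : \sum_u `|infl r v u| =
    \sum_u `|marg (scales (vacate r v) l) u - marg (vacate r v) u|.
  by apply: eq_bigr => u _; rewrite /infl (eq_marg (@occupy_scales r v)).
apply: sum_marg_scales; first exact: vacate_ge0.
exact: filter_uniq (enum_uniq _).
Qed.

Lemma odds_rec r v (l := active_nbrs (vacate r v) v)
    (act := fun i => scales (vacate r v) (take i l))
    (site := fun i => nth v l i) : (forall u, 0 <= r u) ->
  odds r v = r v * \prod_(0 <= i < size l)
    ((b * odds (act i) (site i) + 1) / (odds (act i) (site i) + 1)).
Proof.
move=> r0; rewrite /odds (eq_gasZ e b (@occupy_scales r v)).
rewrite (gasZ_scales v) ?(filter_uniq _ (enum_uniq _))//; last exact: vacate_ge0.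
have zv := gasZ_gt0 e b_ge0 (vacate_ge0 v r0).
move: (\prod_(_ <= _ < _) _) => P.
by field; rewrite gt_eqF.
Qed.

Section SpectralIndependence.
Variables (Delta : nat) (Lup q : R).
Hypothesis deg_le : forall v, (#|[set u | e v u]| <= Delta)%N.
Hypotheses (q_ge0 : 0 <= q) (q_lt1 : q < 1) (Lup_ge0 : 0 <= Lup).
Hypothesis contract : forall (xs : seq R) (x : R), (size xs <= Delta.-1)%N ->
  {in xs, forall y, 0 <= y} -> 0 <= x ->
  x <= Lup * \prod_(y <- xs) ((b * y + 1) / (y + 1)) ->
  h x * (\sum_(y <- xs) Num.sqrt (h y)) ^+ 2 <= q ^+ 2.

Let B : R := Num.sqrt ((1 - b) * Lup).
(** The sum of [q + q ^+ 2 + ...], which one contraction step reproduces: [q * (1 + Q) = Q]. *)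
Let Q : R := q / (1 - q).

Lemma sqrt_hfun_le x : 0 <= x <= Lup -> Num.sqrt (h x) <= B.
Proof.
move=> /andP[x0 xL]; apply: ler_wsqrtr; apply: le_trans (hfun_le _ _ _) _ => //.
by rewrite ler_wpM2l// subr_ge0 ltW.
Qed.

Let Q0 : 0 <= Q. Proof. by rewrite divr_ge0// subr_ge0 ltW. Qed.
Let B0 : 0 <= B. Proof. exact: sqrtr_ge0. Qed.
Let QE : q * (1 + Q) = Q.
Proof. by rewrite /Q; field; rewrite subr_eq0 gt_eqF. Qed.

Lemma site_active r v i (l := active_nbrs (vacate r v) v)
    (act := scales (vacate r v) (take i l)) (site := nth v l i) :
  (i < size l)%N ->
  [/\ act site != 0,
      (size (active_nbrs (vacate act site) site) <= Delta.-1)%N &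
      forall u, act u != 0 -> (u != v) && (r u != 0)].
Proof.
move=> il.
have sl : site \in l by rewrite mem_nth.
move: (sl); rewrite mem_filter => /andP[/andP[evs rs] _].
have lun : uniq l by apply: filter_uniq; apply: enum_uniq.
have nt : site \notin take i l.
  move: lun; rewrite -{1}(cat_take_drop i l) (drop_nth v)// cat_uniq /=.
  by case/and3P => _; rewrite negb_or => /andP[].
have sub u : act u != 0 -> (u != v) && (r u != 0).
  rewrite /act /scales /vacate; have [->|_] := eqVneq u v.
    by rewrite mul0r eqxx.
  by apply: contraNneq => ->; rewrite mul0r.
split=> //; first by rewrite /act /scales (negPf nt) expr0 mulr1.
have := deg_le site; rewrite (cardsD1 v) inE esym evs add1n => dd.
rewrite -ltnS prednK; last exact: leq_trans dd.
apply: leq_trans dd; rewrite ltnS -(card_uniqP _); last first.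
  by apply: filter_uniq; apply: enum_uniq.
apply/subset_leq_card/subsetP => u.
rewrite mem_filter !inE => /andP[/andP[eu au] _].
rewrite eu andbT; suff /sub/andP[] : act u != 0 by [].
by apply: contraNneq au; rewrite /vacate => ->; case: ifP.
Qed.

Lemma hfun_totinf_le r w : (forall u, 0 <= r u <= Lup) ->
  (totinf r w - 1) * Num.sqrt (h (odds r w)) <= Q * B ->
  h (odds r w) * totinf r w <= Num.sqrt (h (odds r w)) * (B * (1 + Q)).
Proof.
move=> rL; have r0 u : 0 <= r u by have /andP[] := rL u.
have x0 := odds_ge0 w r0; set s := Num.sqrt _ => ih.
have hE : h (odds r w) = s * s by rewrite -expr2 sqr_sqrtr// hfun_ge0.
have s0 : 0 <= s by apply: sqrtr_ge0.
have sB : s <= B.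
  apply: sqrt_hfun_le; rewrite x0/= (le_trans (odds_le _ r0))//.
  by have /andP[] := rL w.
rewrite hE -mulrA ler_wpM2l//; lra.
Qed.

(* The weight [sqrt (hfun (odds r v))] is the potential in which one step of
   [totinf_rec] contracts. *)
Lemma totinf_potential n r v : (#|[set u | (r u != 0)%R]| <= n)%N ->
  (forall u, 0 <= r u <= Lup) -> r v != 0 ->
  (size (active_nbrs (vacate r v) v) <= Delta.-1)%N ->
  (totinf r v - 1) * Num.sqrt (h (odds r v)) <= Q * B.
Proof.
elim: n r v => [|n IH] r v.
  rewrite leqn0 cards_eq0 => /eqP supp _ rv.
  by have := in_set0 v; rewrite -supp inE rv.
move=> supp rL rv dv; have r0 u : 0 <= r u by have /andP[] := rL u.
set l := active_nbrs (vacate r v) v.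
pose act i := scales (vacate r v) (take i l); pose site i := nth v l i.
pose x i := odds (act i) (site i).
have act0 i u : 0 <= act i u by apply: scales_ge0; apply: vacate_ge0.
have actL i u : 0 <= act i u <= Lup.
  rewrite act0; apply: le_trans (scales_le _ _ (vacate_ge0 v r0)) _.
  by apply: le_trans (vacate_le _ _ r0) _; have /andP[] := rL u.
have x0 i : 0 <= x i by apply: odds_ge0.
have step i : (i < size l)%N ->
    h (x i) * totinf (act i) (site i)
    <= Num.sqrt (h (x i)) * (B * (1 + Q)).
  move=> il; have [as0 ad sub] := site_active il.
  apply: hfun_totinf_le => //; apply: IH => //.
  (* The gas of a child no longer contains [v], so its support is strictly smaller. *)
  rewrite -ltnS; apply: leq_trans supp; apply: proper_card.
  apply/properP; split.
    by apply/subsetP => u; rewrite !inE => /sub/andP[].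
  by exists v; rewrite ?inE//; apply/negP => /sub; rewrite eqxx.
have key : totinf r v - 1 <=
    (\sum_(0 <= i < size l) Num.sqrt (h (x i))) * (B * (1 + Q)).
  rewrite lerBlDl; apply: le_trans (totinf_rec v r0) _.
  rewrite lerD2l mulr_suml big_nat_cond [leRHS]big_nat_cond.
  by apply: ler_sum => i /andP[/andP[_ il] _]; apply: step.
set S := \sum_(0 <= i < _) _ in key.
set s := Num.sqrt (h (odds r v)).
have s0 : 0 <= s by apply: sqrtr_ge0.
have S0 : 0 <= S by apply: sumr_ge0 => i _; apply: sqrtr_ge0.
have Ss : S * s <= q.
  rewrite -(ler_pXn2r (n := 2))// ?nnegrE ?mulr_ge0//.
  rewrite exprMn mulrC sqr_sqrtr ?hfun_ge0 ?odds_ge0//.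
  have := contract (xs := [seq x i | i <- index_iota 0 (size l)]) (x := odds r v).
  rewrite !big_map -/S size_map size_iota subn0; apply => //.
  - by move=> _ /mapP[i _ ->].
  - exact: odds_ge0.
  - rewrite (odds_rec v r0) ler_wpM2r//; last by have /andP[] := rL v.
    apply: prodr_ge0 => i _.
    exact: divr_ge0 (ltW (bx1_gt0 b_ge0 (x0 i))) (ltW (x1_gt0 (x0 i))).
apply: le_trans (ler_wpM2r s0 key) _.
have -> : S * (B * (1 + Q)) * s = S * s * (1 + Q) * B by ring.
by rewrite -[in leRHS]QE ler_wpM2r// ler_wpM2r// addr_ge0.
Qed.

(** The root may have [Delta] active neighbours, one more than [contract] allows, so the first level
    is not contracted: there each neighbour contributes at most [B ^+ 2 * (1 + Q)], with
    [B ^+ 2 = (1 - b) * Lup]. *)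
Lemma totinf_le r v : (forall u, 0 <= r u <= Lup) ->
  totinf r v <= 1 + Delta%:R * (1 - b) * Lup / (1 - q).
Proof.
move=> rL; have r0 u : 0 <= r u by have /andP[] := rL u.
set l := active_nbrs (vacate r v) v.
pose act i := scales (vacate r v) (take i l); pose site i := nth v l i.
have act0 i u : 0 <= act i u by apply: scales_ge0; apply: vacate_ge0.
have actL i u : 0 <= act i u <= Lup.
  rewrite act0; apply: le_trans (scales_le _ _ (vacate_ge0 v r0)) _.
  by apply: le_trans (vacate_le _ _ r0) _; have /andP[] := rL u.
have lsz : (size l <= Delta)%N.
  apply: leq_trans (deg_le v); rewrite -(card_uniqP _); last first.
    exact: filter_uniq (enum_uniq _).
  apply/subset_leq_card/subsetP => u.
  by rewrite mem_filter inE => /andP[/andP[-> _] _].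
apply: le_trans (totinf_rec v r0) _; rewrite lerD2l.
apply: le_trans (_ : \sum_(0 <= i < size l) (B * (B * (1 + Q))) <= _).
  rewrite big_nat_cond [leRHS]big_nat_cond.
  apply: ler_sum => i /andP[/andP[_ il] _].
  have [as0 ad _] := site_active il.
  apply: le_trans (hfun_totinf_le (actL i) _) _.
    exact: (totinf_potential (leqnn _) (actL i)).
  rewrite ler_wpM2r ?mulr_ge0 ?addr_ge0//; apply: sqrt_hfun_le.
  rewrite odds_ge0//= (le_trans (odds_le _ (act0 i)))//.
  by have /andP[] := actL i (site i).
rewrite sumr_const_nat subn0 mulrA -expr2.
rewrite sqr_sqrtr ?mulr_ge0 ?subr_ge0 ?(ltW b_lt1)//.
rewrite -[leLHS]mulr_natl.
have -> : 1 + Q = (1 - q)^-1 by rewrite /Q; field; rewrite subr_eq0 gt_eqF.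
rewrite -!mulrA ler_wpM2r ?ler_nat//.
by rewrite !mulr_ge0 ?invr_ge0 ?subr_ge0 ?(ltW b_lt1) ?(ltW q_lt1).
Qed.

End SpectralIndependence.
End Influence.

(** * One-variable calculus and a bound on logarithmic Laplace transforms *)

Section Derivatives.
Variable R : realType.
Implicit Types (f g : R -> R) (x df dg c : R).

Lemma is_derive_cstf x c : is_derive x 1 (fun=> c) 0.
Proof. exact: is_derive_cst. Qed.

Lemma is_derive_idf x : is_derive x 1 (fun t => t) 1.
Proof. exact: is_derive_id. Qed.

Lemma is_derive_val f x df df' : is_derive x 1 f df -> df = df' ->
  is_derive x 1 f df'.
Proof. by move=> ? <-. Qed.

Lemma is_derive_addf f g x df dg : is_derive x 1 f df -> is_derive x 1 g dg ->
  is_derive x 1 (fun t => f t + g t) (df + dg).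
Proof. by move=> hf hg; apply: is_deriveD. Qed.

Lemma is_derive_oppf f x df : is_derive x 1 f df ->
  is_derive x 1 (fun t => - f t) (- df).
Proof. by move=> hf; apply: is_deriveN. Qed.

Lemma is_derive_subf f g x df dg : is_derive x 1 f df -> is_derive x 1 g dg ->
  is_derive x 1 (fun t => f t - g t) (df - dg).
Proof. by move=> hf hg; apply: is_deriveB. Qed.

Lemma is_derive_mulf f g x df dg : is_derive x 1 f df -> is_derive x 1 g dg ->
  is_derive x 1 (fun t => f t * g t) (df * g x + f x * dg).
Proof.
move=> hf hg; have := is_deriveM hf hg.
by rewrite addrC /GRing.scale/= [g x * df]mulrC.
Qed.

Lemma is_derive_expf f x df : is_derive x 1 f df ->
  is_derive x 1 (fun t => expR (f t)) (expR (f x) * df).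
Proof. by move=> hf; apply: (is_derive1_comp (f := expR)). Qed.

Lemma is_derive_lnf f x df : 0 < f x -> is_derive x 1 f df ->
  is_derive x 1 (fun t => ln (f t)) (df / f x).
Proof.
move=> f0 hf; rewrite mulrC; apply: (is_derive1_comp (f := @ln R)).
exact: is_derive1_ln.
Qed.

Lemma is_derive_divf f g x df dg : g x != 0 ->
  is_derive x 1 f df -> is_derive x 1 g dg ->
  is_derive x 1 (fun t => f t / g t) ((df * g x - f x * dg) / g x ^+ 2).
Proof.
move=> g0 hf hg.
have hi : is_derive x 1 (fun t => (g t)^-1) (- (g x) ^- 2 * dg).
  have [dg1 dg2] := hg.
  split; first exact: derivableV.
  by rewrite deriveV// dg2.
by apply: (is_derive_val (is_derive_mulf hf hi)); field.
Qed.

Lemma is_derive_expnf f n x df : is_derive x 1 f df ->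
  is_derive x 1 (fun t => f t ^+ n) (n%:R * f x ^+ n.-1 * df).
Proof.
move=> hf; elim: n => [|n IH].
  by rewrite mul0r mul0r; apply: is_derive_cstf.
have E : (fun t => f t ^+ n.+1) = (fun t => f t * f t ^+ n).
  by apply/funext => t; rewrite exprS.
rewrite E; apply: (is_derive_val (is_derive_mulf hf IH)).
clear E; case: n IH => [|n] _ /=; first by rewrite !expr0; ring.
by rewrite exprS -[in RHS]natr1; ring.
Qed.

Lemma is_derive_sumf (I : Type) (s : seq I) (P : pred I) (F : I -> R -> R)
    (dF : I -> R) x : (forall i, P i -> is_derive x 1 (F i) (dF i)) ->
  is_derive x 1 (fun t => \sum_(i <- s | P i) F i t) (\sum_(i <- s | P i) dF i).
Proof.
move=> hF; elim: s => [|i s IH].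
  rewrite big_nil (_ : (fun t => _) = (fun=> 0)); first exact: is_derive_cstf.
  by apply/funext => t; rewrite big_nil.
rewrite big_cons; have [Pi|Pi] := boolP (P i).
  rewrite (_ : (fun t => _) = (fun t => F i t + \sum_(j <- s | P j) F j t)).
    by apply: is_derive_addf => //; apply: hF.
  by apply/funext => t; rewrite big_cons Pi.
rewrite (_ : (fun t => _) = (fun t => \sum_(j <- s | P j) F j t))//.
by apply/funext => t; rewrite big_cons (negPf Pi).
Qed.

Lemma is_derive_nonincreasing f (df : R -> R) x y : x <= y ->
  (forall t : R, x <= t <= y -> is_derive t 1 f (df t)) ->
  (forall t : R, x <= t <= y -> df t <= 0) -> f y <= f x.
Proof.
move=> xy hf hd.
have [||t] := @MVT_segment R f df x y xy.
- by move=> t; rewrite in_itv/= => /andP[xt ty]; apply: hf; rewrite !ltW.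
- apply: derivable_within_continuous => t; rewrite in_itv/= => txy.
  by have := hf t txy => -[].
rewrite in_itv/= => txy E; rewrite -subr_le0 E mulr_le0_ge0 ?hd// subr_ge0//.
Qed.

(** The hypothesis bounds by [c] the variance of [y] under the tilted weights, which is the second
    derivative of [ln (S 0 t)]. Integrating twice, each time by monotonicity, replaces Taylor's
    formula. *)
Lemma log_laplace_le (I : finType) (m y : I -> R) (c : R)
    (S := fun (k : nat) t => \sum_i m i * (y i ^+ k * expR (t * y i))) :
  (forall i, 0 <= m i) -> 0 < \sum_i m i ->
  (forall t : R, 0 <= t <= 1 -> S 2 t * S 0 t - S 1 t ^+ 2 <= c * S 0 t ^+ 2) ->
  ln (S 0 1 / S 0 0) <= S 1 0 / S 0 0 + c / 2.
Proof.
move=> m0 mpos hc.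
have S0pos t : 0 < S 0 t.
  have [i mi] : exists i, 0 < m i.
    apply/not_existsP => h; move: mpos; rewrite big1 ?ltxx// => i _.
    by apply/eqP; rewrite eq_le m0 andbT leNgt; apply/negP/h.
  rewrite /S (bigD1 i)//= ltr_pwDl//; last first.
    by apply: sumr_ge0 => j _; rewrite !mulr_ge0 ?expr0 ?expR_ge0.
  by rewrite expr0 mul1r mulr_gt0 ?expR_gt0.
have dS (k : nat) (t : R) : is_derive t 1 (S k) (S k.+1 t).
  apply: (@is_derive_sumf _ _ _ (fun i t => m i * (y i ^+ k * expR (t * y i)))).
  move=> i _; have h1 := is_derive_mulf (is_derive_idf t) (is_derive_cstf t (y i)).
  have h2 := is_derive_mulf (is_derive_cstf t (y i ^+ k)) (is_derive_expf h1).
  apply: (is_derive_val (is_derive_mulf (is_derive_cstf t (m i)) h2)).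
  by rewrite exprS; move: (y i ^+ k) => z; ring.
set a := S 1 0 / S 0 0.
pose H (t : R) := S 1 t / S 0 t - a - c * t.
have dH (t : R) : is_derive t 1 H ((S 2 t * S 0 t - S 1 t ^+ 2) / S 0 t ^+ 2 - c).
  have h1 := is_derive_divf (lt0r_neq0 (S0pos t)) (dS 1 t) (dS 0 t).
  have h2 := is_derive_mulf (is_derive_cstf t c) (is_derive_idf t).
  apply: (is_derive_val (is_derive_subf (is_derive_subf h1 (is_derive_cstf t a)) h2)).
  by rewrite expr2; field; rewrite gt_eqF.
have H0 (t : R) : 0 <= t <= 1 -> H t <= 0.
  move=> /andP[t0 t1].
  have <- : H 0 = 0 by rewrite /H /a; ring.
  apply: (is_derive_nonincreasing t0 (fun u _ => dH u)) => u /andP[u0 ut].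
  rewrite subr_le0 ler_pdivrMr ?exprn_gt0//; apply: hc.
  by rewrite u0 (le_trans ut).
pose G (t : R) := ln (S 0 t) - a * t - c * (t ^+ 2 / 2).
have dG (t : R) : is_derive t 1 G (H t).
  have h1 := is_derive_lnf (S0pos t) (dS 0 t).
  have h2 := is_derive_mulf (is_derive_cstf t a) (is_derive_idf t).
  have h3 := is_derive_mulf (is_derive_cstf t c)
    (is_derive_mulf (is_derive_expnf 2 (is_derive_idf t)) (is_derive_cstf t 2^-1)).
  apply: (is_derive_val (is_derive_subf (is_derive_subf h1 h2) h3)).
  by rewrite /H; field; rewrite gt_eqF.
have := is_derive_nonincreasing ler01 (fun u _ => dG u) H0.
rewrite /G ln_div ?posrE// expr0n expr1n/=; lra.
Qed.

End Derivatives.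

(** * Entropic independence *)

Section EntropicIndependence.
Variables (R : realType) (V : finType) (e : rel V) (b : R).
Implicit Types (r w : V -> R) (A B : {set V}) (f g F : {set V} -> R) (u v : V).
Hypotheses (esym : symmetric e) (eirr : irreflexive e).
Hypotheses (b_ge0 : 0 <= b) (b_lt1 : b < 1).

Local Notation W := (gasW e b).
Local Notation M := (gasM e b).
Local Notation Z := (gasZ e b).
Local Notation occ := (occupy e b).
Local Notation odds := (odds e b).
Local Notation marg := (marg e b).
Local Notation infl := (infl e b).
Local Notation totinf := (totinf e b).

(** [Z r] times the entropy of [f] under the normalised gas, so that pinned and thinned pieces add
    up without normalising factors. *)
Definition gasEnt r f : R :=
  M r (fun A => f A * ln (f A)) - M r f * ln (M r f / Z r).

Lemma donsker_varadhan r f g : (forall v, 0 <= r v) -> (forall A, 0 < f A) ->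
  M r (fun A => f A * g A) <=
  gasEnt r f + M r f * ln (M r (fun A => expR (g A)) / Z r).
Proof.
move=> r0 f0; have F0 := gasM_gt0 e b_ge0 r0 f0.
have E0 := gasM_gt0 e b_ge0 r0 (fun A => expR_gt0 (g A)).
have Z0 := gasZ_gt0 e b_ge0 r0.
rewrite /gasEnt !ln_div ?posrE//.
set F := M r f in F0 *; set E := M r _ in E0 *; set z := Z r in Z0 *.
have key : M r (fun A => f A * g A - f A * ln (f A) + (ln F - ln E) * f A)
    <= M r (fun A => F / E * expR (g A) - f A).
  apply: ler_gasM => // A.
  have := ln_le_subr1 (x := F / E * expR (g A) / f A).
  rewrite !divr_gt0 ?mulr_gt0 ?invr_gt0 ?expR_gt0// => /(_ isT).
  rewrite ln_div ?posrE ?mulr_gt0 ?invr_gt0 ?expR_gt0//.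
  rewrite lnM ?posrE ?divr_gt0 ?expR_gt0// expRK ln_div ?posrE//.
  move=> /(ler_wpM2l (ltW (f0 A))).
  rewrite !mulrBr mulr1 [f A * (_ / f A)]mulrC divfK ?gt_eqF//; lra.
move: key; rewrite gasMB gasMZ -/E divfK ?gt_eqF// subrr gasMD gasMB gasMZ -/F.
lra.
Qed.

Lemma gasW_tilt r w A :
  W r A * expR (\sum_(v in A) w v) = W (fun v => r v * expR (w v)) A.
Proof.
by rewrite /gasW big_split/= expR_sum mulrAC.
Qed.

Lemma gasM_tilt r w F :
  M r (fun A => F A * expR (\sum_(v in A) w v))
  = M (fun v => r v * expR (w v)) F.
Proof. by apply: eq_bigr => A _; rewrite mulrCA mulrC gasW_tilt mulrC. Qed.

Lemma margE r v : (forall u, 0 <= r u) -> marg r v = odds r v / (1 + odds r v).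
Proof.
move=> r0; have := marg_split esym eirr b_ge0 v v r0.
rewrite eqxx (marg_eq0 e b (r := vacate r v)) ?/vacate ?eqxx//.
rewrite (marg_eq0 e b (r := occ r v)) ?/occupy ?eqxx// !add0r mulr1 => E.
by apply: (canRL (mulfK _)) => //; rewrite gt_eqF// ltr_wpDr// odds_ge0.
Qed.

Lemma marg_ge0 r v : (forall u, 0 <= r u) -> 0 <= marg r v.
Proof.
by move=> r0; rewrite margE// divr_ge0 ?addr_ge0 ?odds_ge0.
Qed.

Lemma marg_le_odds r v : (forall u, 0 <= r u) -> marg r v <= odds r v.
Proof.
move=> r0; have := odds_ge0 e b_ge0 v r0 => x0.
by rewrite margE// ler_pdivrMr ?ltr_wpDr// ler_peMr// lerDl.
Qed.

Lemma marg_le r v : (forall u, 0 <= r u) -> marg r v <= r v.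
Proof.
by move=> r0; apply: le_trans (marg_le_odds v r0) _; apply: odds_le.
Qed.

Lemma marg_le1 r v : (forall u, 0 <= r u) -> marg r v <= 1.
Proof.
move=> r0; have := odds_ge0 e b_ge0 v r0 => x0.
by rewrite margE// ler_pdivrMr ?ltr_wpDr// mul1r lerDr.
Qed.

Lemma marg_gt0 r v : (forall u, 0 <= r u) -> 0 < r v -> 0 < marg r v.
Proof.
move=> r0 rv; have od : 0 < odds r v.
  by rewrite divr_gt0 ?mulr_gt0 ?gasZ_gt0//; [apply: occupy_ge0|apply: vacate_ge0].
by rewrite margE// divr_gt0// addr_gt0.
Qed.

Definition upd r v c : V -> R := fun u => if u == v then c * r u else r u.

(** [Z] is affine in the activity of [v] with slope [Z (occ r v)], which repulsion keeps below
    [Z r]. Iterated over the sites, this gives the Laplace transform of independent Poisson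
    variables as an upper bound. *)
Lemma gasZ_upd_le r v c : (forall u, 0 <= r u) -> 1 <= c ->
  Z (upd r v c) <= Z r * expR (r v * (c - 1)).
Proof.
move=> r0 c1; rewrite (gasZ_split b esym eirr _ v).
rewrite (eq_gasZ e b (r' := vacate r v)); last first.
  by move=> u; rewrite /vacate /upd; case: eqP.
rewrite (eq_gasZ e b (r := occ _ v) (r' := occ r v)); last first.
  by move=> u; rewrite /occupy /upd; case: eqP.
have -> : Z (vacate r v) = Z r - r v * Z (occ r v).
  by rewrite [Z r](gasZ_split b esym eirr _ v) addrK.
have zo : Z (occ r v) <= Z r.
  by apply: ler_sum => A _; apply: gasW_le => // u; rewrite occupy_ge0// occupy_le.
have z0 := gasZ_gt0 e b_ge0 r0.
apply: le_trans (_ : Z r * (1 + r v * (c - 1)) <= _); last first.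
  by rewrite ler_pM2l// expR_ge1Dx.
have : r v * (c - 1) * Z (occ r v) <= r v * (c - 1) * Z r.
  by rewrite ler_wpM2l// mulr_ge0// subr_ge0.
by rewrite /upd eqxx; lra.
Qed.

Lemma gasZ_tilt_le r (c : V -> R) : (forall u, 0 <= r u) ->
  (forall u, 1 <= c u) ->
  Z (fun u => r u * c u) <= Z r * expR (\sum_u r u * (c u - 1)).
Proof.
move=> r0 c1.
suff gen (l : seq V) : uniq l ->
    Z (fun u => if u \in l then r u * c u else r u)
    <= Z r * expR (\sum_(u <- l) r u * (c u - 1)).
  rewrite (eq_gasZ e b (r' := fun u => if u \in enum V then r u * c u else r u)).
    by rewrite -[X in expR X]big_enum/=; apply: gen; apply: enum_uniq.
  by move=> u; rewrite mem_enum.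
elim: l => [|v l IH] /=; first by rewrite big_nil expR0 mulr1.
move=> /andP[vl ul]; rewrite big_cons addrC expRD mulrA.
set r' := fun u => if u \in l then _ else _ in IH.
have r'0 u : 0 <= r' u.
  by rewrite /r'; case: ifP => // _; rewrite mulr_ge0// (le_trans ler01).
rewrite (eq_gasZ e b (r' := upd r' v (c v))); last first.
  move=> u; rewrite /upd /r' inE; have [->|] := eqVneq u v => //=.
  by rewrite (negPf vl) mulrC.
apply: le_trans (gasZ_upd_le v r'0 (c1 v)) _.
rewrite {2}/r' (negPf vl) ler_wpM2r ?expR_ge0//; exact: IH.
Qed.

(** Each neighbour lowers the odds in [odds_rec] by a factor no smaller than
    [expR (- ((1 - b) * Lup))]. Hence marginals are comparable to activities, however small these
    are, once [Delta * (1 - b) * Lup] is bounded. *)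
Lemma marg_ge (Delta : nat) (Lup : R) r v :
  (forall v, (#|[set u | e v u]| <= Delta)%N) ->
  (forall u, 0 <= r u <= Lup) ->
  r v <= (1 + Lup) * expR (Delta%:R * (1 - b) * Lup) * marg r v.
Proof.
move=> dD rL; have r0 u : 0 <= r u by have /andP[] := rL u.
have L0 : 0 <= Lup by have /andP[/le_trans] := rL v; apply.
set K := expR _; rewrite margE//.
have od : odds r v <= Lup.
  by apply: le_trans (odds_le _ _ _ _ _) _ => //; have /andP[] := rL v.
have od0 := odds_ge0 e b_ge0 v r0.
suff key : r v <= K * odds r v.
  rewrite mulrA ler_pdivlMr ?ltr_wpDr//.
  have Ko : 0 <= K * odds r v by rewrite mulr_ge0 ?expR_ge0.
  apply: le_trans (_ : (K * odds r v) * (1 + Lup) <= _); last by rewrite mulrC mulrA.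
  by apply: ler_pM => //; [rewrite addr_ge0|rewrite lerD2l].
rewrite (odds_rec esym eirr b_ge0 v r0).
set l := active_nbrs e (vacate r v) v.
have lsz : (size l <= Delta)%N.
  apply: leq_trans (dD v); rewrite -(card_uniqP _); last first.
    exact: filter_uniq (enum_uniq _).
  apply/subset_leq_card/subsetP => u.
  by rewrite mem_filter inE => /andP[/andP[-> _] _].
rewrite mulrCA ler_peMr//.
pose x i := odds (scales b (vacate r v) (take i l)) (nth v l i).
have act0 i u : 0 <= scales b (vacate r v) (take i l) u.
  by apply: scales_ge0 => //; apply: vacate_ge0.
have x0 i : 0 <= x i by apply: odds_ge0.
have xL i : x i <= Lup.
  apply: le_trans (odds_le e b_ge0 b_lt1 _ (act0 i)) _.
  apply: le_trans (scales_le b_ge0 b_lt1 _ _ (vacate_ge0 v r0)) _.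
  by apply: le_trans (vacate_le _ _ r0) _; have /andP[] := rL (nth v l i).
have lb : expR (- ((size l)%:R * ((1 - b) * Lup))) <=
    \prod_(0 <= i < size l) ((b * x i + 1) / (x i + 1)).
  rewrite -mulrN expRM_natl.
  rewrite -[X in _ ^+ X]subn0 -prodr_const_nat; apply: ler_prod => i _.
  rewrite expR_ge0/=.
  rewrite -[leRHS]invrK expRN invf_div lef_pV2 ?posrE ?expR_gt0//; last first.
    exact: divr_gt0 (x1_gt0 (x0 i)) (bx1_gt0 b_ge0 (x0 i)).
  apply: le_trans (expR_ge1Dx _); rewrite ler_pdivrMr ?bx1_gt0//.
  have h1 : (1 - b) * x i <= (1 - b) * Lup.
    by rewrite ler_wpM2l// subr_ge0 ltW.
  have h2 : 0 <= (1 - b) * Lup * (b * x i).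
    apply: mulr_ge0 (mulr_ge0 _ L0) (mulr_ge0 b_ge0 (x0 i)).
    by rewrite subr_ge0 ltW.
  lra.
apply: le_trans (_ : K * expR (- ((size l)%:R * ((1 - b) * Lup))) <= _); last first.
  by rewrite ler_pM2l ?expR_gt0.
rewrite -expRD -[leLHS]expR0 ler_expR -mulrA -mulrBl mulr_ge0 ?subr_ge0 ?ler_nat//.
by rewrite mulr_ge0// subr_ge0 ltW.
Qed.

Definition linf w A : R := \sum_(v in A) w v.

Lemma linfE w A : linf w A = \sum_v w v * (v \in A)%:R.
Proof.
rewrite /linf big_mkcond/=; apply: eq_bigr => v _.
by case: (v \in A); rewrite ?mulr1 ?mulr0.
Qed.

Lemma gasM_occupied r v F :
  M r (fun A => (v \in A)%:R * F A) = r v * M (occ r v) (fun A => F (v |: A)).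
Proof.
rewrite (gasM_split b esym eirr r _ v).
rewrite {1}/gasM big1 ?add0r => [|A _].
  by congr (_ * _); apply: eq_gasM => // A; rewrite setU11 mul1r.
have [vA|vA] := boolP (v \in A); last by rewrite mul0r mulr0.
by rewrite (gasW_eq0 e b (v := v)) ?mul0r// /vacate eqxx.
Qed.

Lemma gasM_cov r u v : (forall u, 0 <= r u) ->
  M r (fun A => (u \in A)%:R * (v \in A)%:R) / Z r - marg r u * marg r v
  = marg r v * (1 - marg r v) * (infl r v u + (u == v)%:R).
Proof.
move=> r0; have zo := gasZ_gt0 e b_ge0 (occupy_ge0 e b_ge0 v r0).
have z0 := gasZ_gt0 e b_ge0 r0; have x0 := odds_ge0 e b_ge0 v r0.
have mv : marg r v = r v * Z (occ r v) / Z r.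
  rewrite /marg; congr (_ / _); rewrite gasZE -(gasM_occupied r v (fun=> 1)).
  by apply: eq_gasM => // A; rewrite mulr1.
have -> : M r (fun A => (u \in A)%:R * (v \in A)%:R) / Z r
    = marg r v * (marg (occ r v) u + (u == v)%:R) :> R.
  have -> : M r (fun A => (u \in A)%:R * (v \in A)%:R) =
      M r (fun A => (v \in A)%:R * (u \in A)%:R).
    by apply: eq_gasM => // A; rewrite mulrC.
  rewrite gasM_occupied mv.
  have -> : M (occ r v) (fun A => (u \in v |: A)%:R) =
      M (occ r v) (fun A => (u \in A)%:R) + (u == v)%:R * Z (occ r v).
    rewrite gasZE -gasMZ -gasMD; apply: eq_bigr => A _.
    have [uv|uv] := eqVneq u v; last by rewrite !inE (negPf uv) mul0r addr0.
    have [vA|vA] := boolP (v \in A).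
      by rewrite (gasW_eq0 e b (v := v)) ?mul0r// /occupy eqxx.
    by rewrite uv (negPf vA) setU11 mul1r add0r.
  rewrite /marg; move: (M _ _) => y; move: ((u == v)%:R : R) => c.
  by field; rewrite !gt_eqF.
have x1 : 1 + odds r v != 0 by rewrite gt_eqF// ltr_wpDr.
have mu : marg r u = (1 - marg r v) * marg (vacate r v) u
    + marg r v * (marg (occ r v) u + (u == v)%:R) :> R.
  apply: (mulIf x1); rewrite (marg_split esym eirr b_ge0 v u r0) (margE v r0).
  move: ((u == v)%:R : R) (marg (vacate r v) u) (marg (occ r v) u) => c p0 p1.
  by field.
by rewrite mu /infl; ring.
Qed.

(** Covariances are symmetric, so bounding [w u * w v] by half of [w u ^+ 2 + w v ^+ 2] leaves only
    column sums of their absolute values; by [gasM_cov] these are at most [marg r v * totinf r v].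
    No eigenvalue enters. *)
Lemma gas_variance_le r w : (forall u, 0 <= r u) ->
  M r (fun A => linf w A ^+ 2) * Z r - M r (linf w) ^+ 2 <=
  (\sum_v marg r v * totinf r v * w v ^+ 2) * Z r ^+ 2.
Proof.
move=> r0; have z0 := gasZ_gt0 e b_ge0 r0.
pose C u v := M r (fun A => (u \in A)%:R * (v \in A)%:R) / Z r
  - marg r u * marg r v.
have M2 : M r (fun A => linf w A ^+ 2) =
    \sum_u \sum_v w u * w v * M r (fun A => (u \in A)%:R * (v \in A)%:R).
  transitivity (M r (fun A => \sum_u \sum_v
      w u * w v * ((u \in A)%:R * (v \in A)%:R))).
    apply: eq_gasM => // A; rewrite expr2 linfE mulr_suml.
    apply: eq_bigr => u _; rewrite mulr_sumr; apply: eq_bigr => v _.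
    by rewrite mulrACA.
  rewrite gasM_sum; apply: eq_bigr => u _; rewrite gasM_sum.
  by apply: eq_bigr => v _; rewrite gasMZ.
have M1 : M r (linf w) = \sum_u w u * (marg r u * Z r).
  transitivity (M r (fun A => \sum_u w u * (u \in A)%:R)).
    by apply: eq_gasM => // A; rewrite linfE.
  rewrite gasM_sum; apply: eq_bigr => u _; rewrite gasMZ.
  by rewrite /marg divfK// gt_eqF.
have -> : M r (fun A => linf w A ^+ 2) * Z r - M r (linf w) ^+ 2 =
    (\sum_u \sum_v w u * w v * C u v) * Z r ^+ 2.
  rewrite M2 M1 expr2 mulr_suml mulr_suml -sumrB mulr_suml.
  apply: eq_bigr => u _; rewrite mulr_suml mulr_sumr mulr_suml -sumrB.
  apply: eq_bigr => v _; rewrite /C; move: (M _ _) => y.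
  by field; rewrite gt_eqF.
rewrite ler_wpM2r ?sqr_ge0//.
have CE u v : C u v = marg r v * (1 - marg r v) * (infl r v u + (u == v)%:R).
  exact: gasM_cov.
have Csym u v : C u v = C v u.
  rewrite /C [marg r u * _]mulrC; congr (_ / _ - _).
  by apply: eq_gasM => // A; rewrite mulrC.
apply: le_trans (_ : \sum_u \sum_v ((w u ^+ 2 + w v ^+ 2) / 2) * `|C u v| <= _).
  apply: ler_sum => u _; apply: ler_sum => v _.
  apply: le_trans (ler_norm _) _; rewrite normrM ler_wpM2r//.
  rewrite ler_norml; have := sqr_ge0 (w u + w v); have := sqr_ge0 (w u - w v).
  by rewrite !expr2; lra.
have -> : \sum_u \sum_v ((w u ^+ 2 + w v ^+ 2) / 2) * `|C u v| =
    \sum_v w v ^+ 2 * \sum_u `|C u v|.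
  transitivity (\sum_u \sum_v (w u ^+ 2 / 2 * `|C u v|)
      + \sum_u \sum_v (w v ^+ 2 / 2 * `|C u v|)).
    rewrite -big_split; apply: eq_bigr => u _; rewrite -big_split/=.
    by apply: eq_bigr => v _; move: `|C u v| => c; field.
  rewrite [X in _ + X]exchange_big/= -big_split/=; apply: eq_bigr => v _.
  rewrite mulr_sumr -big_split/=; apply: eq_bigr => u _.
  by rewrite [C v u]Csym; move: `|C u v| => c; field.
apply: ler_sum => v _; rewrite mulrC ler_wpM2r ?sqr_ge0//.
have m0 := marg_ge0 v r0; have m1 := marg_le1 v r0.
apply: le_trans (_ : \sum_u marg r v * (`|infl r v u| + (u == v)%:R) <= _).
  apply: ler_sum => u _; rewrite CE normrM ger0_norm; last first.
    by rewrite mulr_ge0// subr_ge0.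
  apply: ler_pM => //; first by rewrite mulr_ge0// subr_ge0.
    by rewrite ler_piMr// gerBl.
  by apply: le_trans (ler_normD _ _) _; rewrite lerD2l ger0_norm.
rewrite -mulr_sumr ler_wpM2l// big_split/= addrC lerD2r.
rewrite (bigD1 v)//= eqxx big1 ?addr0// => u /negPf -> //.
Qed.

(** Tilting by the exponential of [t * linf w] yields again a gas, with activities
    [r v * expR (t * w v)], so the variance bound applies along the whole path of tilts. *)
Lemma gas_log_laplace r w (c : R) : (forall u, 0 <= r u) ->
  (forall t : R, 0 <= t <= 1 ->
     \sum_v marg (fun v => r v * expR (t * w v)) v
       * totinf (fun v => r v * expR (t * w v)) v * w v ^+ 2 <= c) ->
  ln (M r (fun A => expR (linf w A)) / Z r)
  <= \sum_v marg r v * w v + c / 2.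
Proof.
move=> r0 hc; have z0 := gasZ_gt0 e b_ge0 r0.
have r't (t : R) u : 0 <= r u * expR (t * w u) by rewrite mulr_ge0 ?expR_ge0.
pose S (k : nat) (t : R) :=
  \sum_A W r A * (linf w A ^+ k * expR (t * linf w A)).
have SE k t : S k t = M (fun v => r v * expR (t * w v)) (fun A => linf w A ^+ k).
  rewrite -(gasM_tilt r (fun v => t * w v)); apply: eq_bigr => A _.
  by rewrite /linf mulr_sumr.
have S0E t : S 0 t = Z (fun v => r v * expR (t * w v)).
  by rewrite SE gasZE; apply: eq_gasM.
have S1E t : S 1 t = M (fun v => r v * expR (t * w v)) (linf w).
  by rewrite SE; apply: eq_gasM => // A; rewrite expr1.
have t0E : (fun v => r v * expR (0 * w v)) =1 r.
  by move=> v; rewrite mul0r expR0 mulr1.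
have S00 : S 0 0 = Z r by rewrite S0E; apply: eq_gasZ.
have -> : M r (fun A => expR (linf w A)) = S 0 1.
  by apply: eq_bigr => A _; rewrite mul1r expr0 mul1r.
have -> : \sum_v marg r v * w v = S 1 0 / S 0 0.
  rewrite S00 S1E (eq_gasM e b t0E (frefl _)).
  transitivity (M r (fun A => \sum_u w u * (u \in A)%:R) / Z r).
    rewrite gasM_sum mulr_suml; apply: eq_bigr => u _.
    by rewrite gasMZ /marg mulrC mulrA.
  by congr (_ / _); apply: eq_gasM => // A; rewrite linfE.
rewrite -S00; apply: (@log_laplace_le R _ (W r) (linf w) c).
- by move=> A; apply: gasW_ge0.
- exact: z0.
- move=> t t01; have := gas_variance_le w (r't t).
  rewrite -S0E -S1E -SE => /le_trans; apply.
  by rewrite ler_wpM2r ?sqr_ge0//; apply: hc.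
Qed.

Section Main.
Variables (Lam a0 eta K : R).
Hypotheses (a0_ge0 : 0 <= a0) (K_ge1 : 1 <= K) (eta_ge1 : 1 <= eta).
Hypothesis totinf_eta : forall r v,
  (forall u, 0 <= r u <= Lam * expR a0) -> totinf r v <= eta.
Hypothesis act_le_marg : forall r v,
  (forall u, 0 <= r u <= Lam) -> r v <= K * marg r v.

(** Chosen so that [g > G] gives [ln g >= 2 * (ln K + 1)], which pays for the comparison constant
    [K] in [ei_large]. *)
Let G : R := (K * expR 1) ^+ 2.
(** Compares the variance in a tilted gas with the untilted marginals: [eta] for influence,
    [expR a0] for the tilt, [K] for passing from activities to marginals. *)
Let E : R := eta * expR a0 * K.

Let K0 : 0 < K. Proof. exact: lt_le_trans K_ge1. Qed.
Let eta0 : 0 < eta. Proof. exact: lt_le_trans eta_ge1. Qed.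
Let G1 : 1 <= G.
Proof.
by rewrite exprn_ege1// mulr_ege1// -[leLHS]expR0 ler_expR.
Qed.
Let E0 : 0 < E. Proof. by rewrite !mulr_gt0 ?expR_gt0. Qed.

Section Fixed.
Variables (r : V -> R) (f : {set V} -> R).
Hypotheses (rL : forall u, 0 <= r u <= Lam) (f0 : forall A, 0 < f A).
Let r0 u : 0 <= r u. Proof. by have /andP[] := rL u. Qed.

Let Fm := M r f.
Let D : R := gasEnt r f / Fm.
Let nu v : R := M r (fun A => (v \in A)%:R * f A) / Fm.
Let g v : R := nu v / marg r v.

Let F0 : 0 < Fm. Proof. exact: gasM_gt0. Qed.
Let nu_ge0 v : 0 <= nu v.
Proof.
rewrite divr_ge0// ?(ltW F0)// gasM_ge0// => A.
by rewrite mulr_ge0// ltW.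
Qed.
Let g_ge0 v : 0 <= g v.
Proof. by rewrite divr_ge0// marg_ge0. Qed.
Let nuE v : nu v = marg r v * g v.
Proof.
rewrite /g; have [rv|rv] := eqVneq (r v) 0; last first.
  by rewrite mulrC divfK// gt_eqF// marg_gt0// lt_neqAle eq_sym rv r0.
have m0 : marg r v = 0 by apply: marg_eq0.
by rewrite m0 mul0r /nu gasM_occupied rv !mul0r.
Qed.

Lemma dv_linear w :
  \sum_v nu v * w v <= D + ln (M r (fun A => expR (linf w A)) / Z r).
Proof.
have := donsker_varadhan (linf w) r0 f0; rewrite -/Fm.
have -> : M r (fun A => f A * linf w A) = Fm * \sum_v nu v * w v.
  transitivity (M r (fun A => \sum_v w v * ((v \in A)%:R * f A))).
    apply: eq_gasM => // A; rewrite linfE mulr_sumr; apply: eq_bigr => v _.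
    by rewrite mulrCA [f A * _]mulrC.
  rewrite gasM_sum mulr_sumr; apply: eq_bigr => v _; rewrite gasMZ /nu.
  by move: (M r _) => y; field; rewrite gt_eqF.
have -> : gasEnt r f = Fm * D by rewrite /D mulrC divfK ?gt_eqF.
by rewrite -mulrDr ler_pM2l.
Qed.

(** [dv_linear] is tested on [a * (g - 1)], cut off where [g > G] so that tilts stay below [a0],
    where influences are bounded. The gain [a * (g - 1) ^+ 2] beats the variance term
    [E * a ^+ 2 * (g - 1) ^+ 2 / 2] since [E * a <= 1]. *)
Lemma ei_small (a : R) : 0 < a -> a * G <= a0 -> E * a <= 1 ->
  a / 2 * \sum_(v | g v <= G) marg r v * xi (g v) <= D.
Proof.
move=> a_gt0 aG aE.
pose w v := if g v <= G then a * (g v - 1) else 0.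
have w_le v : w v <= a0.
  rewrite /w; case: ifP => // gG; apply: le_trans aG.
  by rewrite ler_pM2l//; lra.
have tilt_le (t : R) v : 0 <= t <= 1 -> r v * expR (t * w v) <= expR a0 * r v.
  move=> /andP[t0 t1]; rewrite mulrC ler_wpM2r// ler_expR.
  have [w0|/ltW w0] := leP 0 (w v).
    by apply: le_trans (w_le v); rewrite ler_piMl.
  by apply: le_trans a0_ge0; rewrite mulr_ge0_le0.
have LE (t : R) u : 0 <= t <= 1 -> 0 <= r u * expR (t * w u) <= Lam * expR a0.
  move=> t01; rewrite mulr_ge0 ?expR_ge0//=; apply: le_trans (tilt_le _ _ t01) _.
  by rewrite mulrC ler_wpM2r ?expR_ge0//; have /andP[] := rL u.
have hc (t : R) : 0 <= t <= 1 ->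
    \sum_v marg (fun v => r v * expR (t * w v)) v
      * totinf (fun v => r v * expR (t * w v)) v * w v ^+ 2
    <= \sum_v E * (marg r v * w v ^+ 2).
  move=> t01; apply: ler_sum => v _.
  rewrite mulrA ler_wpM2r ?sqr_ge0// /E.
  have q0 u : 0 <= r u * expR (t * w u) by have /andP[] := LE t u t01.
  have h1 := totinf_eta v (fun u => LE t u t01).
  have h2 := le_trans (marg_le v q0) (tilt_le _ _ t01).
  have h3 := ler_wpM2l (expR_ge0 a0) (act_le_marg v rL).
  have -> : eta * expR a0 * K * marg r v = expR a0 * (K * marg r v) * eta.
    by ring.
  apply: ler_pM => //; first exact: marg_ge0.
    by rewrite addr_ge0// sumr_ge0.
  exact: le_trans h2 h3.
have h1 := dv_linear w; have h2 := gas_log_laplace r0 hc.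
have {h1 h2} h3 : \sum_v nu v * w v <= D + (\sum_v marg r v * w v
    + (\sum_v E * (marg r v * w v ^+ 2)) / 2).
  by apply: le_trans h1 _; rewrite lerD2l.
have h4 : \sum_v (nu v * w v - marg r v * w v - E * (marg r v * w v ^+ 2) / 2)
    <= D.
  by rewrite !sumrB -mulr_suml; lra.
apply: le_trans h4; rewrite mulr_sumr big_mkcond/=; apply: ler_sum => v _.
rewrite nuE /w; case: ifP => gG; last first.
  by rewrite expr0n/=; lra.
have m0 := marg_ge0 v r0; have gv := xi_le_sqr (g_ge0 v).
have -> : marg r v * g v * (a * (g v - 1)) - marg r v * (a * (g v - 1))
    - E * (marg r v * (a * (g v - 1)) ^+ 2) / 2
  = a / 2 * (marg r v * (g v - 1) ^+ 2) * (2 - E * a) by field.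
apply: le_trans (_ : a / 2 * (marg r v * (g v - 1) ^+ 2) <= _).
  by rewrite ler_wpM2l ?divr_ge0 ?(ltW a_gt0)// ler_wpM2l.
rewrite ler_peMr//; last lra.
exact: mulr_ge0 (divr_ge0 (ltW a_gt0) (ler0n _ _)) (mulr_ge0 m0 (sqr_ge0 _)).
Qed.

(** Large ratios need tilts beyond [a0], so the Laplace transform of the test function [ln (g / K)]
    is bounded by [gasZ_tilt_le]. This costs [marg * g], and the choice of [G] still leaves half of
    [marg * g * ln g]. *)
Lemma ei_large : 2^-1 * \sum_(v | ~~ (g v <= G)) marg r v * xi (g v) <= D.
Proof.
pose c v := if g v <= G then 1 else g v / K.
have gK v : ~~ (g v <= G) -> 1 <= g v / K.
  rewrite -ltNge => gG; rewrite ler_pdivlMr// mul1r (le_trans _ (ltW gG))//.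
  rewrite /G exprMn expr2 -mulrA ler_peMr ?(ltW K0)//.
  by rewrite mulr_ege1// exprn_ege1// -[leLHS]expR0 ler_expR.
have c1 v : 1 <= c v.
  by rewrite /c; case: ifP => // /negbT; apply: gK.
have c0 v : 0 < c v by apply: lt_le_trans (c1 v).
have h1 := dv_linear (fun v => ln (c v)).
have ME : M r (fun A => expR (linf (fun v => ln (c v)) A))
    = Z (fun u => r u * c u).
  transitivity (M r (fun A => 1 * expR (\sum_(v in A) ln (c v)))).
    by apply: eq_gasM => // A; rewrite mul1r.
  rewrite gasM_tilt gasZE; apply: eq_gasM => // v.
  by rewrite lnK// posrE.
have z0 := gasZ_gt0 e b_ge0 r0.
have h2 : ln (M r (fun A => expR (linf (fun v => ln (c v)) A)) / Z r)
    <= \sum_(v | ~~ (g v <= G)) marg r v * g v.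
  apply: le_trans (_ : \sum_v r v * (c v - 1) <= _).
    rewrite -ler_expR lnK ?ME; last first.
      rewrite posrE divr_gt0// gasZ_gt0// => u.
      by rewrite mulr_ge0// ltW.
    rewrite ler_pdivrMr// mulrC; exact: gasZ_tilt_le.
  rewrite [leRHS]big_mkcond/=; apply: ler_sum => v _; rewrite /c.
  case: ifP => [_|/negbT gG]; first by rewrite subrr mulr0.
  apply: le_trans (_ : r v * (g v / K) <= _).
    by rewrite ler_wpM2l//; lra.
  have := ler_wpM2r (g_ge0 v) (act_le_marg v rL).
  rewrite mulrA ler_pdivrMr// => /le_trans; apply.
  by rewrite le_eqVlt; apply/orP; left; apply/eqP; ring.
have h3 : \sum_(v | ~~ (g v <= G)) (nu v * ln (g v / K) - marg r v * g v) <= D.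
  rewrite sumrB lerBlDr; apply: le_trans (lerD (lexx D) h2).
  apply: le_trans h1; rewrite big_mkcond/=.
  apply: ler_sum => v _; rewrite /c; case: (boolP (g v <= G)) => //= _.
  by rewrite ln1 mulr0.
apply: le_trans h3; rewrite mulr_sumr; apply: ler_sum => v gG.
have gGl : G < g v by rewrite ltNge.
have g1 : 1 <= g v by apply: le_trans (ltW gGl).
have g0 : 0 < g v by apply: lt_le_trans g1.
rewrite nuE ln_div ?posrE//.
have lnG : 2 * (ln K + 1) <= ln (g v).
  apply: le_trans (_ : ln G <= _); last first.
    by rewrite ler_ln ?posrE ?(ltW gGl)// (lt_le_trans _ G1).
  rewrite /G lnXn ?mulr_gt0 ?expR_gt0// lnM ?posrE ?expR_gt0// expRK.
  by rewrite mulr2n; lra.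
have mg : 0 <= marg r v * g v by rewrite mulr_ge0// marg_ge0.
have h5 : marg r v * xi (g v) <= marg r v * g v * ln (g v).
  rewrite /xi -[leRHS]mulrA; apply: ler_wpM2l; first exact: marg_ge0.
  lra.
have := ler_wpM2l mg lnG; lra.
Qed.

Lemma entropic_independence (a : R) : 0 < a -> a * G <= a0 -> E * a <= 1 ->
  \sum_v marg r v * Fm * xi (nu v / marg r v) <= (2 / a + 2) * gasEnt r f.
Proof.
move=> a_gt0 aG aE; have h1 := ei_small a_gt0 aG aE; have h2 := ei_large.
have -> : gasEnt r f = D * Fm by rewrite /D divfK// gt_eqF.
rewrite mulrA; under eq_bigr => v _.
  rewrite mulrAC; over.
rewrite -mulr_suml ler_wpM2r ?(ltW F0)// (bigID (fun v => g v <= G))/=.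
have {}h1 := ler_wpM2l (_ : 0 <= 2 / a) h1.
have k : 2 / a * (a / 2 * \sum_(v | g v <= G) marg r v * xi (g v))
  = \sum_(v | g v <= G) marg r v * xi (g v).
  have ka : 2 / a * (a / 2) = 1 by field; rewrite gt_eqF.
  by rewrite mulrA ka mul1r.
rewrite k in h1; have {}h1 := h1 (divr_ge0 (ler0n R 2) (ltW a_gt0)).
rewrite mulrDl; apply: lerD => //.
by move: h2; rewrite -/(g _); move: (\sum_(v | _) _) => S; lra.
Qed.

End Fixed. End Main.
End EntropicIndependence.

(** * Thinning and pinning *)

Section Localization.
Variables (R : realType) (V : finType) (e : rel V) (b : R).
Implicit Types (r w : V -> R) (A B T : {set V}) (f g F : {set V} -> R) (u v : V).
Hypotheses (esym : symmetric e) (eirr : irreflexive e).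
Hypotheses (b_ge0 : 0 <= b) (b_lt1 : b < 1).

Local Notation W := (gasW e b).
Local Notation M := (gasM e b).
Local Notation marg := (marg e b).
Local Notation gasEnt := (gasEnt e b).

(** Conditioning on all of [T] being occupied, with [T] then deleted: [occupy] iterated over [T]. *)
Definition pin r T : V -> R :=
  fun u => if u \in T then 0 else r u * b ^+ nbrs_in e T u.

Lemma nbrs_inU T B u : [disjoint T & B] ->
  nbrs_in e (T :|: B) u = (nbrs_in e T u + nbrs_in e B u)%N.
Proof.
move=> TB; rewrite /nbrs_in -cardsUI [X in (_ + X)%N](_ : _ = 0%N) ?addn0.
  by congr #|pred_of_set _|; apply/setP => x; rewrite !inE; case: (e u x);
    rewrite ?andbF ?andbT.
apply/eqP; rewrite cards_eq0; apply/eqP/setP => x; rewrite !inE.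
by have [xT|//] := boolP (x \in T); rewrite (disjointFr TB xT) andbF.
Qed.

Lemma gasW_pin r T B : [disjoint T & B] ->
  W r (T :|: B) = W r T * W (pin r T) B.
Proof.
have [n] := ubnP #|B|; elim: n B => // n IH B.
have [-> _ _|[v vB] Bn TB] := set_0Vmem B; first by rewrite setU0 gasW0 mulr1.
have vD : v \notin B :\ v by rewrite !inE eqxx.
have TBv : [disjoint T & B :\ v] by apply: disjointWr TB; apply: subD1set.
have vT : v \notin T.
  by apply/negP => vT; have := disjointFr TB vT; rewrite vB.
rewrite -(setD1K vB) setUCA !gasWU ?inE ?eqxx ?(negPf vT)//.
rewrite IH//; last by move: Bn; rewrite (cardsD1 v) vB.
rewrite nbrs_inU// /pin (negPf vT) exprD.
move: (b ^+ nbrs_in e T v) (b ^+ _) (W _ _) (W _ _) => x y z t.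
by ring.
Qed.

Lemma gasW_pin0 r T B : ~~ [disjoint T & B] -> W (pin r T) B = 0.
Proof.
rewrite -setI_eq0 => /set0Pn[v]; rewrite inE => /andP[vT vB].
by apply: (gasW_eq0 e b (v := v)) => //; rewrite /pin vT.
Qed.

Lemma gasW_scaled r (c : R) B : W (fun u => c * r u) B = c ^+ #|B| * W r B.
Proof. by rewrite /gasW big_split/= prodr_const mulrA. Qed.

Lemma gasW_sub0 r T A : T \subset A -> W r T = 0 -> W r A = 0.
Proof.
move=> TA WT; have E : T :|: (A :\: T) = A.
  apply/setP => x; rewrite !inE.
  by have [xT|//] := boolP (x \in T); rewrite (subsetP TA).
rewrite -E gasW_pin ?WT ?mul0r// -setI_eq0.
by apply/eqP/setP => x; rewrite !inE; case: (x \in T).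
Qed.

(** Keep each site of a random [A] independently with probability [1 - th] and call the kept set
    [T]: multiplied by [(1 - th) ^+ #|T|], this is the contribution of [T] to the total mass of
    [F]. *)
Definition amass r F T (th : R) : R :=
  \sum_(A : {set V} | T \subset A) W r A * F A * th ^+ #|A :\: T|.

Lemma amassE r F T th :
  amass r F T th = W r T * M (fun u => th * pin r T u) (fun B => F (T :|: B)).
Proof.
rewrite /amass /gasM mulr_sumr [RHS](bigID (fun B => [disjoint T & B]))/=.
rewrite [X in _ + X]big1 ?addr0; last first.
  by move=> B TB; rewrite gasW_scaled gasW_pin0// mulr0 mul0r mulr0.
rewrite (reindex_onto (fun B => T :|: B) (fun A => A :\: T))/=; last first.
  move=> A TA; apply/setP => x; rewrite !inE.
  by have [xT|//] := boolP (x \in T); rewrite (subsetP TA).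
apply: eq_big => [B|B].
  rewrite subsetUl/= setDUl setDv set0U disjoint_sym.
  by apply/eqP/idP => /setDidPl.
rewrite subsetUl/= setDUl setDv set0U => /eqP BT.
have TB : [disjoint T & B] by rewrite disjoint_sym; apply/setDidPl.
rewrite BT gasW_scaled gasW_pin//.
by move: (th ^+ _) (W _ _) (W _ _) (F _) => x y z t; ring.
Qed.

Lemma sum_subset_weights A (th : R) :
  \sum_(T : {set V} | T \subset A) (1 - th) ^+ #|T| * th ^+ #|A :\: T| = 1.
Proof.
pose F u : R := if u \in A then 1 - th else 0.
pose G u : R := if u \in A then th else 1.
transitivity (\prod_u (F u + G u)); last first.
  by rewrite big1// => u _; rewrite /F /G; case: ifP => _; ring.
rewrite bigA_distr [RHS](bigID (fun T : {set V} => T \subset A))/=.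
rewrite [X in _ = _ + X]big1 ?addr0 => [|T]; last first.
  by move=> /subsetPn[u uT uA]; rewrite (bigD1 u)//= uT /F (negPf uA) mul0r.
apply: eq_bigr => T TA.
rewrite (bigID (fun u => u \in T))/=; congr (_ * _).
  rewrite -prodr_const; apply: eq_bigr => u uT.
  by rewrite uT /F (subsetP TA).
rewrite -prodr_const [LHS]big_mkcond [RHS]big_mkcond/=.
by apply: eq_bigr => u _; rewrite !inE /G; case: (u \in T) => //=;
  case: (u \in A).
Qed.

Lemma sum_amass r F (th : R) :
  \sum_(T : {set V}) (1 - th) ^+ #|T| * amass r F T th = \sum_A W r A * F A.
Proof.
under eq_bigr do rewrite mulr_sumr.
rewrite (exchange_big_dep predT)//=; apply: eq_bigr => A _.
transitivity (W r A * F A * (\sum_(T : {set V} | T \subset A)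
    (1 - th) ^+ #|T| * th ^+ #|A :\: T|)); last first.
  by rewrite sum_subset_weights mulr1.
rewrite mulr_sumr; apply: eq_bigr => T _.
by move: (W r A * F A) ((1 - th) ^+ _) (th ^+ _) => x y z; ring.
Qed.

(** Differentiating [th ^+ #|A :\: T|] selects one site of [A] outside [T] and moves it into [T]. *)
Lemma is_derive_amass r F T (th : R) :
  is_derive th 1 (amass r F T) (\sum_(v | v \notin T) amass r F (v |: T) th).
Proof.
have E : \sum_(v | v \notin T) amass r F (v |: T) th =
    \sum_(A : {set V} | T \subset A)
      W r A * F A * (#|A :\: T|%:R * th ^+ (#|A :\: T|).-1 * 1).
  rewrite /amass (exchange_big_dep (fun A : {set V} => T \subset A))/=; last first.
    by move=> v A _; rewrite subUset => /andP[].
  apply: eq_bigr => A TA; rewrite -mulr_sumr mulr1; congr (_ * _).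
  rewrite -[X in _ = X%:R * _]sum1_card natr_sum mulr_suml.
  apply: eq_big => [v|v].
    by rewrite subUset sub1set TA andbT !inE.
  rewrite subUset sub1set => /andP[vT /andP[vA _]]; rewrite mul1r.
  rewrite (cardsD1 v (A :\: T)) !inE vT vA/=; congr (_ ^+ #|pred_of_set _|).
  by apply/setP => x; rewrite !inE negb_or andbA.
rewrite E; apply: (@is_derive_sumf R _ _ _
  (fun (A : {set V}) th => W r A * F A * th ^+ #|A :\: T|)) => A _.
apply: (is_derive_val (is_derive_mulf (is_derive_cstf th (W r A * F A))
  (is_derive_expnf #|A :\: T| (is_derive_idf th)))).
by rewrite mul0r add0r.
Qed.

Lemma amass_sub0 r F T (th : R) : W r T = 0 -> amass r F T th = 0.
Proof.
by move=> WT; apply: big1 => A TA; rewrite (gasW_sub0 TA WT) !mul0r.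
Qed.

End Localization.

(** * Entropy along the thinning flow *)

Section EntropyConservation.
Variables (R : realType) (V : finType) (e : rel V) (b : R).
Implicit Types (A B T : {set V}) (F : {set V} -> R) (u v : V) (th : R).
Hypotheses (esym : symmetric e) (eirr : irreflexive e).
Hypotheses (b_ge0 : 0 <= b) (b_lt1 : b < 1).

Local Notation W := (gasW e b).
Local Notation M := (gasM e b).
Local Notation Z := (gasZ e b).
Local Notation marg := (marg e b).
Local Notation gasEnt := (gasEnt e b).
Local Notation pinr := (pin e b).
Local Notation amass := (amass e b).

Variables (Lam kappa : R).
Hypothesis kappa_ei : forall (r : V -> R) (f : {set V} -> R),
  (forall u, 0 <= r u <= Lam) -> (forall A, 0 < f A) ->
  \sum_v marg r v * M r f
    * xi (M r (fun A => (v \in A)%:R * f A) / M r f / marg r v)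
  <= kappa * gasEnt r f.

Variables (r : V -> R) (f : {set V} -> R).
Hypotheses (rL : forall u, 0 <= r u <= Lam) (f0 : forall A, 0 < f A).

Let r0 u : 0 <= r u. Proof. by have /andP[] := rL u. Qed.
Let act th T : V -> R := fun u => th * pinr r T u.
Let dens T : {set V} -> R := fun B => f (T :|: B).
Let a T th := amass r f T th.
Let z T th := amass r (fun=> 1) T th.
Let L T th := ln (a T th / z T th).
(** [z (v |: T) th] times the Bregman divergence between the conditional means of [f] after and
    before [v] is revealed. *)
Let loss T v th := a (v |: T) th * L (v |: T) th - a (v |: T) th * L T th
  - a (v |: T) th + a T th / z T th * z (v |: T) th.
Let Psi th := \sum_(T | W r T != 0) (1 - th) ^+ #|T| * (a T th * L T th).
(** By [phiE], the expected entropy left in [f] once each occupied site has been revealed with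
    probability [1 - th]; at [th = 1] nothing is revealed. *)
Let phi th := \sum_A W r A * (f A * ln (f A)) - Psi th.

Lemma pin_ge0 T u : 0 <= pinr r T u.
Proof. by rewrite /pin; case: ifP => // _; rewrite mulr_ge0 ?exprn_ge0. Qed.

Lemma pin_le T u : pinr r T u <= r u.
Proof.
rewrite /pin; case: ifP => // _.
by rewrite ler_piMr// exprn_ile1// ltW.
Qed.

Let act_ge0 th T u : 0 <= th -> 0 <= act th T u.
Proof. by move=> th0; rewrite mulr_ge0 ?pin_ge0. Qed.

Let actL th T u : 0 <= th <= 1 -> 0 <= act th T u <= Lam.
Proof.
move=> /andP[th0 th1]; rewrite act_ge0//=; have /andP[_] := rL u.
by apply: le_trans; apply: le_trans (pin_le T u); rewrite ler_piMl ?pin_ge0.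
Qed.

Let aE T th : a T th = W r T * M (act th T) (dens T).
Proof. exact: amassE. Qed.

Let zE T th : z T th = W r T * Z (act th T).
Proof. by rewrite /z amassE// gasZE. Qed.

Let W_gt0 T : W r T != 0 -> 0 < W r T.
Proof. by move=> WT; rewrite lt_neqAle eq_sym WT gasW_ge0. Qed.

Let a_gt0 T th : W r T != 0 -> 0 <= th -> 0 < a T th.
Proof.
move=> WT th0; rewrite aE mulr_gt0 ?W_gt0// gasM_gt0//.
  by move=> u; apply: act_ge0.
by move=> A; apply: f0.
Qed.

Let z_gt0 T th : W r T != 0 -> 0 <= th -> 0 < z T th.
Proof.
move=> WT th0; rewrite zE mulr_gt0 ?W_gt0// gasZ_gt0//.
by move=> u; apply: act_ge0.
Qed.

Lemma amass_occupied F T v th : v \notin T ->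
  th * amass r F (v |: T) th
  = W r T * M (act th T) (fun B => (v \in B)%:R * F (T :|: B)).
Proof.
move=> vT.
have -> : M (act th T) (fun B => (v \in B)%:R * F (T :|: B))
    = M (act th T) (fun B => (v \in T :|: B)%:R * F (T :|: B)).
  by apply: eq_gasM => // B; rewrite inE (negPf vT).
rewrite -(amassE b esym eirr r (fun A => (v \in A)%:R * F A)).
rewrite /amass mulr_sumr.
rewrite [RHS](bigID (fun A : {set V} => v \in A))/=.
rewrite [X in _ = _ + X]big1 ?addr0; last first.
  by move=> A /andP[_ /negPf ->]; rewrite mul0r mulr0 mul0r.
apply: eq_big => [A|A]; first by rewrite subUset sub1set andbC.
rewrite subUset sub1set => /andP[vA TA]; rewrite vA mul1r mulrCA -exprS.
congr (_ * _ ^+ _); rewrite (cardsD1 v (A :\: T)) !inE vT vA/= add1n.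
by congr (#|pred_of_set _|.+1); apply/setP => x; rewrite !inE negb_or andbA.
Qed.

Lemma phiE th : 0 <= th -> phi th =
  \sum_(T | W r T != 0) (1 - th) ^+ #|T| * (W r T * gasEnt (act th T) (dens T)).
Proof.
move=> th0; rewrite /phi -(sum_amass e b r (fun A => f A * ln (f A)) th).
rewrite (bigID (fun T => W r T != 0))/= [X in _ + X - _]big1 ?addr0; last first.
  move=> T; rewrite negbK => /eqP WT.
  by rewrite amass_sub0// mulr0.
rewrite /Psi -sumrB; apply: eq_bigr => T WT; rewrite -mulrBr; congr (_ * _).
rewrite /L aE zE amassE// /gasEnt mulrBr mulrA; congr (_ - _ * ln _).
have := W_gt0 WT; have : 0 < Z (act th T).
  by apply: gasZ_gt0 => // u; apply: act_ge0.
move: (W r T) (Z _) (M _ _) => x y t y0 x0.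
by field; rewrite !gt_eqF.
Qed.

Lemma sum_remove_vertex (G : {set V} -> R) th :
  \sum_(T : {set V}) #|T|%:R * (1 - th) ^+ #|T|.-1 * G T
  = \sum_(T : {set V}) \sum_(v | v \notin T) (1 - th) ^+ #|T| * G (v |: T).
Proof.
transitivity (\sum_(T : {set V}) \sum_(v | v \in T) (1 - th) ^+ #|T|.-1 * G T).
  by apply: eq_bigr => T _; rewrite sumr_const -[RHS]mulr_natl mulrA.
rewrite (exchange_big_dep predT)//= [RHS](exchange_big_dep predT)//=.
apply: eq_bigr => v _.
rewrite (reindex_onto (fun T : {set V} => v |: T) (fun T : {set V} => T :\ v))/=;
  last by move=> T vT; rewrite setD1K.
apply: eq_big => [T|T].
  rewrite setU11/=; apply/eqP/idP => [<-|vT]; first by rewrite setD11.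
  by rewrite setU1K.
move=> /andP[_ /eqP E]; have vT : v \notin T by rewrite -E setD11.
by rewrite cardsU1 vT.
Qed.

Lemma is_derive_Psi th : 0 < th ->
  is_derive th 1 Psi (- \sum_(T | W r T != 0)
    (1 - th) ^+ #|T| * \sum_(v | v \notin T) loss T v th).
Proof.
move=> th0.
pose a' T := \sum_(v | v \notin T) a (v |: T) th.
pose z' T := \sum_(v | v \notin T) z (v |: T) th.
have d1 : is_derive th 1 (fun t : R => 1 - t) (- 1).
  apply: (is_derive_val (is_derive_subf (is_derive_cstf th 1) (is_derive_idf th))).
  by rewrite sub0r.
have da T : is_derive th 1 (a T) (a' T) by apply: is_derive_amass.
have dz T : is_derive th 1 (z T) (z' T) by apply: is_derive_amass.
have dT T : W r T != 0 ->
    is_derive th 1 (fun t => (1 - t) ^+ #|T| * (a T t * L T t))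
    (- (#|T|%:R * (1 - th) ^+ #|T|.-1 * (a T th * L T th))
     + (1 - th) ^+ #|T| * (a' T * L T th + a' T - a T th / z T th * z' T)).
  move=> WT; have ap := a_gt0 WT (ltW th0); have zp := z_gt0 WT (ltW th0).
  have dq := is_derive_divf (lt0r_neq0 zp) (da T) (dz T).
  have dL := is_derive_lnf (f := fun t => a T t / z T t) (divr_gt0 ap zp) dq.
  have dd := is_derive_mulf (is_derive_expnf #|T| d1) (is_derive_mulf (da T) dL).
  apply: (is_derive_val dd); rewrite /L.
  move: (#|T|%:R * _) ((1 - th) ^+ #|T|) (ln _) => x y l.
  move: (a T th) (z T th) (a' T) (z' T) ap zp => p q p' q' p0 q0.
  by rewrite expr2; field; rewrite !gt_eqF.
apply: (is_derive_val (is_derive_sumf (index_enum _) dT)).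
rewrite big_split/= sumrN.
(* The derivative of [(1 - th) ^+ #|T|] is reindexed by the set before its last site was revealed,
   to be combined with the derivatives of the masses at that set. *)
have -> : \sum_(T | W r T != 0)
      #|T|%:R * (1 - th) ^+ #|T|.-1 * (a T th * L T th)
    = \sum_(T | W r T != 0) (1 - th) ^+ #|T| *
        \sum_(v | v \notin T) a (v |: T) th * L (v |: T) th.
  have -> : \sum_(T | W r T != 0)
      #|T|%:R * (1 - th) ^+ #|T|.-1 * (a T th * L T th)
     = \sum_(T : {set V}) #|T|%:R * (1 - th) ^+ #|T|.-1 * (a T th * L T th).
    rewrite [RHS](bigID (fun T => W r T != 0))/= [X in _ = _ + X]big1 ?addr0//.
    by move=> T; rewrite negbK => /eqP WT; rewrite /a amass_sub0// mul0r mulr0.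
  rewrite (sum_remove_vertex (fun T => a T th * L T th)).
  rewrite (bigID (fun T => W r T != 0))/= [X in _ + X]big1 ?addr0; last first.
    move=> T; rewrite negbK => /eqP WT; apply: big1 => v vT.
    rewrite /a amass_sub0 ?mul0r ?mulr0//.
    by apply: (gasW_sub0 esym eirr (T := T)) => //; apply: subsetUr.
  by apply: eq_bigr => T _; rewrite mulr_sumr.
rewrite -sumrN -big_split/= -sumrN; apply: eq_bigr => T _.
have -> : \sum_(v | v \notin T) loss T v th =
    \sum_(v | v \notin T) a (v |: T) th * L (v |: T) th - a' T * L T th - a' T
    + a T th / z T th * z' T.
  by rewrite /loss big_split/= !sumrB -mulr_suml -mulr_sumr.
move: (\sum_(_ | _) _) (_ ^+ _) (a' T) (z' T) (a T th / _) (L T th).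
by move=> s c p p' q l; ring.
Qed.

(** [th] times the mass at [v |: T] is the mass at [T] restricted to [v] occupied in the thinned gas
    ([amass_occupied]). So the losses at [T] add up to the left side of [kappa_ei] for the gas
    pinned at [T] and thinned to [th]. *)
Lemma sum_loss T th : 0 < th <= 1 -> W r T != 0 ->
  th * \sum_(v | v \notin T) loss T v th
  <= kappa * (W r T * gasEnt (act th T) (dens T)).
Proof.
move=> /andP[th0 th1] WT; have w0 := W_gt0 WT.
have q0 u : 0 <= act th T u by apply: act_ge0; apply: ltW.
have qL u : 0 <= act th T u <= Lam by apply: actL; rewrite ltW.
have d0 A : 0 < dens T A by apply: f0.
have F0 := gasM_gt0 e b_ge0 q0 d0; have Z0 := gasZ_gt0 e b_ge0 q0.
rewrite mulrCA; apply: le_trans (ler_wpM2l (ltW w0) (kappa_ei qL d0)).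
rewrite !mulr_sumr [leLHS]big_mkcond/=.
rewrite le_eqVlt; apply/orP; left; apply/eqP; apply: eq_bigr => v _.
have [vT|vT] := boolP (v \in T) => /=.
  have -> : marg (act th T) v = 0.
    by apply: marg_eq0; rewrite /act /pin vT mulr0.
  by rewrite !mul0r mulr0.
set m1 := M (act th T) (fun A => (v \in A)%:R * dens T A).
pose z1 := M (act th T) (fun A => (v \in A)%:R * 1).
have aTv : a (v |: T) th = W r T * m1 / th.
  by rewrite -amass_occupied// mulrC mulKf ?gt_eqF.
have zTv : z (v |: T) th = W r T * z1 / th.
  rewrite /z1 -(amass_occupied (fun=> 1) th vT) mulrC mulKf ?gt_eqF//.
have mE : marg (act th T) v = z1 / Z (act th T).
  by rewrite /marg; congr (_ / _); apply: eq_gasM => // A; rewrite mulr1.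
have [v0|v0] := eqVneq (act th T v) 0.
  have m10 : m1 = 0 by rewrite /m1 gasM_occupied// v0 mul0r.
  have z10 : z1 = 0 by rewrite /z1 gasM_occupied// v0 mul0r.
  by rewrite mE z10 !mul0r mulr0 /loss aTv zTv m10 z10; ring.
have vp : 0 < act th T v by rewrite lt_neqAle eq_sym v0 q0.
have o0 u : 0 <= occupy e b (act th T) v u by apply: occupy_ge0.
have m1p : 0 < m1.
  rewrite /m1 gasM_occupied// mulr_gt0//; apply: (gasM_gt0 e b_ge0 o0) => A.
  exact: d0.
have z1p : 0 < z1.
  by rewrite /z1 gasM_occupied// mulr_gt0//; apply: (gasM_gt0 e b_ge0 o0).
have Lv : L (v |: T) th = ln m1 - ln z1.
  rewrite /L aTv zTv -ln_div ?posrE//; congr ln.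
  by move: (W r T) w0 z1p => w w0 z1p; field; rewrite !gt_eqF.
have LT : L T th = ln (M (act th T) (dens T)) - ln (Z (act th T)).
  rewrite /L aE zE -ln_div ?posrE//; congr ln.
  by move: (W r T) w0 (M _ _) => w w0 t; field; rewrite !gt_eqF.
rewrite mE /xi !ln_div ?posrE ?divr_gt0// /loss Lv LT aTv zTv aE zE.
move: (ln m1) (ln z1) (ln (M _ _)) (ln (Z _)) => l1 l2 l3 l4.
move: (W r T) w0 (M (act th T) (dens T)) F0 (Z _) Z0 => w w0 t t0 y y0.
by clearbody m1 z1; field; rewrite !gt_eqF.
Qed.

(** A Gronwall argument: the derivative of [phi] at [t] is the total loss, at most
    [kappa / t * phi t], so [phi] times the power [- kappa] of [t] is nonincreasing between [th] and
    1. *)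
Lemma entropy_conservation th : 0 < th <= 1 ->
  gasEnt r f <= expR (- (kappa * ln th)) *
    \sum_(T : {set V}) (1 - th) ^+ #|T| *
      (W r T * gasEnt (fun u => th * pinr r T u) (fun B => f (T :|: B))).
Proof.
move=> /andP[th0 th1].
have phi1 : phi 1 = gasEnt r f.
  rewrite phiE// (bigD1 set0)/= ?gasW0 ?oner_neq0// big1 ?addr0; last first.
    move=> T /andP[_ T0]; rewrite subrr expr0n cards_eq0 (negPf T0) mul0r.
    by [].
  rewrite cards0 expr0 !mul1r.
  have E1 : act 1 set0 =1 r.
    move=> u; rewrite /act /pin inE mul1r.
    have -> : nbrs_in e set0 u = 0%N.
      by apply/eqP; rewrite cards_eq0; apply/eqP/setP => x; rewrite !inE.
    by rewrite expr0 mulr1.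
  rewrite /gasEnt (eq_gasZ e b E1); congr (_ - _ * ln (_ / _));
    by apply: eq_gasM => // A; rewrite /dens set0U.
have -> : \sum_(T : {set V}) (1 - th) ^+ #|T| *
      (W r T * gasEnt (fun u => th * pinr r T u) (fun B => f (T :|: B)))
    = phi th.
  rewrite phiE; last exact: ltW.
  rewrite [LHS](bigID (fun T => W r T != 0))/= [X in _ + X]big1 ?addr0//.
  by move=> T; rewrite negbK => /eqP ->; rewrite mul0r mulr0.
pose S t := \sum_(T | W r T != 0) (1 - t) ^+ #|T| *
  \sum_(v | v \notin T) loss T v t.
have S_le t : th <= t <= 1 -> t * S t <= kappa * phi t.
  move=> /andP[tt t1]; have t0 : 0 < t by apply: lt_le_trans tt.
  rewrite phiE ?(ltW t0)// /S !mulr_sumr; apply: ler_sum => T WT.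
  rewrite mulrCA [leRHS]mulrCA ler_wpM2l ?exprn_ge0 ?subr_ge0//.
  by apply: sum_loss => //; rewrite t0.
pose H (t : R) := expR (- (kappa * ln t)) * phi t.
have dH (t : R) : th <= t <= 1 ->
    is_derive t 1 H (expR (- (kappa * ln t)) * (S t - kappa / t * phi t)).
  move=> /andP[tt t1]; have t0 : 0 < t by apply: lt_le_trans tt.
  have h1 := is_derive_oppf (is_derive_mulf (is_derive_cstf t kappa)
    (is_derive_lnf (f := fun t => t) t0 (is_derive_idf t))).
  have h2 := is_derive_subf
    (is_derive_cstf t (\sum_A W r A * (f A * ln (f A)))) (is_derive_Psi t0).
  apply: (is_derive_val (is_derive_mulf (is_derive_expf h1) h2)).
  rewrite -/(S t) /phi; move: (\sum_A _) (Psi t) (S t) (ln t) => s p q l.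
  by field; rewrite gt_eqF.
have := is_derive_nonincreasing th1 dH; rewrite /H ln1 mulr0 oppr0 expR0 mul1r.
rewrite phi1; apply => t tt; have := S_le t tt.
move: tt => /andP[tt t1]; have t0 : 0 < t by apply: lt_le_trans tt.
move=> h; rewrite mulr_ge0_le0 ?expR_ge0// subr_le0.
by rewrite mulrAC ler_pdivlMr// mulrC.
Qed.

End EntropyConservation.

(** * Local entropies *)

Section TwoPointEntropy.
Variable R : realType.
Implicit Types a c x y m k : R.

Definition twoEnt a c x y : R :=
  a * (x * ln x) + c * (y * ln y) - (a * x + c * y) * ln ((a * x + c * y) / (a + c)).

Definition breg x m : R := x * ln x - x * ln m - x + m.

Lemma bregE x m : 0 < x -> 0 < m -> breg x m = m * xi (x / m).
Proof.
by move=> x0 m0; rewrite /breg /xi ln_div ?posrE//; field; rewrite gt_eqF.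
Qed.

Lemma breg_ge0 x m : 0 < x -> 0 < m -> 0 <= breg x m.
Proof.
move=> x0 m0; rewrite bregE//.
exact: mulr_ge0 (ltW m0) (xi_ge0 (divr_ge0 (ltW x0) (ltW m0))).
Qed.

Lemma twoEnt_homog k a c x y : twoEnt (k * a) (k * c) x y = k * twoEnt a c x y.
Proof.
rewrite /twoEnt; have [->|k0] := eqVneq k 0; first by rewrite !mul0r; ring.
have -> : (k * a * x + k * c * y) / (k * a + k * c) = (a * x + c * y) / (a + c).
  rewrite -[k * a + _]mulrDr; have [->|s0] := eqVneq (a + c) 0.
    by rewrite mulr0 invr0 !mulr0.
  by field; rewrite s0.
by move: (ln (_ / _)) => l; ring.
Qed.

Lemma twoEnt0 c x y : twoEnt 0 c x y = 0.
Proof.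
rewrite /twoEnt !mul0r !add0r; have [->|c0] := eqVneq c 0; first by ring.
have -> : c * y / c = y by field.
by ring.
Qed.

Lemma twoEnt0r a x y : twoEnt a 0 x y = 0.
Proof.
rewrite /twoEnt !mul0r !addr0; have [->|a0] := eqVneq a 0; first by ring.
have -> : a * x / a = x by field.
by ring.
Qed.

Lemma twoEntC a c x y : twoEnt a c x y = twoEnt c a y x.
Proof. by rewrite /twoEnt [c * y + _]addrC [c + a]addrC; ring. Qed.

Lemma twoEntE a c x y (m := (a * x + c * y) / (a + c)) :
  0 <= a -> 0 <= c -> 0 < a + c -> twoEnt a c x y = a * breg x m + c * breg y m.
Proof.
move=> a0 c0 ac.
have E : a * x + c * y = m * (a + c) by rewrite /m divfK// gt_eqF.
rewrite /twoEnt /breg -/m.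
transitivity (a * (x * ln x) + c * (y * ln y) - (a * x + c * y) * ln m
  - (a * x + c * y) + m * (a + c)); last by ring.
by rewrite -E; ring.
Qed.

Lemma comb_gt0 a c x y : 0 <= a -> 0 <= c -> 0 < a + c -> 0 < x -> 0 < y ->
  0 < a * x + c * y.
Proof.
move=> a0 c0 ac x0 y0; have [aE|aN] := eqVneq a 0.
  by rewrite aE mul0r add0r mulr_gt0//; move: ac; rewrite aE add0r.
by rewrite ltr_pwDl ?mulr_gt0 ?mulr_ge0 ?(ltW y0)// lt_neqAle eq_sym aN.
Qed.

Lemma mean_gt0 a c x y : 0 <= a -> 0 <= c -> 0 < a + c -> 0 < x -> 0 < y ->
  0 < (a * x + c * y) / (a + c).
Proof. by move=> a0 c0 ac x0 y0; rewrite divr_gt0// comb_gt0. Qed.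

(* [twoEnt] is an infimum over reference values [m], attained at the mean. *)
Lemma twoEnt_le_breg a c x y m : 0 <= a -> 0 <= c -> 0 < x -> 0 < y -> 0 < m ->
  twoEnt a c x y <= a * breg x m + c * breg y m.
Proof.
move=> a0 c0 x0 y0 m0.
have [ac|ac] := eqVneq (a + c) 0.
  have a00 : a = 0 by lra.
  have c00 : c = 0 by lra.
  by rewrite a00 c00 twoEnt0; lra.
have {}ac : 0 < a + c by rewrite lt_neqAle eq_sym ac addr_ge0.
set F := a * x + c * y.
have F0 : 0 < F by apply: comb_gt0.
have q0 : 0 < F / (a + c) by rewrite divr_gt0.
have := mulr_ge0 (ltW ac) (breg_ge0 q0 m0).
have -> : (a + c) * breg (F / (a + c)) m
    = F * ln (F / (a + c)) - F * ln m - F + (a + c) * m.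
  by rewrite /breg; move: (ln _) (ln m) => l1 l2; field; rewrite gt_eqF.
rewrite /twoEnt /breg -/F => h.
have -> : a * (x * ln x - x * ln m - x + m) + c * (y * ln y - y * ln m - y + m)
  = a * (x * ln x) + c * (y * ln y) - F * ln m - F + (a + c) * m.
  by rewrite /F; ring.
lra.
Qed.

(** The mean for the larger mass [a] serves as reference value for both masses, and Bregman terms
    are nonnegative. *)
Lemma twoEnt_mono a a' c x y : 0 <= a' <= a -> 0 <= c -> 0 < x -> 0 < y ->
  twoEnt a' c x y <= twoEnt a c x y.
Proof.
move=> /andP[a'0 a'a] c0 x0 y0.
have a0 : 0 <= a by apply: le_trans a'a.
have [ac|ac] := eqVneq (a + c) 0.
  have a00 : a = 0 by lra.
  have a'00 : a' = 0 by lra.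
  by rewrite a00 a'00.
have {}ac : 0 < a + c by rewrite lt_neqAle eq_sym ac addr_ge0.
have m0 := mean_gt0 a0 c0 ac x0 y0.
rewrite [leRHS]twoEntE//; apply: le_trans (twoEnt_le_breg a'0 c0 x0 y0 m0) _.
by rewrite lerD2r ler_wpM2r// breg_ge0.
Qed.

Lemma twoEnt_ge0 a c x y : 0 <= a -> 0 <= c -> 0 < x -> 0 < y ->
  0 <= twoEnt a c x y.
Proof.
move=> a0 c0 x0 y0; rewrite -(twoEnt0 c x y).
by apply: twoEnt_mono => //; rewrite lexx.
Qed.

End TwoPointEntropy.

Section LocalEntropy.
Variables (R : realType) (V : finType) (e : rel V) (b : R).
Implicit Types (r : V -> R) (A B T : {set V}) (f F : {set V} -> R) (u v w : V).
Hypotheses (esym : symmetric e) (eirr : irreflexive e).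
Hypotheses (b_ge0 : 0 <= b) (b_lt1 : b < 1).

Local Notation W := (gasW e b).
Local Notation M := (gasM e b).
Local Notation Z := (gasZ e b).
Local Notation occ := (occupy e b).
Local Notation gasEnt := (gasEnt e b).
Local Notation pinr := (pin e b).

(** [Z r] times the expected conditional entropy of [f] at [w] given all other sites. *)
Definition locEnt r w f : R := \sum_(B : {set V} | w \notin B)
  twoEnt (W r (w |: B)) (W r B) (f (w |: B)) (f B).

Lemma locEnt_ge0 r w f : (forall u, 0 <= r u) -> (forall A, 0 < f A) ->
  0 <= locEnt r w f.
Proof.
by move=> r0 f0; apply: sumr_ge0 => B _; apply: twoEnt_ge0; rewrite ?gasW_ge0.
Qed.

Lemma locEntE r w f : locEnt r w f =
  M (vacate r w) (fun B => twoEnt (r w * b ^+ nbrs_in e B w) 1 (f (w |: B)) (f B)).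
Proof.
rewrite /gasM [RHS](bigID (fun B : {set V} => w \notin B))/=.
rewrite [X in _ = _ + X]big1 ?addr0 => [|B]; last first.
  rewrite negbK => wB; rewrite (gasW_eq0 e b (v := w)) ?mul0r//.
  by rewrite /vacate eqxx.
apply: eq_bigr => B wB; rewrite gasW_vacate// gasWU//.
by rewrite -[in LHS](mulr1 (W r B)) -mulrA mul1r twoEnt_homog.
Qed.

Lemma locEnt_vacant r w f : r w = 0 -> locEnt r w f = 0.
Proof.
move=> rw; apply: big1 => B wB.
by rewrite (gasW_eq0 e b rw) ?twoEnt0// setU11.
Qed.

Lemma locEnt_split r v w f : w != v ->
  locEnt r w f = locEnt (vacate r v) w f
    + r v * locEnt (occ r v) w (fun A => f (v |: A)).
Proof.
move=> wv; rewrite !locEntE (gasM_split b esym eirr _ _ v).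
have -> : vacate r w v = r v by rewrite /vacate eq_sym (negPf wv).
congr (_ + _ * _).
  apply: eq_gasM; first by move=> u; rewrite /vacate; do 2 case: ifP.
  by move=> B; rewrite /vacate (negPf wv).
have E : occ (vacate r w) v =1 vacate (occ r v) w.
  by move=> u; rewrite /occupy /vacate; do 2 case: ifP; rewrite ?mul0r.
rewrite /gasM; apply: eq_bigr => B _.
rewrite (eq_gasW e b (r' := vacate (occ r v) w)); last by move=> u _; apply: E.
have [vB|vB] := boolP (v \in B).
  rewrite (gasW_eq0 e b (v := v)) ?mul0r// /vacate /occupy eqxx.
  by case: ifP.
congr (_ * _); rewrite setUCA; congr (twoEnt _ _ _ _).
rewrite /occupy (negPf wv) -mulrA -exprD; congr (_ * _ ^+ _).
rewrite nbrs_inU; last by rewrite disjoints1.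
congr (_ + _)%N; rewrite /nbrs_in.
have [evw|evw] := boolP (e v w).
  rewrite (_ : [set u in _ | _] = [set v]) ?cards1//.
  by apply/setP => x; rewrite !inE; case: eqP => //= ->; rewrite esym.
rewrite (_ : [set u in _ | _] = finset.set0) ?cards0//.
apply/setP => x; rewrite !inE; case: eqP => //= ->.
by rewrite esym (negPf evw).
Qed.

(** Chain rule for revealing [v]; the last term is the entropy of the two conditional means, the
    part that [marginal_entropy_le] bounds later. *)
Lemma gasEnt_split r v f : (forall u, 0 <= r u) -> (forall A, 0 < f A) ->
  gasEnt r f = gasEnt (vacate r v) f
    + r v * gasEnt (occ r v) (fun A => f (v |: A))
    + twoEnt (r v * Z (occ r v)) (Z (vacate r v))
        (M (occ r v) (fun A => f (v |: A)) / Z (occ r v))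
        (M (vacate r v) f / Z (vacate r v)).
Proof.
move=> r0 f0.
have zo := gasZ_gt0 e b_ge0 (occupy_ge0 e b_ge0 v r0).
have zv := gasZ_gt0 e b_ge0 (vacate_ge0 v r0).
rewrite /gasEnt /twoEnt (gasM_split b esym eirr r (fun A => _ * ln _) v).
rewrite (gasM_split b esym eirr r f v) (gasZ_split b esym eirr r v).
have -> : r v * Z (occ r v) * (M (occ r v) (fun A => f (v |: A)) / Z (occ r v))
   = r v * M (occ r v) (fun A => f (v |: A)).
  by move: (M _ _) => y; field; rewrite gt_eqF.
have -> : Z (vacate r v) * (M (vacate r v) f / Z (vacate r v)) = M (vacate r v) f.
  by move: (M _ _) => y; field; rewrite gt_eqF.
rewrite [r v * _ + M (vacate r v) f]addrC [r v * _ + Z (vacate r v)]addrC.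
move: (ln ((_ + _) / (_ + _))) (ln (M (occ r v) _ / _)) (ln (M (vacate r v) _ / _)).
move: (M (vacate r v) _) (M (vacate r v) _) (M (occ r v) _) (M (occ r v) _).
move: (Z _) zo (Z _) zv => z1 z10 z2 z20 m1 m2 m3 m4 l1 l2 l3.
by field; rewrite !gt_eqF.
Qed.

(* Thinning the activities by [th] and pinning a random set can only decrease
   local entropies, since [twoEnt] is nondecreasing in the occupied mass. *)
Lemma sum_locEnt_pin r w f (th : R) : 0 <= th <= 1 ->
  (forall u, 0 <= r u) -> (forall A, 0 < f A) ->
  \sum_(T : {set V}) (1 - th) ^+ #|T| *
    (W r T * locEnt (fun u => th * pinr r T u) w (fun B => f (T :|: B)))
  <= locEnt r w f.
Proof.
move=> /andP[th0 th1] r0 f0.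
(* Whatever [T] is, the mass with [w] occupied carries exactly one more factor [th] than the mass
   without; the rest is common and comes out by homogeneity. *)
pose H A := twoEnt (th * W r (w |: A)) (W r A) (f (w |: A)) (f A).
have key T : W r T * locEnt (fun u => th * pinr r T u) w (fun B => f (T :|: B))
    = \sum_(A : {set V} | (T \subset A) && (w \notin A)) th ^+ #|A :\: T| * H A.
  have [wT|wT] := boolP (w \in T).
    rewrite locEnt_vacant ?mulr0; last by rewrite /pin wT mulr0.
    rewrite big1// => A /andP[TA wA].
    by rewrite (subsetP TA) in wA.
  rewrite /locEnt mulr_sumr (bigID (fun B => [disjoint T & B]))/=.
  rewrite [X in _ + X]big1 ?addr0; last first.
    move=> B /andP[wB TB].
    by rewrite [W _ B]gasW_scaled gasW_pin0// mulr0 twoEnt0r mulr0.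
  rewrite [RHS](reindex_onto (fun B => T :|: B) (fun A => A :\: T))/=; last first.
    move=> A /andP[TA _]; apply/setP => x; rewrite !inE.
    by have [xT|//] := boolP (x \in T); rewrite (subsetP TA).
  apply: eq_big => [B|B].
    rewrite subsetUl/= inE (negPf wT)/= setDUl setDv set0U disjoint_sym.
    by congr (_ && _); apply/idP/eqP => /setDidPl.
  move=> /andP[wB TB].
  have -> : (T :|: B) :\: T = B.
    by rewrite setDUl setDv set0U; apply/setDidPl; rewrite disjoint_sym.
  have TwB : [disjoint T & w |: B].
    rewrite -setI_eq0; apply/eqP/setP => x; rewrite !inE.
    have [xT|//] := boolP (x \in T); rewrite (disjointFr TB xT) orbF/=.
    by apply/eqP => xw; rewrite xw (negPf wT) in xT.
  rewrite !gasW_scaled cardsU1 wB add1n exprS.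
  rewrite -twoEnt_homog /H -twoEnt_homog (setUCA [set w]).
  rewrite (gasW_pin b esym eirr r TwB) (gasW_pin b esym eirr r TB).
  by congr (twoEnt _ _ _ _); [|]; move: (th ^+ _) (W _ _) (W _ _) => x y z; ring.
have -> : \sum_(T : {set V}) (1 - th) ^+ #|T| *
    (W r T * locEnt (fun u => th * pinr r T u) w (fun B => f (T :|: B)))
  = \sum_(T : {set V}) \sum_(A : {set V} | (T \subset A) && (w \notin A))
      (1 - th) ^+ #|T| * (th ^+ #|A :\: T| * H A).
  by apply: eq_bigr => T _; rewrite key mulr_sumr.
rewrite (exchange_big_dep (fun A : {set V} => w \notin A))/=; last by move=> T A _ /andP[].
apply: ler_sum => A wA.
apply: le_trans (_ : H A <= _); last first.
  apply: twoEnt_mono; rewrite ?gasW_ge0//.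
  by rewrite mulr_ge0 ?gasW_ge0//= ler_piMl ?gasW_ge0.
rewrite -[leRHS]mul1r -[X in _ <= X * _](sum_subset_weights A th) mulr_suml.
rewrite le_eqVlt; apply/orP; left; apply/eqP.
by apply: eq_big => [T|T _]; [rewrite wA andbT|rewrite mulrA].
Qed.

End LocalEntropy.

(** * Tensorization in the subcritical regime *)

Section BinaryDivergence.
Variable R : realType.
Implicit Types p q a c x y K t : R.

Definition kl2 q p : R := q * ln (q / p) + (1 - q) * ln ((1 - q) / (1 - p)).

Lemma twoEnt_kl2 a c x y : 0 < a -> 0 < c -> 0 < x -> 0 < y ->
  twoEnt a c x y
  = (a * x + c * y) * kl2 (a * x / (a * x + c * y)) (a / (a + c)).
Proof.
move=> a0 c0 x0 y0; have ac : 0 < a + c by rewrite addr_gt0.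
have F0 : 0 < a * x + c * y by rewrite addr_gt0 ?mulr_gt0.
rewrite /kl2 /twoEnt.
have -> : 1 - a * x / (a * x + c * y) = c * y / (a * x + c * y).
  by field; rewrite gt_eqF.
have -> : 1 - a / (a + c) = c / (a + c) by field; rewrite gt_eqF.
have e1 : a * x / (a * x + c * y) / (a / (a + c))
    = x / ((a * x + c * y) / (a + c)).
  by field; rewrite !gt_eqF.
have e2 : c * y / (a * x + c * y) / (c / (a + c))
    = y / ((a * x + c * y) / (a + c)).
  by field; rewrite !gt_eqF.
rewrite e1 e2 [ln (x / _)]ln_div ?posrE ?divr_gt0//.
rewrite [ln (y / _)]ln_div ?posrE ?divr_gt0//.
by move: (ln x) (ln y) (ln _) => l1 l2 l3; field; rewrite gt_eqF.
Qed.

Lemma kl2_ge_xi q p : 0 < q < 1 -> 0 < p < 1 -> p * xi (q / p) <= kl2 q p.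
Proof.
move=> /andP[q0 q1] /andP[p0 p1].
have h := ln_le_subr1 (x := (1 - p) / (1 - q)).
have {}h : ln ((1 - p) / (1 - q)) <= (1 - p) / (1 - q) - 1.
  by apply: h; rewrite divr_gt0 ?subr_gt0.
have h2 : (1 - q) * ln ((1 - q) / (1 - p)) = - ((1 - q) * ln ((1 - p) / (1 - q))).
  by rewrite -mulrN -lnV ?posrE ?divr_gt0 ?subr_gt0// invf_div.
have h3 : (1 - q) * ((1 - p) / (1 - q) - 1) = q - p.
  by field; rewrite gt_eqF// subr_gt0.
have q1' : 0 <= 1 - q by rewrite subr_ge0 ltW.
have := ler_wpM2l q1' h; rewrite h3 /kl2 h2 /xi.
have -> : p * (q / p * ln (q / p) - q / p + 1) = q * ln (q / p) - q + p.
  by move: (ln _) => l; field; rewrite gt_eqF.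
lra.
Qed.

Lemma kl2_ge0 q p : 0 < q < 1 -> 0 < p < 1 -> 0 <= kl2 q p.
Proof.
move=> hq hp; apply: le_trans (kl2_ge_xi hq hp).
move: hq hp => /andP[q0 _] /andP[p0 _].
exact: mulr_ge0 (ltW p0) (xi_ge0 (divr_ge0 (ltW q0) (ltW p0))).
Qed.

Lemma dist_le_kl2 q p a : 0 < q < 1 -> 0 < p < 1 -> 0 < a ->
  `|q - p| <= a * p + (1 + a^-1) * kl2 q p.
Proof.
move=> hq hp a0; have := kl2_ge_xi hq hp.
move: hq hp => /andP[q0 _] /andP[p0 _] h.
have := dist1_le_xi (divr_ge0 (ltW q0) (ltW p0)) a0 => d.
have -> : q - p = p * (q / p - 1) by field; rewrite gt_eqF.
rewrite normrM gtr0_norm//.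
have := ler_wpM2l (ltW p0) d => /le_trans; apply.
have a1 : 0 <= 1 + a^-1 by rewrite addr_ge0// invr_ge0 ltW.
by have := ler_wpM2l a1 h; lra.
Qed.

(** Moving the reference from [pt] to [p] adds at most [d * (q - p) / (p * (1 - p))] with
    [d = pt - p]. Its part [d * (q - pt)] is paid by [kl2 q pt] through [dist_le_kl2] at the
    parameter [|d| / rho]. The remaining error is relative to [p], as small marginals require. *)
Lemma kl2_change q p pt rho K : 0 < q < 1 -> 0 < pt < 1 -> 0 < p <= 1 / 2 ->
  p <= rho -> pt <= rho -> rho <= K * p ->
  kl2 q p <= (1 + 4 * K) * kl2 q pt + 4 * ((pt - p) ^+ 2 / p).
Proof.
move=> hq hpt /andP[p0 p2] pr ptr rK.
have kl0 := kl2_ge0 hq hpt.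
have [q0 q1] := andP hq; have [pt0 pt1] := andP hpt.
have p1 : 0 < 1 - p by lra.
have pt1' : 0 < 1 - pt by lra.
have q1' : 0 < 1 - q by lra.
set d := pt - p.
have step : kl2 q p <= kl2 q pt + d * (q - p) / (p * (1 - p)).
  have h1 : ln (pt / p) <= pt / p - 1 by apply: ln_le_subr1; rewrite divr_gt0.
  have h2 : ln ((1 - pt) / (1 - p)) <= (1 - pt) / (1 - p) - 1.
    by apply: ln_le_subr1; rewrite divr_gt0.
  have E : d * (q - p) / (p * (1 - p))
     = q * (pt / p - 1) + (1 - q) * ((1 - pt) / (1 - p) - 1).
    by rewrite /d; field; rewrite !gt_eqF.
  have := ler_wpM2l (ltW q0) h1; have := ler_wpM2l (ltW q1') h2.
  by rewrite E /kl2 !ln_div ?posrE//; lra.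
have rho0 : 0 < rho by apply: lt_le_trans pr.
have K0 : 0 <= K by rewrite -(pmulr_lge0 _ p0); apply: le_trans rK; apply: ltW.
have prod_le : d * (q - p) <= 2 * d ^+ 2 + 2 * rho * kl2 q pt.
  have -> : d * (q - p) = d * (q - pt) + d ^+ 2 by rewrite /d; ring.
  have [->|dN] := eqVneq d 0.
    by rewrite !mul0r expr0n/= mulr0 !add0r !mulr_ge0// ltW.
  suff : d * (q - pt) <= d ^+ 2 + 2 * rho * kl2 q pt by lra.
  apply: le_trans (ler_norm _) _; rewrite normrM.
  have nd0 : 0 < `|d| by rewrite normr_gt0.
  have a0 : 0 < `|d| / rho by rewrite divr_gt0.
  have := dist_le_kl2 hq hpt a0 => h.
  have h3 := ler_wpM2l (ltW nd0) h.
  apply: le_trans h3 _.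
  have -> : `|d| * (`|d| / rho * pt + (1 + (`|d| / rho)^-1) * kl2 q pt)
     = `|d| ^+ 2 * (pt / rho) + (`|d| + rho) * kl2 q pt.
    by field; rewrite !gt_eqF.
  rewrite real_normK ?num_real//; apply: lerD.
    by rewrite ler_piMr ?sqr_ge0// ler_pdivrMr// mul1r.
  rewrite ler_wpM2r//; suff : `|d| <= rho by lra.
  by rewrite ler_norml /d; lra.
apply: le_trans step _.
have pp : 0 < p * (1 - p) by rewrite mulr_gt0.
have h4 : d * (q - p) / (p * (1 - p))
    <= 2 * (2 * d ^+ 2 + 2 * rho * kl2 q pt) / p.
  rewrite invfM mulrA mulrAC ler_pM2r ?invr_gt0//.
  rewrite ler_pdivrMr//; apply: le_trans prod_le _.
  have : 0 <= 2 * d ^+ 2 + 2 * rho * kl2 q pt.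
    exact: addr_ge0 (mulr_ge0 (ler0n _ 2) (sqr_ge0 _))
      (mulr_ge0 (mulr_ge0 (ler0n _ 2) (ltW rho0)) kl0).
  move: (2 * d ^+ 2 + _) => X X0.
  have : 0 <= X * (1 - 2 * p) by rewrite mulr_ge0//; lra.
  lra.
have h5 : rho / p <= K by rewrite ler_pdivrMr.
have E : 2 * (2 * d ^+ 2 + 2 * rho * kl2 q pt) / p
  = 4 * (d ^+ 2 / p) + 4 * (rho / p * kl2 q pt).
  by field; rewrite gt_eqF.
rewrite E in h4; have := ler_wpM2r kl0 h5; lra.
Qed.

(** For [X <= 1] the choice [a = sqrt X] gives [t <= 7 / 2 * sqrt X], and 49/4 is below 13; for
    [X >= 1], [t <= 1] suffices. The coefficient 3/2 is the row sum bound [interm_row]. *)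
Lemma sqr_le_of_linear t X : 0 <= t <= 1 -> 0 <= X ->
  (forall a, 0 < a -> t <= 3 / 2 * a + (1 + a^-1) * X) -> t ^+ 2 <= 13 * X.
Proof.
move=> /andP[t0 t1] X0 h.
have [X1|X1] := leP 1 X.
  apply: le_trans (_ : 1 <= _); last lra.
  by rewrite expr_le1.
have [XE|XN] := eqVneq X 0.
  have [->|tN] := eqVneq t 0; first by rewrite expr0n/= XE mulr0.
  have tp : 0 < t by rewrite lt_neqAle eq_sym tN.
  have : 0 < t / 3 by rewrite divr_gt0.
  by move/h; rewrite XE mulr0; lra.
have Xp : 0 < X by rewrite lt_neqAle eq_sym XN.
set s := Num.sqrt X; have s0 : 0 < s by rewrite sqrtr_gt0.
have sX : X = s ^+ 2 by rewrite sqr_sqrtr.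
have s1 : s <= 1.
  by rewrite -(ler_pXn2r (n := 2))// ?nnegrE ?(ltW s0)// -sX expr1n ltW.
have E : (1 + s^-1) * s ^+ 2 = s ^+ 2 + s by field; rewrite gt_eqF.
have ht := h s s0; rewrite sX E in ht; have {}ht : t <= 7 / 2 * s.
  have : s ^+ 2 <= s by rewrite expr2 ler_piMl// ltW.
  lra.
apply: le_trans (_ : (7 / 2 * s) ^+ 2 <= _).
  by rewrite ler_pXn2r// ?nnegrE ?mulr_ge0 ?(ltW s0)//; lra.
by rewrite exprMn; have := sqr_ge0 s; lra.
Qed.

End BinaryDivergence.

(** * A resolvent for nonnegative matrices with row and column sums at most 1/2 *)

Section Resolvent.
Variables (R : realType) (V : finType) (c : V -> V -> R).
Hypothesis c_ge0 : forall u w, 0 <= c u w.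
Hypothesis c_row : forall u, \sum_w c u w <= 1 / 2.
Hypothesis c_col : forall w, \sum_u c u w <= 1 / 2.

Fixpoint resolv (k : nat) (u w : V) : R :=
  if k is k'.+1 then (u == w)%:R + \sum_x c u x * resolv k' x w else 0.

Lemma resolvS k u w :
  resolv k.+1 u w = (u == w)%:R + \sum_x c u x * resolv k x w.
Proof. by []. Qed.

Lemma resolv_step k u w : 0 <= resolv k.+1 u w - resolv k u w <= 2^-1 ^+ k.
Proof.
elim: k u w => [|k IH] u w.
  rewrite /= expr0 subr0 big1 ?addr0 => [|x _]; last by rewrite mulr0.
  by rewrite ler0n/=; case: (u == w).
have -> : resolv k.+2 u w - resolv k.+1 u w =
    \sum_x c u x * (resolv k.+1 x w - resolv k x w).
  rewrite (resolvS k.+1 u w) [X in _ - X](resolvS k u w) opprD addrACA subrr.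
  rewrite add0r -sumrB.
  by apply: eq_bigr => x _; rewrite mulrBr.
apply/andP; split.
  by apply: sumr_ge0 => x _; rewrite mulr_ge0//; have /andP[] := IH x w.
apply: le_trans (_ : \sum_x c u x * 2^-1 ^+ k <= _).
  by apply: ler_sum => x _; rewrite ler_wpM2l//; have /andP[] := IH x w.
rewrite -mulr_suml exprS ler_wpM2r ?exprn_ge0 ?invr_ge0//.
by apply: le_trans (c_row u) _; rewrite div1r.
Qed.

Lemma resolv_ge0 k u w : 0 <= resolv k u w.
Proof.
by case: k => [|k] //=; elim: k u w => [|k IH] u w /=; rewrite addr_ge0 ?sumr_ge0//
  => x _; rewrite mulr_ge0.
Qed.

Lemma resolv_row k u : \sum_w resolv k u w <= 2.
Proof.
elim: k u => [|k IH] u /=; first by rewrite big1.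
rewrite big_split/= exchange_big/= (bigD1 u)//= eqxx -[(true : nat)%:R]/(1 : R) big1; last first.
  by move=> w /negPf; rewrite eq_sym => ->.
have : \sum_x \sum_w c u x * resolv k x w <= 1.
  apply: le_trans (_ : \sum_x c u x * 2 <= _).
    by apply: ler_sum => x _; rewrite -mulr_sumr ler_wpM2l.
  by rewrite -mulr_suml; have := c_row u; lra.
lra.
Qed.

Lemma resolv_col k w : \sum_u resolv k u w <= 2.
Proof.
elim: k w => [|k IH] w /=; first by rewrite big1.
rewrite big_split/= exchange_big/= (bigD1 w)//= eqxx -[(true : nat)%:R]/(1 : R) big1; last first.
  by move=> u /negPf ->.
have : \sum_x \sum_u c u x * resolv k x w <= 1.
  apply: le_trans (_ : \sum_x 1 / 2 * resolv k x w <= _).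
    by apply: ler_sum => x _; rewrite -mulr_suml ler_wpM2r ?resolv_ge0.
  by rewrite -mulr_sumr; have := IH w; lra.
lra.
Qed.

Lemma half_pow_lt (t : R) : 0 < t -> exists k, 2^-1 ^+ k < t.
Proof.
move=> t0; exists (Num.truncn t^-1).+1.
have h : t^-1 < (2 ^ (Num.truncn t^-1).+1)%:R.
  apply: lt_trans (truncnS_gt _) _.
  by rewrite ltr_nat ltn_expl.
rewrite exprVn -[ltRHS]invrK ltf_pV2 ?posrE ?invr_gt0 ?exprn_gt0//.
by rewrite -natrX.
Qed.

(* A truncated Neumann series plus a small constant, so that no limit is
   needed. *)
Lemma resolvent_exists : exists Mx : V -> V -> R,
  [/\ forall u w, 0 <= Mx u w,
      forall u w, (u == w)%:R + \sum_x c u x * Mx x w <= Mx u w,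
      forall u, \sum_w Mx u w <= 3 &
      forall w, \sum_u Mx u w <= 3].
Proof.
pose n : R := #|V|.+1%:R; have n0 : 0 < n by rewrite ltr0n.
have [k hk] : exists k, (2^-1 : R) ^+ k < n^-1 / 2.
  by apply: half_pow_lt; rewrite divr_gt0 ?invr_gt0.
have sn : \sum_(w : V) n^-1 <= 1.
  rewrite sumr_const -[leLHS]mulr_natl -ler_pdivlMr ?invr_gt0// invrK mul1r.
  by rewrite ler_nat.
exists (fun u w => resolv k u w + n^-1); split.
- by move=> u w; rewrite addr_ge0 ?resolv_ge0 ?invr_ge0 ?ltW.
- move=> u w; have /andP[_] := resolv_step k u w.
  have -> : resolv k.+1 u w = (u == w)%:R + \sum_x c u x * resolv k x w by [].
  have -> : \sum_x c u x * (resolv k x w + n^-1)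
      = \sum_x c u x * resolv k x w + (\sum_x c u x) * n^-1.
    by rewrite mulr_suml -big_split; apply: eq_bigr => x _; rewrite mulrDr.
  have : (\sum_x c u x) * n^-1 <= 1 / 2 * n^-1.
    by rewrite ler_wpM2r ?invr_ge0 ?(ltW n0)// c_row.
  set s1 := \sum_x c u x * _; set s2 := \sum_x c u x.
  move: hk; move: (2^-1 ^+ k) (n^-1) s1 s2 (resolv k u w) ((u == w)%:R : R).
  by move=> x y s1 s2 m d; lra.
- by move=> u; rewrite big_split/=; have := resolv_row k u; lra.
- by move=> u; rewrite big_split/=; have := resolv_col k u; lra.
Qed.

End Resolvent.

(** * Dobrushin's comparison of the gas with the law of density [f] *)

Section DobrushinComparison.
Variables (R : realType) (V : finType) (e : rel V) (b : R).
Implicit Types (A B T : {set V}) (G : {set V} -> R) (d y : V -> R) (u v w : V).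
Hypotheses (esym : symmetric e) (eirr : irreflexive e).
Hypotheses (b_ge0 : 0 <= b) (b_lt1 : b < 1).

Local Notation W := (gasW e b).
Local Notation M := (gasM e b).
Local Notation Z := (gasZ e b).

Variables (Delta : nat) (rho : R).
Hypothesis deg_le : forall v, (#|[set u | e v u]| <= Delta)%N.
Hypothesis rho_ge0 : 0 <= rho.
Hypothesis rho_small : Delta%:R * (1 - b) * rho <= 1 / 2.

(** Bounds the change of the conditional probability at [u] when [w] flips: that change is
    [hfun b x <= (1 - b) * x] for odds [x <= rho]. *)
Definition coupl u w : R := rho * (1 - b) * (e u w)%:R.

Lemma coupl_ge0 u w : 0 <= coupl u w.
Proof. by rewrite /coupl !mulr_ge0// subr_ge0 ltW. Qed.

Lemma coupl_row u : \sum_w coupl u w <= 1 / 2.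
Proof.
rewrite -mulr_sumr -natr_sum.
apply: le_trans (_ : rho * (1 - b) * Delta%:R <= _); last first.
  by move: rho_small; lra.
rewrite ler_wpM2l ?mulr_ge0 ?subr_ge0 ?(ltW b_lt1)// ler_nat.
apply: leq_trans (deg_le u); rewrite -sum1_card [leqRHS]big_mkcond/=.
by apply: leq_sum => w _; rewrite inE; case: (e u w).
Qed.

Lemma coupl_col w : \sum_u coupl u w <= 1 / 2.
Proof.
have -> : \sum_u coupl u w = \sum_u coupl w u.
  by apply: eq_bigr => u _; rewrite /coupl esym.
exact: coupl_row.
Qed.

Variables (r : V -> R) (f : {set V} -> R).
Hypotheses (rL : forall u, 0 <= r u <= rho) (f0 : forall A, 0 < f A).
Let r0 u : 0 <= r u. Proof. by have /andP[] := rL u. Qed.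

Definition lodds u A : R := r u * b ^+ nbrs_in e A u.
Definition cprob u A : R := lodds u A / (1 + lodds u A).
(** Measures how far the law of density [f] is from being invariant under resampling [u] from the
    gas; see [gasM_resample_dist]. *)
Definition disc u : R :=
  (\sum_(B : {set V} | u \notin B)
     W r B * (cprob u B * `|f (u |: B) - f B|)) / M r f.
Definition oscle d G := forall A u, `|G (u |: A) - G (A :\ u)| <= d u.
(** Dobrushin's notion of an estimate for two laws: the smaller the vector [y], the better. The
    trivial one is lowered step by step to a supersolution. *)
Definition estimate y := forall G d, (forall u, 0 <= d u) -> oscle d G ->
  `|M r (fun A => f A * G A) / M r f - M r G / Z r| <= \sum_u d u * y u.

Let F0 : 0 < M r f. Proof. exact: gasM_gt0. Qed.
Let Z0 : 0 < Z r. Proof. exact: gasZ_gt0. Qed.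

Lemma lodds_ge0 u A : 0 <= lodds u A.
Proof. by rewrite mulr_ge0 ?exprn_ge0. Qed.

Lemma lodds_le u A : lodds u A <= r u.
Proof. by rewrite ler_piMr// exprn_ile1// ltW. Qed.

Lemma nbrs_in_addrem u w A :
  nbrs_in e (w |: A) u = (nbrs_in e (A :\ w) u + e u w)%N.
Proof.
rewrite /nbrs_in (cardsD1 w) !inE eqxx/= addnC; congr (#|pred_of_set _| + _)%N.
by apply/setP => x; rewrite !inE; case: eqP.
Qed.

Lemma lodds_add u w A : lodds u (w |: A) = lodds u (A :\ w) * b ^+ e u w.
Proof. by rewrite /lodds nbrs_in_addrem exprD mulrA. Qed.

Lemma lodds_self u A : lodds u (u |: A) = lodds u (A :\ u).
Proof. by rewrite lodds_add eirr mulr1. Qed.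

Lemma lodds_self1 u A : u \notin A -> lodds u (u |: A) = lodds u A.
Proof.
move=> uA; rewrite lodds_self; congr (_ * _ ^+ nbrs_in _ _ _).
by apply/setDidPl; rewrite disjoint_sym disjoints1.
Qed.

Lemma cprob_bounds u A : 0 <= cprob u A < 1.
Proof.
have l0 := lodds_ge0 u A.
rewrite divr_ge0 ?addr_ge0//= ltr_pdivrMr ?mul1r ?ltrDr ?ltr_wpDr//.
Qed.

Lemma cprob_dist_le u w A :
  `|cprob u (w |: A) - cprob u (A :\ w)| <= r u * (1 - b) * (e u w)%:R.
Proof.
rewrite /cprob lodds_add; have l0 := lodds_ge0 u (A :\ w).
have := lodds_le u (A :\ w).
move: (lodds _ _) l0 => x x0 xL.
have [_|_] := boolP (e u w); last first.
  by rewrite expr0 mulr1 subrr normr0 mulr0.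
rewrite expr1 mulr1 distrC.
have bx := bx1_gt0 b_ge0 x0; have x1 := x1_gt0 x0.
have -> : x / (1 + x) - x * b / (1 + x * b) = hfun b x.
  have xb : 0 < 1 + x * b by rewrite addrC mulrC.
  have x1' : 0 < 1 + x by rewrite addrC.
  by rewrite /hfun; field; rewrite !gt_eqF.
rewrite ger0_norm ?hfun_ge0//; apply: le_trans (hfun_le b_ge0 b_lt1 x0) _.
by rewrite mulrC ler_wpM2r// subr_ge0 ltW.
Qed.

Lemma cprob_dist u w A :
  `|cprob u (w |: A) - cprob u (A :\ w)| <= coupl u w.
Proof.
apply: le_trans (cprob_dist_le u w A) _; rewrite ler_wpM2r// ler_wpM2r//.
  by rewrite subr_ge0 ltW.
by have /andP[] := rL u.
Qed.

Definition resample u G A : R :=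
  (1 - cprob u A) * G (A :\ u) + cprob u A * G (u |: A).

Lemma gasWU_lodds u B : u \notin B -> W r (u |: B) = W r B * lodds u B.
Proof. exact: gasWU. Qed.

Lemma setDU1 u B : u \notin B -> (u |: B) :\ u = B.
Proof. exact: setU1K. Qed.

Lemma setD1_id u B : u \notin B -> B :\ u = B.
Proof. by move=> uB; apply/setDidPl; rewrite disjoint_sym disjoints1. Qed.

Lemma cprob_self u B : u \notin B -> cprob u (u |: B) = cprob u B.
Proof. by move=> uB; rewrite /cprob lodds_self1. Qed.

Lemma resample_self u G B : u \notin B -> resample u G (u |: B) = resample u G B.
Proof.
by move=> uB; rewrite /resample cprob_self// setDU1// setD1_id// setUA setUid.
Qed.

Lemma gasM_resample u G : M r (resample u G) = M r G.
Proof.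
rewrite /gasM !(sum_split_vertex u); apply: eq_bigr => B uB.
rewrite resample_self// gasWU_lodds// /resample setD1_id// /cprob.
have := lodds_ge0 u B; move: (lodds u B) (W r B) (G _) (G _) => x w g1 g2 x0.
by field; rewrite gt_eqF// ltr_wpDr.
Qed.

Lemma gasM_resample_dist u G d : (forall u, 0 <= d u) -> oscle d G ->
  `|M r (fun A => f A * G A) - M r (fun A => f A * resample u G A)|
  <= d u * (disc u * M r f).
Proof.
move=> d0 dG; rewrite /disc divfK ?gt_eqF// -gasMB /gasM (sum_split_vertex u).
apply: le_trans (ler_norm_sum _ _ _) _; rewrite mulr_sumr.
apply: ler_sum => B uB.
rewrite resample_self// gasWU_lodds// /resample setD1_id//.
have -> : W r B * (f B * G B
      - f B * ((1 - cprob u B) * G B + cprob u B * G (u |: B)))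
    + W r B * lodds u B * (f (u |: B) * G (u |: B)
      - f (u |: B) * ((1 - cprob u B) * G B + cprob u B * G (u |: B)))
  = (G (u |: B) - G B) * (W r B * (cprob u B * (f (u |: B) - f B))).
  rewrite /cprob; have := lodds_ge0 u B.
  move: (lodds u B) (W r B) (G B) (G _) (f B) (f _) => x w g1 g2 h1 h2 x0.
  by field; rewrite gt_eqF// ltr_wpDr.
rewrite normrM; have := dG B u; rewrite setD1_id// => h.
have /andP[p0 _] := cprob_bounds u B.
rewrite [X in _ * X]normrM [X in _ * (_ * X)]normrM.
rewrite (ger0_norm (gasW_ge0 e b_ge0 B r0)) (ger0_norm p0).
by apply: ler_wpM2r => //; rewrite mulr_ge0 ?gasW_ge0// mulr_ge0.
Qed.

(** Resampling [u] removes the dependence on [u] and passes its oscillation on to the other sites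
    through the dependence of [cprob u] on them. *)
Lemma oscle_resample u G d : (forall u, 0 <= d u) -> oscle d G ->
  oscle (fun w => if w == u then 0 else d w + coupl u w * d u) (resample u G).
Proof.
move=> d0 dG A w; have [->|wu] := eqVneq w u.
  rewrite -{1}[u |: A](_ : u |: (A :\ u) = _); last first.
    by apply/setP => x; rewrite !inE; case: eqP.
  by rewrite resample_self ?subrr ?normr0// !inE eqxx.
rewrite /resample.
have E1 : (w |: A) :\ u = w |: (A :\ u).
  by apply/setP => x; rewrite !inE; have [->|] := eqVneq x w; rewrite ?wu.
have E2 : A :\ w :\ u = A :\ u :\ w by apply/setP => x; rewrite !inE andbCA.
have E3 : u |: (w |: A) = w |: (u |: A) by rewrite setUCA.
have E4 : u |: (A :\ w) = (u |: A) :\ w.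
  apply/setP => x; rewrite !inE; have [->|] := eqVneq x u; rewrite ?orbT//.
  by rewrite eq_sym wu.
rewrite E1 E2 E3 E4.
have h1 := dG (A :\ u) w; have h2 := dG (u |: A) w.
have h3 : `|G ((u |: A) :\ w) - G (A :\ u :\ w)| <= d u.
  have := dG (A :\ w) u; rewrite E4.
  by rewrite (_ : A :\ w :\ u = A :\ u :\ w)//; apply/setP => x; rewrite !inE andbCA.
have h4 := cprob_dist u w A.
have /andP[p0 p1] := cprob_bounds u (w |: A).
set p := cprob u (w |: A) in p0 p1 h4 *; set p' := cprob u _ in h4 *.
set a1 := G (w |: _) in h1 *; set a2 := G (w |: _) in h2 *.
set a3 := G (_ :\ w) in h1 h3 *; set a4 := G (_ :\ w) in h2 h3 *.
have -> : (1 - p) * a1 + p * a2 - ((1 - p') * a3 + p' * a4)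
  = (1 - p) * (a1 - a3) + p * (a2 - a4) + (p - p') * (a4 - a3) by ring.
apply: le_trans (ler_normD _ _) _; apply: lerD; last first.
  by rewrite normrM; apply: ler_pM.
apply: le_trans (ler_normD _ _) _; rewrite (normrM (1 - p)) (normrM p).
rewrite (ger0_norm p0) (@ger0_norm _ (1 - p)) ?subr_ge0 ?(ltW p1)//.
have k1 : 0 <= 1 - p by rewrite subr_ge0 ltW.
by have := ler_wpM2l k1 h1; have := ler_wpM2l p0 h2; lra.
Qed.

Lemma estimate_mono y y' : (forall u, y u <= y' u) -> estimate y -> estimate y'.
Proof.
move=> yy' yE G d d0 dG; apply: le_trans (yE G d d0 dG) _.
by apply: ler_sum => u _; rewrite ler_wpM2l.
Qed.

(** The old estimate is applied to the test function resampled at [u]: the mean in the gas does not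
    move, the mean under [f] moves by at most [d u * disc u], and the oscillation at [u] is gone. *)
Lemma estimate_update y u : (forall w, 0 <= y w) -> estimate y ->
  estimate (fun w => if w == u then disc u + \sum_x coupl u x * y x else y w).
Proof.
move=> y0 yE G d d0 dG.
set d' := fun w => if w == u then 0 else d w + coupl u w * d u.
have d'0 w : 0 <= d' w.
  rewrite /d'; case: eqP => // _.
  exact: addr_ge0 (d0 _) (mulr_ge0 (coupl_ge0 _ _) (d0 _)).
have h1 := yE _ _ d'0 (oscle_resample u d0 dG).
have h2 := gasM_resample_dist u d0 dG.
rewrite gasM_resample in h1.
have h3 : `|M r (fun A => f A * G A) / M r f
    - M r (fun A => f A * resample u G A) / M r f| <= d u * disc u.
  rewrite -mulrBl normrM [X in _ * X]gtr0_norm ?invr_gt0//.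
  by rewrite ler_pdivrMr// -mulrA.
have -> : \sum_w d w * (if w == u then disc u + \sum_x coupl u x * y x else y w)
    = d u * disc u + \sum_w d' w * y w.
  rewrite (bigD1 u)//= eqxx [in RHS](bigD1 u)//= {1}/d' eqxx mul0r add0r.
  have -> : \sum_(w | w != u) d' w * y w
      = \sum_(w | w != u) d w * y w + d u * \sum_x coupl u x * y x.
    rewrite [\sum_x coupl u x * y x](bigD1 u)//= {1}/coupl eirr !mulr0 mul0r add0r.
    rewrite mulr_sumr -big_split/=; apply: eq_bigr => w /negPf wu.
    by rewrite /d' wu; ring.
  have -> : \sum_(w | w != u)
      d w * (if w == u then disc u + \sum_x coupl u x * y x else y w)
      = \sum_(w | w != u) d w * y w.
    by apply: eq_bigr => w /negPf ->.
  by rewrite mulrDr -!addrA; congr (_ + _); rewrite addrC.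
apply: le_trans (_ : `|_ - M r (fun A => f A * resample u G A) / M r f|
   + `|M r (fun A => f A * resample u G A) / M r f - _| <= _).
  exact: ler_distD.
exact: lerD.
Qed.

Lemma dist_empty_le G d A : (forall u, 0 <= d u) -> oscle d G ->
  `|G A - G finset.set0| <= \sum_u d u.
Proof.
move=> d0 dG; apply: le_trans (_ : \sum_(u in A) d u <= _); last first.
  by rewrite [leRHS](bigID (mem A))/= lerDl sumr_ge0.
have [n] := ubnP #|A|; elim: n A => // n IH A.
have [-> _|[v vA] An] := set_0Vmem A.
  by rewrite subrr normr0 sumr_ge0.
rewrite (bigD1 v)//=.
apply: le_trans (_ : `|_ - G (A :\ v)| + `|G (A :\ v) - _| <= _).
  exact: ler_distD.
apply: lerD; first by have := dG A v; rewrite (setUidPr _) ?sub1set.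
have -> : \sum_(i in A | i != v) d i = \sum_(i in A :\ v) d i.
  by apply: eq_bigl => i; rewrite !inE andbC.
by apply: IH; move: An; rewrite (cardsD1 v) vA.
Qed.

(** Each of the two means is within the total oscillation of the value at the empty set, hence 2. *)
Lemma estimate_init : estimate (fun=> 2).
Proof.
move=> G d d0 dG; rewrite -mulr_suml.
have E1 : M r (fun A => f A * G A) / M r f - G finset.set0 =
    M r (fun A => f A * (G A - G finset.set0)) / M r f.
  have -> : M r (fun A => f A * (G A - G finset.set0)) =
      M r (fun A => f A * G A) - G finset.set0 * M r f.
    rewrite -gasMZ -gasMB; apply: eq_gasM => // A; ring.
  by move: (M r (fun A => _ * _)) => x; field; rewrite gt_eqF.
have E2 : M r G / Z r - G finset.set0 =
    M r (fun A => G A - G finset.set0) / Z r.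
  have -> : M r (fun A => G A - G finset.set0) = M r G - G finset.set0 * Z r.
    by rewrite gasZE -gasMZ -gasMB; apply: eq_gasM => // A; rewrite mulr1.
  by move: (M r _) => x; field; rewrite gt_eqF.
set D := \sum_u d u.
have nM F : `|M r F| <= M r (fun A => `|F A|).
  apply: le_trans (ler_norm_sum _ _ _) _; apply: ler_sum => A _.
  by rewrite normrM ger0_norm// gasW_ge0.
have B1 : `|M r (fun A => f A * G A) / M r f - G finset.set0| <= D.
  rewrite E1 normrM [X in _ * X]gtr0_norm ?invr_gt0// ler_pdivrMr//.
  apply: le_trans (nM _) _; rewrite -gasMZ; apply: ler_gasM => // A.
  by rewrite normrM gtr0_norm// mulrC ler_wpM2r ?(ltW (f0 A))// dist_empty_le.
have B2 : `|M r G / Z r - G finset.set0| <= D.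
  rewrite E2 normrM [X in _ * X]gtr0_norm ?invr_gt0// ler_pdivrMr//.
  apply: le_trans (nM _) _; rewrite gasZE -gasMZ; apply: ler_gasM => // A.
  by rewrite mulr1 dist_empty_le.
rewrite (_ : D * 2 = D + D); last by ring.
apply: le_trans (ler_distD (G finset.set0) _ _) _.
by apply: lerD => //; rewrite distrC.
Qed.

Section Supersolution.
Variable yh : V -> R.
Hypothesis yh_ge0 : forall u, 0 <= yh u.
Hypothesis yh_super : forall u, disc u + \sum_x coupl u x * yh x <= yh u.

(** One sweep of updates over all sites: the row sum 1/2 of [coupl] halves the excess over the
    supersolution. *)
Lemma estimate_half (al : R) : 0 <= al -> estimate (fun u => yh u + al) ->
  estimate (fun u => yh u + al / 2).
Proof.
move=> al0 est.
suff gen (l : seq V) :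
    estimate (fun u => yh u + if u \in l then al / 2 else al).
  by apply: estimate_mono (gen (enum V)) => u; rewrite mem_enum.
elim: l => [|v l IH]; first by apply: estimate_mono est => u.
have z0 w : 0 <= yh w + (if w \in l then al / 2 else al).
  by rewrite addr_ge0//; case: ifP => // _; rewrite divr_ge0.
apply: estimate_mono (estimate_update v z0 IH) => u; rewrite inE.
case: eqP => [->|_] //=.
apply: le_trans (_ : disc v + \sum_x coupl v x * (yh x + al) <= _).
  rewrite lerD2l; apply: ler_sum => x _; rewrite ler_wpM2l ?coupl_ge0// lerD2l.
  by case: ifP => // _; lra.
have -> : \sum_x coupl v x * (yh x + al)
    = \sum_x coupl v x * yh x + (\sum_x coupl v x) * al.
  by rewrite mulr_suml -big_split; apply: eq_bigr => x _; rewrite mulrDr.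
have := ler_wpM2r al0 (coupl_row v); have := yh_super v; lra.
Qed.

Lemma dobrushin_comparison : estimate yh.
Proof.
have est k : estimate (fun u => yh u + 2 * 2^-1 ^+ k).
  elim: k => [|k IH].
    by apply: estimate_mono estimate_init => u; rewrite expr0 mulr1 lerDr.
  have k0 : 0 <= 2 * 2^-1 ^+ k :> R by rewrite mulr_ge0 ?exprn_ge0 ?invr_ge0.
  apply: estimate_mono (estimate_half k0 IH) => u.
  by rewrite exprS lerD2l; lra.
move=> G d d0 dG; apply/ler_addgt0Pr => eps eps0.
set D := \sum_u d u; have D0 : 0 <= D by apply: sumr_ge0.
have [k hk] : exists k, (2^-1 : R) ^+ k < eps / (2 * D + 1).
  by apply: half_pow_lt; rewrite divr_gt0// ltr_wpDl// mulr_ge0.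
apply: le_trans (est k G d d0 dG) _.
have -> : \sum_u d u * (yh u + 2 * 2^-1 ^+ k)
    = \sum_u d u * yh u + D * (2 * 2^-1 ^+ k).
  by rewrite mulr_suml -big_split; apply: eq_bigr => u _; rewrite mulrDr.
rewrite lerD2l; move: hk; rewrite ltr_pdivlMr; last by rewrite ltr_wpDl// mulr_ge0.
have : 0 <= (2^-1 : R) ^+ k by rewrite exprn_ge0 ?invr_ge0.
move: (2^-1 ^+ k) => t t0; lra.
Qed.

End Supersolution.

End DobrushinComparison.

Section TwoPointAux.
Variable R : realType.
Implicit Types k rh x y a q pt : R.

Lemma twoEnt_homog1 k rh x y : twoEnt (k * rh) k x y = k * twoEnt rh 1 x y.
Proof. by rewrite -twoEnt_homog mulr1. Qed.

Lemma twoEnt_dist rh rho x y a : 0 <= rh <= rho -> 0 < x -> 0 < y -> 0 < a ->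
  rh / (1 + rh) * `|x - y|
  <= a * rho * (rh * x + y) + (1 + a^-1) * twoEnt rh 1 x y.
Proof.
move=> /andP[rh0 rhL] x0 y0 a0.
have a1 : 0 <= 1 + a^-1 by rewrite addr_ge0// invr_ge0 ltW.
have s0 : 0 < rh * x + y by rewrite ltr_wpDl// mulr_ge0// ltW.
have [E|rN] := eqVneq rh 0.
  rewrite E !mul0r twoEnt0 mulr0 addr0 add0r !mulr_ge0// ?(ltW a0) ?(ltW y0)//.
  exact: le_trans rhL.
have rp : 0 < rh by rewrite lt_neqAle eq_sym rN.
rewrite twoEnt_kl2// mul1r; set s := rh * x + y in s0 *.
have r1 : 0 < 1 + rh by rewrite addr_gt0.
have r1' : 0 < rh + 1 by rewrite addr_gt0.
have hq : 0 < rh * x / s < 1.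
  by rewrite divr_gt0 ?mulr_gt0//= ltr_pdivrMr// mul1r /s ltrDl.
have hp : 0 < rh / (rh + 1) < 1.
  by rewrite divr_gt0//= ltr_pdivrMr// mul1r ltrDl.
have := dist_le_kl2 hq hp a0 => /(ler_wpM2l (ltW s0)).
have -> : s * `|rh * x / s - rh / (rh + 1)| = rh / (1 + rh) * `|x - y|.
  have -> : rh * x / s - rh / (rh + 1) = (rh / (1 + rh) * (x - y)) / s.
    by rewrite /s; field; rewrite !gt_eqF.
  rewrite normrM normrM [`|s^-1|]gtr0_norm ?invr_gt0//.
  rewrite [`|rh / _|]gtr0_norm ?divr_gt0// mulrCA mulfV ?mulr1 ?gt_eqF//.
move/le_trans; apply; rewrite mulrDr; apply: lerD; last first.
  by rewrite mulrCA.
rewrite mulrC ler_pM2r// ler_pM2l//; apply: le_trans rhL.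
by rewrite ler_pdivrMr// ler_peMr//; lra.
Qed.

(** Replacing the reference values by [m * (q / pt)] and [m * ((1 - q) / (1 - pt))] in the two
    Bregman terms gives a bound linear in [x] and [y], which can be summed over configurations with
    [q] and [pt] fixed. *)
Lemma twoEnt_tangent rh x y q pt : 0 <= rh -> 0 < x -> 0 < y ->
  0 < q < 1 -> 0 < pt < 1 ->
  rh * x * ln (q / pt) + y * ln ((1 - q) / (1 - pt))
  + (rh * x + y) * (1 - rh / (1 + rh) * (q / pt)
      - (1 - rh / (1 + rh)) * ((1 - q) / (1 - pt))) <= twoEnt rh 1 x y.
Proof.
move=> rh0 x0 y0 /andP[q0 q1] /andP[pt0 pt1].
have r1 : 0 < rh + 1 by rewrite ltr_wpDl.
have r1' : 0 < 1 + rh by rewrite addrC.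
rewrite twoEntE//; set m := (rh * x + 1 * y) / (rh + 1).
have m0 : 0 < m by apply: mean_gt0.
set A := q / pt; set B := (1 - q) / (1 - pt).
have A0 : 0 < A by rewrite divr_gt0.
have B0 : 0 < B by rewrite divr_gt0 ?subr_gt0.
have h1 : x * ln A - m * A + m <= breg x m.
  have := breg_ge0 x0 (mulr_gt0 m0 A0); rewrite /breg lnM ?posrE//; lra.
have h2 : y * ln B - m * B + m <= breg y m.
  have := breg_ge0 y0 (mulr_gt0 m0 B0); rewrite /breg lnM ?posrE//; lra.
have := ler_wpM2l rh0 h1.
have -> : rh * x * ln A + y * ln B + (rh * x + y) * (1 - rh / (1 + rh) * A
     - (1 - rh / (1 + rh)) * B)
  = rh * (x * ln A - m * A + m) + (y * ln B - m * B + m).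
  by rewrite /m; move: (ln A) (ln B) => l1 l2; field; rewrite !gt_eqF.
lra.
Qed.

End TwoPointAux.

(** * Revealing the sites of a subcritical gas one at a time *)

Section BaseTensorization.
Variables (R : realType) (V : finType) (e : rel V) (b : R).
Implicit Types (r : V -> R) (f G : {set V} -> R) (A B T : {set V}) (u v w : V).
Hypotheses (esym : symmetric e) (eirr : irreflexive e).
Hypotheses (b_ge0 : 0 <= b) (b_lt1 : b < 1).

Local Notation W := (gasW e b).
Local Notation M := (gasM e b).
Local Notation Z := (gasZ e b).
Local Notation occ := (occupy e b).
Local Notation gasEnt := (gasEnt e b).
Local Notation lE := (locEnt e b).
Local Notation mrg := (marg e b).
Local Notation lod := (lodds e b).
Local Notation cpr := (cprob e b).
Local Notation dsc := (disc e b).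

Variables (Delta : nat) (rho K : R).
Hypothesis deg_le : forall v, (#|[set u | e v u]| <= Delta)%N.
Hypothesis rho01 : 0 < rho <= 1.
Hypothesis rho_small : Delta%:R * (1 - b) * rho <= 1 / 2.
Hypothesis K_ge0 : 0 <= K.
Hypothesis act_le_marg : forall r v,
  (forall u, 0 <= r u <= rho) -> r v <= K * mrg r v.

Local Notation cpl := (coupl e b rho).

Variable Mx : V -> V -> R.
Hypothesis Mx_ge0 : forall u w, 0 <= Mx u w.
Hypothesis Mx_super : forall u w,
  (u == w)%:R + \sum_x cpl u x * Mx x w <= Mx u w.
Hypothesis Mx_row : forall u, \sum_w Mx u w <= 3.
Hypothesis Mx_col : forall w, \sum_u Mx u w <= 3.

Let rho_gt0 : 0 < rho. Proof. by case/andP: rho01. Qed.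
Let rho_ge0 : 0 <= rho. Proof. exact: ltW. Qed.

(** [Mx] dominates the sum of all powers of the coupling matrix, so this accounts for the paths of
    length at least one by which a discrepancy at [w] reaches the conditional probability at [v]. *)
Definition interm v w : R := \sum_u cpl v u * Mx u w.

Lemma interm_ge0 v w : 0 <= interm v w.
Proof. by apply: sumr_ge0 => u _; rewrite mulr_ge0// coupl_ge0. Qed.

Lemma interm_row v : \sum_w interm v w <= 3 / 2.
Proof.
rewrite exchange_big/=; apply: le_trans (_ : \sum_u cpl v u * 3 <= _).
  by apply: ler_sum => u _; rewrite -mulr_sumr ler_wpM2l// coupl_ge0.
have := coupl_row b_lt1 deg_le rho_ge0 rho_small v.
by rewrite -mulr_suml; lra.
Qed.

Lemma interm_col w : \sum_v interm v w <= 3 / 2.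
Proof.
rewrite exchange_big/=; apply: le_trans (_ : \sum_u 1 / 2 * Mx u w <= _).
  apply: ler_sum => u _; rewrite -mulr_suml ler_wpM2r//.
  exact: (coupl_col esym b_lt1 deg_le rho_ge0 rho_small u).
by rewrite -mulr_sumr; have := Mx_col w; lra.
Qed.

Section Marginal.
Variables (r : V -> R) (f : {set V} -> R) (v : V).
Hypotheses (rL : forall u, 0 <= r u <= rho) (f0 : forall A, 0 < f A).
Hypothesis rv_gt0 : 0 < r v.

Let r0 u : 0 <= r u. Proof. by have /andP[] := rL u. Qed.
Let F : R := M r f.
Let F0 : 0 < F. Proof. exact: gasM_gt0. Qed.
Let Z0 : 0 < Z r. Proof. exact: gasZ_gt0. Qed.

(** The parameter [a] stays free until discrepancies have been summed over [w]; it is optimized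
    once, by [sqr_le_of_linear]. *)
Lemma disc_le w (a : R) : 0 < a ->
  dsc r f w <= a * rho + (1 + a^-1) * (lE r w f / F).
Proof.
move=> a0; rewrite /disc ler_pdivrMr// -/F.
have -> : (a * rho + (1 + a^-1) * (lE r w f / F)) * F
    = a * rho * F + (1 + a^-1) * lE r w f by field; rewrite !gt_eqF.
rewrite /F /gasM (sum_split_vertex w) /locEnt !mulr_sumr -big_split/=.
apply: ler_sum => B wB; rewrite gasWU_lodds//.
have lb : 0 <= lod r w B <= rho.
  rewrite (lodds_ge0 e b_ge0 rL)/=.
  apply: le_trans (lodds_le e b_ge0 b_lt1 rL w B) _.
  by have /andP[] := rL w.
have := twoEnt_dist lb (f0 (w |: B)) (f0 B) a0.
rewrite twoEnt_homog1.
move=> /(ler_wpM2l (gasW_ge0 e b_ge0 B r0)); rewrite -/(cpr r w B).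
lra.
Qed.

Let a1v (A : {set V}) : R := (v \in A)%:R.
(** Three occupation probabilities of [v]: [p] in the gas, [q] under the density [f], and [pt] after
    resampling [v] in the law of density [f]. Passing from [q] to [pt] costs only local entropy at
    [v]; from [pt] to [p] is a Dobrushin comparison. *)
Let p : R := mrg r v.
Let q : R := M r (fun A => a1v A * f A) / F.
Let pt : R := M r (fun A => f A * cpr r v A) / F.

Let cp01 A : 0 <= cpr r v A < 1. Proof. exact: cprob_bounds rL v A. Qed.

Let cp_le A : cpr r v A <= r v.
Proof.
have l0 := lodds_ge0 e b_ge0 rL v A.
apply: le_trans (lodds_le e b_ge0 b_lt1 rL v A).
by rewrite /cprob ler_pdivrMr ?ltr_wpDr// ler_peMr// lerDl.
Qed.

Lemma gasM_cprob : M r (cpr r v) = M r a1v.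
Proof.
rewrite -(gasM_resample esym eirr b_ge0 rL v a1v); apply: eq_gasM => // A.
by rewrite /resample /a1v setU11 !inE eqxx mulr0 add0r mulr1.
Qed.

Let pE : p = M r (cpr r v) / Z r.
Proof. by rewrite gasM_cprob. Qed.

Let p0 : 0 < p. Proof. exact: marg_gt0. Qed.

Let p_half : p <= 1 / 2.
Proof.
have od := le_trans (odds_le e b_ge0 b_lt1 v r0) (elimT andP (rL v)).2.
have o0 := odds_ge0 e b_ge0 v r0; have [_ r1] := andP rho01.
by rewrite /p margE// ler_pdivrMr ?ltr_wpDr//; lra.
Qed.

Let q01 : 0 < q < 1.
Proof.
have F1 : 0 < M r (fun A => a1v A * f A).
  by rewrite gasM_occupied// mulr_gt0// gasM_gt0// => u; apply: occupy_ge0.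
rewrite divr_gt0//= ltr_pdivrMr// mul1r /F -subr_gt0 -gasMB.
rewrite (eq_gasM e b (frefl r) (F' := fun A => (1 - a1v A) * f A)); last first.
  by move=> A; rewrite mulrBl mul1r.
rewrite (gasM_split b esym eirr r _ v).
have -> : M (occ r v) (fun A => (1 - a1v (v |: A)) * f (v |: A)) = 0.
  by apply: big1 => A _; rewrite /a1v setU11 subrr mul0r mulr0.
rewrite mulr0 addr0 (_ : M _ _ = M (vacate r v) f).
  by apply: gasM_gt0 => // u; apply: vacate_ge0.
apply: eq_bigr => A _; have [vA|vA] := boolP (v \in A).
  by rewrite (gasW_eq0 e b (v := v)) ?mul0r// /vacate eqxx.
by rewrite /a1v (negPf vA) subr0 mul1r.
Qed.

Let pt_le : pt <= r v.
Proof.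
rewrite ler_pdivrMr// -gasMZ; apply: ler_gasM => // A.
by rewrite mulrC ler_wpM2r// ltW.
Qed.

Let pt01 : 0 < pt < 1.
Proof.
apply/andP; split.
  rewrite divr_gt0// /gasM (bigD1 finset.set0)//= gasW0 mul1r ltr_wpDr//.
    apply: sumr_ge0 => A _; rewrite mulr_ge0 ?gasW_ge0// mulr_ge0 ?(ltW (f0 A))//.
    by have /andP[] := cp01 A.
  rewrite mulr_gt0// /cprob /lodds (_ : nbrs_in e finset.set0 v = 0%N).
    by rewrite expr0 mulr1 divr_gt0// addr_gt0.
  by apply/eqP; rewrite cards_eq0; apply/eqP/setP => x; rewrite !inE.
rewrite ltr_pdivrMr// mul1r /F -subr_gt0 -gasMB; apply: gasM_gt0 => // A.
rewrite -[X in X - _]mulr1 -mulrBr mulr_gt0// subr_gt0.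
by have /andP[] := cp01 A.
Qed.

(** Data processing: [lE r v f / F] is the relative entropy of the law of density [f] with respect
    to that law resampled at [v], and [q], [pt] are the occupation probabilities of [v] under the
    two. *)
Lemma kl2_cond_le : F * kl2 q pt <= lE r v f.
Proof.
have [q0 q1] := andP q01; have [pt0 pt1] := andP pt01.
pose lnA := ln (q / pt); pose lnB := ln ((1 - q) / (1 - pt)).
pose A := q / pt; pose B := (1 - q) / (1 - pt).
have E : F * kl2 q pt = M r (fun S => a1v S * f S * lnA
     + (1 - a1v S) * f S * lnB + f S * (1 - cpr r v S * A - (1 - cpr r v S) * B)).
  transitivity (lnA * M r (fun S => a1v S * f S)
      + lnB * (M r f - M r (fun S => a1v S * f S))
      + (M r f - A * M r (fun S => f S * cpr r v S)
         - B * (M r f - M r (fun S => f S * cpr r v S)))).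
    have -> : M r (fun S => a1v S * f S) = q * F by rewrite /q divfK ?gt_eqF.
    have -> : M r (fun S => f S * cpr r v S) = pt * F by rewrite /pt divfK ?gt_eqF.
    rewrite -/F /kl2 -/lnA -/lnB /A /B.
    have k1 : 1 - pt != 0 by rewrite gt_eqF// subr_gt0.
    by clearbody lnA lnB q pt F; field; rewrite k1 gt_eqF.
  rewrite -!gasMB -!gasMZ -!gasMD -!gasMB -!gasMD; apply: eq_gasM => // S.
  by ring.
rewrite E /gasM (sum_split_vertex v) /locEnt; apply: ler_sum => S vS.
rewrite gasWU_lodds// cprob_self// /a1v setU11 (negPf vS).
have l0 := lodds_ge0 e b_ge0 rL v S.
rewrite twoEnt_homog1.
have := twoEnt_tangent l0 (f0 (v |: S)) (f0 S) q01 pt01.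
move=> /(ler_wpM2l (gasW_ge0 e b_ge0 S r0)); rewrite -/lnA -/lnB -/A -/B.
rewrite -/(cpr r v S); apply: le_trans.
rewrite le_eqVlt; apply/orP; left; apply/eqP.
move: (W r S) (cpr r v S) (lod r v S) (f S) (f _) => w c l x y.
by rewrite -[(false : nat)%:R]/(0 : R) -[(true : nat)%:R]/(1 : R); ring.
Qed.

(** The test function is the conditional probability at [v], whose oscillations are [r v / rho]
    times [cpl v]. This keeps the error proportional to [r v]; multiplying by [rho] clears the
    denominator. *)
Lemma dobrushin_marg (a : R) : 0 < a ->
  rho * `|pt - p| <= r v * (\sum_w interm v w *
     (a * rho + (1 + a^-1) * (lE r w f / F))).
Proof.
move=> a0.
pose yh u := \sum_w Mx u w * dsc r f w.
have d0 w : 0 <= dsc r f w.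
  rewrite divr_ge0 ?(ltW F0)//; apply: sumr_ge0 => B _.
  rewrite mulr_ge0 ?gasW_ge0// mulr_ge0//.
  by have /andP[] := cprob_bounds e b_ge0 rL w B.
have yh0 u : 0 <= yh u by apply: sumr_ge0 => w _; rewrite mulr_ge0.
have yhs u : dsc r f u + \sum_x cpl u x * yh x <= yh u.
  have -> : dsc r f u + \sum_x cpl u x * yh x =
      \sum_w ((u == w)%:R + \sum_x cpl u x * Mx x w) * dsc r f w.
    transitivity (\sum_w (u == w)%:R * dsc r f w
        + \sum_w (\sum_x cpl u x * Mx x w) * dsc r f w); last first.
      by rewrite -big_split; apply: eq_bigr => w _; rewrite mulrDl.
    congr (_ + _).
      rewrite (bigD1 u)//= eqxx mul1r big1 ?addr0// => w /negPf.
      by rewrite eq_sym => ->; rewrite mul0r.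
    under [RHS]eq_bigr do rewrite mulr_suml.
    rewrite exchange_big/=; apply: eq_bigr => x _; rewrite mulr_sumr.
    by apply: eq_bigr => w _; rewrite mulrA.
  by apply: ler_sum => w _; rewrite ler_wpM2r.
have b1 : 0 <= 1 - b by rewrite subr_ge0 ltW.
have dd0 u : 0 <= r v * (1 - b) * (e v u)%:R by rewrite !mulr_ge0.
have osc : oscle (fun u => r v * (1 - b) * (e v u)%:R) (cpr r v).
  by move=> A w; apply: (cprob_dist_le e b_ge0 b_lt1 rL).
have := dobrushin_comparison esym eirr b_ge0 b_lt1 deg_le rho_ge0 rho_small
  rL f0 yh0 yhs dd0 osc.
rewrite -/F -/pt -pE => /(ler_wpM2l rho_ge0)/le_trans; apply.
have -> : rho * (\sum_u r v * (1 - b) * (e v u)%:R * yh u)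
    = r v * \sum_w interm v w * dsc r f w.
  transitivity (r v * \sum_u cpl v u * yh u).
    rewrite !mulr_sumr; apply: eq_bigr => u _; rewrite /coupl.
    by move: ((e v u)%:R : R) => z; ring.
  congr (_ * _); under eq_bigr do rewrite mulr_sumr.
  rewrite exchange_big/=; apply: eq_bigr => w _; rewrite /interm mulr_suml.
  by apply: eq_bigr => u _; rewrite mulrA.
rewrite ler_pM2l//; apply: ler_sum => w _.
by rewrite ler_wpM2l ?interm_ge0// disc_le.
Qed.

(** [kl2_change] splits the cost into the divergence of [q] from [pt], local at [v], and
    [(pt - p) ^+ 2 / p], bounded by optimizing [dobrushin_marg] over [a]. The constant 52 is 4 from
    [kl2_change] times 13 from [sqr_le_of_linear]. *)
Lemma marginal_entropy_le :
  twoEnt (r v * Z (occ r v)) (Z (vacate r v))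
    (M (occ r v) (fun A => f (v |: A)) / Z (occ r v))
    (M (vacate r v) f / Z (vacate r v))
  <= (1 + 4 * K) * lE r v f + 52 * K * \sum_w interm v w * lE r w f.
Proof.
have zo := gasZ_gt0 e b_ge0 (occupy_ge0 e b_ge0 v r0).
have zv := gasZ_gt0 e b_ge0 (vacate_ge0 v r0).
have mo := gasM_gt0 e b_ge0 (occupy_ge0 e b_ge0 v r0) (fun A => f0 (v |: A)).
have mv := gasM_gt0 e b_ge0 (vacate_ge0 v r0) f0.
rewrite twoEnt_kl2 ?(mulr_gt0 rv_gt0 zo) ?(divr_gt0 mo zo) ?(divr_gt0 mv zv)//.
have E1 : r v * Z (occ r v) * (M (occ r v) (fun A => f (v |: A)) / Z (occ r v))
    = M r (fun A => a1v A * f A).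
  rewrite gasM_occupied//; move: (M _ _) => y; field; rewrite gt_eqF//.
have E2 : Z (vacate r v) * (M (vacate r v) f / Z (vacate r v)) = M (vacate r v) f.
  by move: (M _ _) => y; field; rewrite gt_eqF.
have E3 : M r (fun A => a1v A * f A) + M (vacate r v) f = F.
  by rewrite gasM_occupied// addrC /F [RHS](gasM_split b esym eirr r f v).
have E4 : r v * Z (occ r v) / (r v * Z (occ r v) + Z (vacate r v)) = p.
  rewrite addrC -(gasZ_split b esym eirr r v) /p /marg; congr (_ / _).
  rewrite gasZE -(gasM_occupied b esym eirr r v (fun=> 1)).
  by apply: eq_gasM => // A; rewrite mulr1.
rewrite E1 E2 E3 E4 -/q.
have rK : r v <= K * p by apply: act_le_marg.
have kc := kl2_change q01 pt01 (_ : 0 < p <= 1 / 2) (marg_le esym eirr b_ge0 b_lt1 v r0) pt_le rK.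
have {}kc := kc (introT andP (conj p0 p_half)).
have {}kc := ler_wpM2l (ltW F0) kc; apply: le_trans kc _.
have -> : F * ((1 + 4 * K) * kl2 q pt + 4 * ((pt - p) ^+ 2 / p))
  = (1 + 4 * K) * (F * kl2 q pt) + 4 * F * ((pt - p) ^+ 2 / p) by ring.
apply: lerD.
  by rewrite ler_wpM2l ?kl2_cond_le// addr_ge0// mulr_ge0.
set S := \sum_w _; have S0 : 0 <= S.
  by apply: sumr_ge0 => w _; rewrite mulr_ge0 ?interm_ge0 ?locEnt_ge0.
pose t := `|pt - p| / r v; pose X := S / (F * rho).
have X0 : 0 <= X by rewrite divr_ge0// mulr_ge0// ltW.
have t01 : 0 <= t <= 1.
  rewrite divr_ge0 ?(ltW rv_gt0)//= ler_pdivrMr// mul1r ler_norml.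
  have [pt0 _] := andP pt01.
  have := marg_le esym eirr b_ge0 b_lt1 v r0; rewrite -/p => pr.
  by apply/andP; split; move: pt_le p0; lra.
have key : t ^+ 2 <= 13 * X.
  apply: sqr_le_of_linear => // a a0.
  have := dobrushin_marg a0.
  have -> : \sum_w interm v w * (a * rho + (1 + a^-1) * (lE r w f / F))
      = a * rho * (\sum_w interm v w) + (1 + a^-1) * (S / F).
    rewrite /S mulr_suml !mulr_sumr -big_split/=; apply: eq_bigr => w _.
    by ring.
  move=> hh; have {}hh : t <= (a * rho * (\sum_w interm v w) + (1 + a^-1) * (S / F)) / rho.
    rewrite /t ler_pdivrMr// mulrAC ler_pdivlMr// mulrC.
    by apply: le_trans hh _; rewrite mulrC.
  apply: le_trans hh _.
  have -> : (a * rho * (\sum_w interm v w) + (1 + a^-1) * (S / F)) / rho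
     = a * (\sum_w interm v w) + (1 + a^-1) * X.
    rewrite /X; clearbody S F; move: (\sum_w interm v w) => s1; field.
    by rewrite !gt_eqF.
  by rewrite lerD2r mulrC ler_wpM2r ?(ltW a0)// interm_row.
have e2 : (pt - p) ^+ 2 / p <= K * rho * t ^+ 2.
  have -> : (pt - p) ^+ 2 = t ^+ 2 * r v ^+ 2.
    by rewrite /t expr_div_n divfK ?expf_neq0 ?gt_eqF// real_normK// num_real.
  rewrite ler_pdivrMr//.
  have h1 : r v ^+ 2 <= K * rho * p.
    rewrite expr2 mulrAC; apply: ler_pM => //.
    by have /andP[] := rL v.
  by have := ler_wpM2l (sqr_ge0 t) h1; lra.
have F4 : 0 <= 4 * F by rewrite mulr_ge0// ltW.
apply: le_trans (ler_wpM2l F4 e2) _.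
have Kr : 0 <= 4 * F * (K * rho) by rewrite mulr_ge0 ?mulr_ge0// ltW.
have := ler_wpM2l Kr key.
have -> : 4 * F * (K * rho) * (13 * X) = 52 * K * S.
  by rewrite /X; clearbody S F; field; rewrite !gt_eqF.
by rewrite -[X in X <= _ -> _]mulrA.
Qed.

End Marginal.
(** Induction on the sites that may be occupied: revealing [v] costs [marginal_entropy_le], both
    conditional gases live on the shorter list, and their local entropies at other sites recombine
    exactly by [locEnt_split]. *)
Lemma gasEnt_support_le (s : seq V) r f : uniq s ->
  (forall u, 0 <= r u <= rho) -> (forall A, 0 < f A) ->
  (forall u, u \notin s -> r u = 0) ->
  gasEnt r f <= \sum_w ((1 + 4 * K) * (w \in s)%:R
    + 52 * K * \sum_(v <- s) interm v w) * lE r w f.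
Proof.
elim: s r f => [|v s IH] r f /=.
  move=> _ rL f0 rs.
  have MF F : M r F = F finset.set0.
    rewrite /gasM (bigD1 finset.set0)//= gasW0 mul1r big1 ?addr0// => A A0.
    have /set0Pn[u uA] := A0.
    by rewrite (gasW_eq0 e b (rs u _)) ?mul0r.
  rewrite big1 => [|w _]; last by rewrite locEnt_vacant ?rs// mulr0.
  by rewrite /gasEnt gasZE !MF divr1 subrr.
move=> /andP[vs us] rL f0 rs.
have r0 u : 0 <= r u by have /andP[] := rL u.
have vL u : 0 <= vacate r v u <= rho.
  rewrite vacate_ge0//=; apply: le_trans (vacate_le _ _ r0) _.
  by have /andP[] := rL u.
have oL u : 0 <= occ r v u <= rho.
  rewrite occupy_ge0//=; apply: le_trans (occupy_le e b_ge0 b_lt1 _ _ r0) _.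
  by have /andP[] := rL u.
have vz u : u \notin s -> vacate r v u = 0.
  by rewrite /vacate => us'; case: eqP => // /eqP uv; rewrite rs// inE negb_or uv.
have oz u : u \notin s -> occ r v u = 0.
  rewrite /occupy => us'; case: eqP => // /eqP uv.
  by rewrite rs ?mul0r// inE negb_or uv.
set cf := fun w => (1 + 4 * K) * (w \in s)%:R + 52 * K * \sum_(v <- s) interm v w.
have cf0 w : 0 <= cf w.
  rewrite /cf addr_ge0 ?mulr_ge0 ?addr_ge0 ?mulr_ge0//.
  by apply: sumr_ge0 => u _; apply: interm_ge0.
have h1 := IH _ f us vL f0 vz.
have h2 := IH _ (fun A => f (v |: A)) us oL (fun A => f0 _) oz.
have h3 : \sum_w cf w * lE (vacate r v) w f
    + r v * \sum_w cf w * lE (occ r v) w (fun A => f (v |: A))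
    <= \sum_w cf w * lE r w f.
  rewrite mulr_sumr -big_split/=; apply: ler_sum => w _.
  rewrite mulrCA -mulrDr ler_wpM2l//.
  have [->|wv] := eqVneq w v; last by rewrite (locEnt_split b esym eirr r f wv).
  rewrite (locEnt_vacant e b (r := vacate r v)) ?/vacate ?eqxx//.
  rewrite (locEnt_vacant e b (r := occ r v)) ?/occupy ?eqxx//.
  by rewrite mulr0 addr0 locEnt_ge0.
have h4 : twoEnt (r v * Z (occ r v)) (Z (vacate r v))
    (M (occ r v) (fun A => f (v |: A)) / Z (occ r v))
    (M (vacate r v) f / Z (vacate r v))
  <= (1 + 4 * K) * lE r v f + 52 * K * \sum_w interm v w * lE r w f.
  have [rv|rv] := eqVneq (r v) 0; last first.
    by apply: marginal_entropy_le => //; rewrite lt_neqAle eq_sym rv r0.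
  rewrite rv mul0r twoEnt0 addr_ge0 ?mulr_ge0 ?addr_ge0 ?mulr_ge0 ?locEnt_ge0//.
  by apply: sumr_ge0 => w _; rewrite mulr_ge0 ?interm_ge0 ?locEnt_ge0.
rewrite (gasEnt_split esym eirr b_ge0 v r0 f0).
have -> : \sum_w ((1 + 4 * K) * (w \in v :: s)%:R
    + 52 * K * \sum_(v0 <- v :: s) interm v0 w) * lE r w f
  = \sum_w cf w * lE r w f + ((1 + 4 * K) * lE r v f
    + 52 * K * \sum_w interm v w * lE r w f).
  have -> : (1 + 4 * K) * lE r v f = \sum_w (1 + 4 * K) * (w == v)%:R * lE r w f.
    rewrite (bigD1 v)//= eqxx mulr1 big1 ?addr0// => w /negPf ->.
    by rewrite mulr0 mul0r.
  rewrite mulr_sumr -!big_split/=; apply: eq_bigr => w _.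
  rewrite big_cons /cf.
  have -> : (w \in v :: s)%:R = (w == v)%:R + (w \in s)%:R :> R.
    rewrite inE; have [->|_] /= := eqVneq w v; last by rewrite add0r.
    by rewrite (negPf vs) addr0.
  by move: ((w == v)%:R : R) ((w \in s)%:R : R) => x y; ring.
apply: lerD => //; apply: le_trans h3; apply: lerD => //.
by rewrite ler_wpM2l.
Qed.

(** 82 is 4 + 52 * 3 / 2, where 3 / 2 is the column sum bound of [interm]. *)
Lemma base_tensorization r f :
  (forall u, 0 <= r u <= rho) -> (forall A, 0 < f A) ->
  gasEnt r f <= (1 + 82 * K) * \sum_w lE r w f.
Proof.
move=> rL f0; have r0 u : 0 <= r u by have /andP[] := rL u.
apply: le_trans (gasEnt_support_le (enum_uniq V) rL f0 _) _.
  by move=> u; rewrite mem_enum.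
rewrite mulr_sumr; apply: ler_sum => w _; rewrite ler_wpM2r ?locEnt_ge0//.
rewrite mem_enum mulr1 big_enum/=.
have K52 : 0 <= 52 * K by rewrite mulr_ge0.
by have := ler_wpM2l K52 (interm_col w); lra.
Qed.

End BaseTensorization.

(** * Tensorization for the lattice gas *)

Section GasTensorization.
Variable R : realType.

(* [cL] bounds [Lam], [cD] bounds [D.+1 * (1 - b) * Lam], and [cTh] is
   the thinning level that makes the gas subcritical. *)
Definition cL : R := 4 * expR 5.
Definition cD : R := 15 * expR 5.
(** The constant of [marg_ge] once [Lup] is at most [cL] and the exponent at most [cD]. *)
Definition cK : R := (1 + cL) * expR cD.
(** [cEta / delta] bounds total influence: 8 comes from [delta / 8 <= 1 - q] with
    [q = expR (- (delta / 4))], and [expR 1] covers the tilt of the activities. *)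
Definition cEta : R := 1 + 8 * (cD * expR 1).
Definition cG : R := (cK * expR 1) ^+ 2.
(** [ca * delta] is the tilt size [a] of [entropic_independence]: the first summand ensures
    [a * G <= delta / 2], the second [E * a <= 1]. *)
Definition ca : R := (2 * cG + cEta * expR 1 * cK)^-1.
Definition cKappa : R := 2 / ca + 2.
Definition cTh : R := (2 * cD + cL)^-1.
Definition cGas : R := cKappa * ln cTh^-1 + 82 * cK.

Lemma e1_ge1 : 1 <= expR 1 :> R.
Proof. by rewrite -[leLHS]expR0 ler_expR. Qed.

Lemma cL_ge1 : 1 <= cL.
Proof.
have : 1 <= expR 5 :> R by rewrite -[leLHS]expR0 ler_expR.
by rewrite /cL; lra.
Qed.

Lemma cD_ge1 : 1 <= cD.
Proof.
have : 1 <= expR 5 :> R by rewrite -[leLHS]expR0 ler_expR.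
by rewrite /cD; lra.
Qed.

Lemma cK_ge1 : 1 <= cK.
Proof.
rewrite /cK mulr_ege1//; first by have := cL_ge1; lra.
by rewrite -[leLHS]expR0 ler_expR; have := cD_ge1; lra.
Qed.

Lemma cEta_ge1 : 1 <= cEta.
Proof.
have := expR_ge0 (1 : R); have := cD_ge1 => d h.
by rewrite /cEta lerDl mulr_ge0// mulr_ge0// (le_trans _ d).
Qed.

Lemma cG_ge1 : 1 <= cG.
Proof. by rewrite exprn_ege1// mulr_ege1 ?cK_ge1 ?e1_ge1. Qed.

Lemma caV_ge1 : 1 <= 2 * cG + cEta * expR 1 * cK.
Proof.
have h : 1 <= cEta * expR 1 * cK.
  exact: mulr_ege1 (mulr_ege1 cEta_ge1 e1_ge1) cK_ge1.
by have := cG_ge1; lra.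
Qed.

Lemma ca_gt0 : 0 < ca.
Proof. by rewrite invr_gt0 (lt_le_trans _ caV_ge1). Qed.

Lemma cTh01 : 0 < cTh <= 1.
Proof.
have := cD_ge1; have := cL_ge1 => l d.
have h : 1 <= 2 * cD + cL by lra.
by rewrite invr_gt0 (lt_le_trans _ h)//= invf_le1// (lt_le_trans _ h).
Qed.

Lemma cGas_gt0 : 0 < cGas.
Proof.
have k := cK_ge1; have /andP[t0 t1] := cTh01; have a0 := ca_gt0.
apply: ltr_wpDl; last by lra.
rewrite mulr_ge0 ?ln_ge0 ?invf_ge1//.
by rewrite addr_ge0// divr_ge0// ltW.
Qed.

Variables (V : finType) (e : rel V) (b : R).
Hypotheses (esym : symmetric e) (eirr : irreflexive e).
Hypotheses (b_ge0 : 0 <= b) (b_lt1 : b < 1).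
Variables (D : nat) (Lam xh delta : R).
Hypotheses (D_ge2 : (2 <= D)%N) (delta01 : 0 < delta < 1).
Hypotheses (xh_gt0 : 0 < xh) (Lam_gt0 : 0 < Lam).
Hypothesis xh_fix : xh = Lam * ((b * xh + 1) / (xh + 1)) ^+ D.
Hypothesis xh_gap : D%:R * hfun b xh <= 1 - delta.
Hypothesis xh_small : b * xh ^+ 2 <= 1.
Hypothesis deg_le : forall v, (#|[set u | e v u]| <= D.+1)%N.

Let d0 : 0 < delta. Proof. by case/andP: delta01. Qed.
Let d1 : delta < 1. Proof. by case/andP: delta01. Qed.
Let b1 : 0 <= 1 - b. Proof. by rewrite subr_ge0 ltW. Qed.
Let Lam0 : 0 <= Lam. Proof. exact: ltW. Qed.

Let Lam_cL : Lam <= cL.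
Proof. exact: (Lam_le b_ge0 b_lt1 D_ge2 delta01 xh_gt0 xh_fix xh_gap xh_small). Qed.

Let Delta_Lam : D.+1%:R * (1 - b) * Lam <= cD.
Proof.
have h := D_Lam_le b_ge0 b_lt1 D_ge2 delta01 xh_gt0 xh_fix xh_gap xh_small.
(* The root sees [D.+1] neighbours; [D >= 2] turns the 10 of [D_Lam_le] into the 15 of [cD]. *)
have D2 : D.+1%:R <= 3 / 2 * D%:R :> R.
  rewrite -natr1; have : 2 <= D%:R :> R by rewrite ler_nat.
  lra.
have bL : 0 <= (1 - b) * Lam by rewrite mulr_ge0.
by have := ler_wpM2r bL D2; rewrite /cD; lra.
Qed.

(** The largest activity a tilt can produce, with [a0 = delta / 2]; it uses up exactly the slack
    allowed in [contraction]. *)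
Let Lup := Lam * expR (delta / 2).

Let act_le_marg r v : (forall u, 0 <= r u <= Lam) ->
  r v <= cK * marg e b r v.
Proof.
move=> rL; have r0 u : 0 <= r u by have /andP[] := rL u.
apply: le_trans (marg_ge esym eirr b_ge0 b_lt1 v deg_le rL) _.
rewrite ler_wpM2r ?(marg_ge0 esym eirr b_ge0)//; apply: ler_pM; rewrite ?expR_ge0//.
- exact: addr_ge0.
- by rewrite lerD2l.
- by rewrite ler_expR.
Qed.

Let totinf_eta r v : (forall u, 0 <= r u <= Lup) ->
  totinf e b r v <= cEta / delta.
Proof.
move=> rL; pose q := expR (- (delta / 4)).
have q1 : q < 1 by rewrite expR_lt1; move: d0; lra.
have Lup0 : 0 <= Lup by rewrite mulr_ge0 ?expR_ge0.
have q2 : q ^+ 2 = expR (- (delta / 2)).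
  by rewrite -expRM_natl; congr expR; field.
have contr (xs : seq R) (x : R) : (size xs <= D.+1.-1)%N ->
  {in xs, forall y, 0 <= y} -> 0 <= x ->
  x <= Lup * \prod_(y <- xs) ((b * y + 1) / (y + 1)) ->
  hfun b x * (\sum_(y <- xs) Num.sqrt (hfun b y)) ^+ 2 <= q ^+ 2.
  rewrite q2; exact: (contraction b_ge0 b_lt1 D_ge2 delta01 xh_gt0 xh_fix xh_gap xh_small).
apply: le_trans (totinf_le esym eirr b_ge0 b_lt1 deg_le (expR_ge0 _) q1 Lup0 contr v rL) _.
have q8 : delta / 8 <= 1 - q.
  have : q <= (1 + delta / 4)^-1.
    rewrite /q expRN lef_pV2 ?posrE ?expR_gt0 ?expR_ge1Dx//.
    by move: d0; lra.
  have h : (1 + delta / 4)^-1 <= 1 - delta / 8.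
    rewrite -[leLHS]mul1r ler_pdivrMr; last by move: d0; lra.
    have : 0 <= delta * (1 - delta) by rewrite mulr_ge0 ?subr_ge0 ?(ltW d0) ?(ltW d1).
    by move: d0 d1; lra.
  lra.
have num : D.+1%:R * (1 - b) * Lup <= cD * expR 1.
  rewrite /Lup mulrA; apply: ler_pM => //; rewrite ?expR_ge0 ?mulr_ge0//.
  by rewrite ler_expR; move: d1; lra.
have cde : 0 <= cD * expR 1 by rewrite mulr_ge0 ?expR_ge0// (le_trans _ cD_ge1).
have frac : D.+1%:R * (1 - b) * Lup / (1 - q) <= cD * expR 1 * (8 / delta).
  apply: ler_pM => //; first exact: mulr_ge0 (mulr_ge0 (ler0n _ _) b1) Lup0.
    by rewrite invr_ge0 subr_ge0 ltW.
  have -> : 8 / delta = (delta / 8)^-1 by field; rewrite gt_eqF.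
  by rewrite lef_pV2 ?posrE ?subr_gt0 ?divr_gt0.
rewrite /cEta mulrDl mul1r.
have dV : 1 <= delta^-1 by rewrite invf_ge1// ltW.
have -> : 8 * (cD * expR 1) / delta = cD * expR 1 * (8 / delta) by ring.
exact: lerD.
Qed.

Let kappa := cKappa / delta.

Let kappa_ei (r : V -> R) (f : {set V} -> R) :
  (forall u, 0 <= r u <= Lam) -> (forall A, 0 < f A) ->
  \sum_v marg e b r v * gasM e b r f
    * xi (gasM e b r (fun A => (v \in A)%:R * f A) / gasM e b r f / marg e b r v)
  <= kappa * gasEnt e b r f.
Proof.
move=> rL f0; have r0 u : 0 <= r u by have /andP[] := rL u.
have a0 := ca_gt0; have cV := caV_ge1.
have eta1 : 1 <= cEta / delta.
  by rewrite ler_pdivlMr// mul1r (le_trans (ltW d1))// cEta_ge1.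
have cG0 := cG_ge1; have cE1 := cEta_ge1; have cK1 := cK_ge1; have e1 := e1_ge1.
have q0 : 0 < 2 * cG + cEta * expR 1 * cK by apply: lt_le_trans cV.
have h0 : 0 < ca * delta by rewrite mulr_gt0.
have h1 : ca * delta * cG <= delta / 2.
  suff : ca * cG <= 1 / 2 by move/(ler_wpM2l (ltW d0)); lra.
  rewrite /ca mulrC ler_pdivrMr//.
  have : 0 <= cEta * expR 1 * cK.
    exact: mulr_ge0 (mulr_ge0 (le_trans ler01 cE1) (expR_ge0 _)) (le_trans ler01 cK1).
  lra.
have h2 : cEta / delta * expR (delta / 2) * cK * (ca * delta) <= 1.
  have -> : cEta / delta * expR (delta / 2) * cK * (ca * delta)
    = cEta * expR (delta / 2) * cK * ca by field; rewrite gt_eqF.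
  rewrite /ca ler_pdivrMr// mul1r.
  have : cEta * expR (delta / 2) * cK <= cEta * expR 1 * cK.
    rewrite ler_wpM2r ?(le_trans ler01)// ler_wpM2l ?(le_trans ler01)//.
    by rewrite ler_expR; move: d1; lra.
  lra.
have d2 : 0 <= delta / 2 by rewrite divr_ge0// ltW.
have := entropic_independence esym eirr b_ge0 b_lt1 d2 cK1 totinf_eta
  act_le_marg rL f0 h0 h1 h2.
move/le_trans; apply; rewrite ler_wpM2r//.
  (* The variational inequality with test function 0 is the nonnegativity of entropy. *)
  rewrite /gasEnt; have := donsker_varadhan e b_ge0 (fun=> 0) r0 f0.
  have -> : gasM e b r (fun A => f A * 0) = 0.
    by apply: big1 => A _; rewrite !mulr0.
  have -> : gasM e b r (fun=> expR 0) = gasZ e b r.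
    by rewrite gasZE; apply: eq_gasM => // A; rewrite expR0.
  rewrite divff ?ln1 ?mulr0 ?addr0//; first by rewrite gt_eqF ?gasZ_gt0.
rewrite /kappa /cKappa.
have -> : (2 / ca + 2) / delta = 2 / (ca * delta) + 2 / delta.
  by field; rewrite !gt_eqF.
rewrite lerD2l ler_pdivlMr//; move: d1; lra.
Qed.

Theorem gas_tensorization (r : V -> R) (f : {set V} -> R) :
  (forall u, 0 <= r u <= Lam) -> (forall A, 0 < f A) ->
  gasEnt e b r f <= expR (cGas / delta) * \sum_w locEnt e b r w f.
Proof.
move=> rL f0; have r0 u : 0 <= r u by have /andP[] := rL u.
have th01 := cTh01; have /andP[th0 th1] := th01.
have cD1 := cD_ge1; have cL1 := cL_ge1; have cK1 := cK_ge1.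
apply: le_trans (entropy_conservation esym eirr b_ge0 b_lt1 kappa_ei rL f0 th01) _.
(* Pinning only lowers activities, so one bound serves every pinned gas at the level [cTh]. *)
pose rho := cTh * Lam.
have rho01 : 0 < rho <= 1.
  rewrite mulr_gt0//= /rho /cTh mulrC ler_pdivrMr; last by move: cD1 cL1; lra.
  by move: Lam_cL cD1; lra.
have rho_small : D.+1%:R * (1 - b) * rho <= 1 / 2.
  rewrite /rho mulrCA mulrC /cTh ler_pdivrMr; last by move: cD1 cL1; lra.
  by move: Delta_Lam cL1; lra.
have rhoL : rho <= Lam by rewrite ler_piMl.
have K0 : 0 <= cK by apply: le_trans cK1.
have alm r' v : (forall u, 0 <= r' u <= rho) -> r' v <= cK * marg e b r' v.
  move=> r'L; apply: act_le_marg => u; have /andP[-> h] := r'L u.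
  exact: le_trans rhoL.
have rho0 : 0 <= rho by have /andP[/ltW] := rho01.
have [Mx [M0 Ms Mr Mc]] := resolvent_exists (coupl_ge0 e b_lt1 rho0)
  (coupl_row b_lt1 deg_le rho0 rho_small) (coupl_col esym b_lt1 deg_le rho0 rho_small).
have loc0 w : 0 <= locEnt e b r w f by apply: locEnt_ge0.
have base (T : {set V}) :
    gasEnt e b (fun u => cTh * pin e b r T u) (fun B => f (T :|: B))
    <= (1 + 82 * cK) * \sum_w
       locEnt e b (fun u => cTh * pin e b r T u) w (fun B => f (T :|: B)).
  apply: (base_tensorization esym eirr b_ge0 b_lt1 deg_le rho01 rho_small K0 alm
    M0 Ms Mr Mc) => // u.
  rewrite mulr_ge0 ?(pin_ge0 e b_ge0 rL) ?(ltW th0)//= /rho ler_pM2l//.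
  by apply: le_trans (pin_le e b_ge0 b_lt1 rL T u) _; have /andP[] := rL u.
have sum_base : \sum_(T : {set V}) (1 - cTh) ^+ #|T| * (gasW e b r T *
    gasEnt e b (fun u => cTh * pin e b r T u) (fun B => f (T :|: B)))
  <= (1 + 82 * cK) * \sum_w locEnt e b r w f.
  apply: le_trans (_ : \sum_(T : {set V}) (1 - cTh) ^+ #|T| * (gasW e b r T *
    ((1 + 82 * cK) * \sum_w locEnt e b (fun u => cTh * pin e b r T u) w
      (fun B => f (T :|: B)))) <= _).
    apply: ler_sum => T _; rewrite ler_wpM2l ?exprn_ge0 ?subr_ge0//.
    by rewrite ler_wpM2l ?gasW_ge0.
  have -> : \sum_(T : {set V}) (1 - cTh) ^+ #|T| * (gasW e b r T *
    ((1 + 82 * cK) * \sum_w locEnt e b (fun u => cTh * pin e b r T u) w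
      (fun B => f (T :|: B))))
    = (1 + 82 * cK) * \sum_w \sum_(T : {set V}) (1 - cTh) ^+ #|T| *
       (gasW e b r T * locEnt e b (fun u => cTh * pin e b r T u) w
         (fun B => f (T :|: B))).
    rewrite exchange_big/= mulr_sumr; apply: eq_bigr => T _.
    rewrite -mulr_sumr -mulr_sumr.
    have ring3 (x y z t : R) : x * (y * (z * t)) = z * (x * (y * t)) by ring.
    exact: ring3.
  apply: ler_wpM2l; first by move: cK1; lra.
  apply: ler_sum => w _.
  by apply: sum_locEnt_pin => //; rewrite (ltW th0).
apply: le_trans (ler_wpM2l (expR_ge0 _) sum_base) _.
rewrite mulrA ler_wpM2r ?sumr_ge0//.
have -> : expR (cGas / delta)
    = expR (- (kappa * ln cTh)) * expR (82 * cK / delta).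
  rewrite -expRD /cGas /kappa lnV ?posrE//; congr expR.
  by move: (ln _) => l; ring.
rewrite ler_wpM2l ?expR_ge0//; apply: le_trans (expR_ge1Dx _) _.
have K82 : 0 <= 82 * cK by apply: mulr_ge0.
by rewrite ler_expR ler_pdivlMr// ler_piMr// ltW.
Qed.

End GasTensorization.

(** * Glauber dynamics *)

Section GlauberEntropy.
Variables (R : realType) (V : finType) (e : rel V) (beta gamma lambda : R).
Implicit Types (s t x : config V) (f g : config V -> R) (v : V).

Local Notation gib := (gibbs e beta gamma lambda).
Local Notation glb := (glauber e beta gamma lambda).
Local Notation ent := (entropy e beta gamma lambda).
Local Notation expt := (expect e beta gamma lambda).
Local Notation dir := (dirichlet e beta gamma lambda).

Hypothesis gib_ge0 : forall s, 0 <= gib s.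
Hypothesis gib_sum : \sum_s gib s = 1.
Hypothesis V_gt0 : (0 < #|V|)%N.

Let n : R := #|V|%:R.
Let n0 : 0 < n. Proof. by rewrite ltr0n. Qed.

Definition agree v s t : bool := [forall u, (u != v) ==> (t u == s u)].

Lemma agreeP v s t : reflect (t = setspin s v (t v)) (agree v s t).
Proof.
apply: (iffP forallP) => [h|h u].
  by apply/ffunP => u; rewrite ffunE; case: eqP => [->//|/eqP uv];
    have := h u; rewrite uv => /eqP.
by apply/implyP => uv; rewrite h ffunE (negPf uv).
Qed.

Lemma setspin_v s v c : setspin s v c v = c.
Proof. by rewrite ffunE eqxx. Qed.

Lemma setspin_setspin s v c c' : setspin (setspin s v c) v c' = setspin s v c'.
Proof. by apply/ffunP => u; rewrite !ffunE; case: eqP. Qed.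

Lemma setspin_id s v : setspin s v (s v) = s.
Proof. by apply/ffunP => u; rewrite !ffunE; case: eqP => [->|]. Qed.

Lemma agree_sym v s t : agree v s t = agree v t s.
Proof.
by apply/forallP/forallP => h u; apply/implyP => uv; have := h u;
  rewrite uv /= eq_sym.
Qed.

Lemma agree_setspin v s t c : agree v s t -> setspin t v c = setspin s v c.
Proof. by move=> /agreeP ->; rewrite setspin_setspin. Qed.

Lemma sum_agree v s (a : config V -> R) :
  \sum_t (if agree v s t then a t else 0)
  = a (setspin s v true) + a (setspin s v false).
Proof.
have ne : setspin s v false != setspin s v true.
  by apply/eqP => E; have := setspin_v s v true; rewrite -E setspin_v.
have ag c : agree v s (setspin s v c) by apply/agreeP; rewrite setspin_v.
rewrite (bigD1 (setspin s v true))//= ag (bigD1 (setspin s v false)) ?ne//= ag.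
rewrite big1 ?addr0// => t /andP[t1 t2]; case: ifP => // /agreeP E.
by move: t1 t2; rewrite E; case: (t v); rewrite eqxx.
Qed.

(** If both masses vanish, division by zero makes this 0; such an [s] has Gibbs mass 0. *)
Definition condexp v g s : R :=
  (gib (setspin s v true) * g (setspin s v true)
   + gib (setspin s v false) * g (setspin s v false))
  / (gib (setspin s v true) + gib (setspin s v false)).

Lemma glauber_sum g s : \sum_t glb s t * g t = n^-1 * \sum_v condexp v g s.
Proof.
under eq_bigr do rewrite /glauber -mulrA.
rewrite -mulr_sumr; congr (_ * _); rewrite -/n.
transitivity (\sum_t \sum_v (if agree v s t then gib t /
    (gib (setspin s v true) + gib (setspin s v false)) * g t else 0)).
  apply: eq_bigr => t _; rewrite mulr_suml; apply: eq_bigr => v _.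
  by rewrite -/(agree v s t); case: ifP => // _; rewrite mul0r.
rewrite exchange_big/=; apply: eq_bigr => v _; rewrite sum_agree /condexp.
by rewrite mulrDl; congr (_ + _); rewrite mulrAC.
Qed.

Lemma sum_split_spin v (G : config V -> R) :
  \sum_s G s = \sum_(s : config V | ~~ s v) (G (setspin s v true) + G s).
Proof.
rewrite (bigID (fun s : config V => ~~ s v))/= addrC big_split/=; congr (_ + _).
rewrite (reindex_onto (fun s : config V => setspin s v true) (fun s : config V => setspin s v false))/=.
  apply: eq_bigl => s; rewrite setspin_v negbK/= setspin_setspin.
  apply/eqP/idP => [<-|sv]; first by rewrite setspin_v.
  by rewrite -[RHS](setspin_id s v) (negPf sv).
move=> s; rewrite negbK => sv; rewrite setspin_setspin.
by rewrite -[RHS](setspin_id s v) sv.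
Qed.

Definition loc v f : R := \sum_(s : config V | ~~ s v)
  twoEnt (gib (setspin s v true)) (gib s) (f (setspin s v true)) (f s).

Definition pos_on_support f := forall s, 0 < gib s -> 0 < f s.

Lemma setspin_false s v : ~~ s v -> setspin s v false = s.
Proof. by move=> /negPf sv; rewrite -[RHS](setspin_id s v) sv. Qed.

Lemma gib_pair_gt0 s v : 0 < gib s ->
  0 < gib (setspin s v true) + gib (setspin s v false).
Proof.
move=> gs; have := setspin_id s v; case: (s v) => E.
  by rewrite E ltr_pwDl.
by rewrite E ltr_wpDl.
Qed.

Lemma pair_gt0 (a c x y : R) : 0 <= a -> 0 <= c -> 0 < a + c ->
  (0 < a -> 0 < x) -> (0 < c -> 0 < y) -> 0 < a * x + c * y.
Proof.
move=> a0 c0 ac hx hy; have [aE|aN] := eqVneq a 0.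
  rewrite aE mul0r add0r; rewrite aE add0r in ac.
  by rewrite mulr_gt0// hy.
have ap : 0 < a by rewrite lt_neqAle eq_sym aN.
have [cE|cN] := eqVneq c 0; first by rewrite cE mul0r addr0 mulr_gt0// hx.
have cp : 0 < c by rewrite lt_neqAle eq_sym cN.
by rewrite addr_gt0// mulr_gt0// ?hx ?hy.
Qed.

Lemma condexp_gt0 f v s : pos_on_support f -> 0 < gib s -> 0 < condexp v f s.
Proof.
move=> f0 gs; have ps := gib_pair_gt0 v gs.
by rewrite divr_gt0// pair_gt0// => h; apply: f0.
Qed.

Lemma condexp_setspin v g s c : condexp v g (setspin s v c) = condexp v g s.
Proof. by rewrite /condexp !setspin_setspin. Qed.

Lemma expt_condexp v g : \sum_s gib s * condexp v g s = \sum_s gib s * g s.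
Proof.
rewrite !(sum_split_spin v); apply: eq_bigr => s sv.
rewrite condexp_setspin /condexp (setspin_false sv).
set a := gib _; set c := gib s.
have [ac|ac] := eqVneq (a + c) 0; last by field.
have a0 : 0 <= a by apply: gib_ge0.
have c0 : 0 <= c by apply: gib_ge0.
have -> : a = 0 by lra.
have -> : c = 0 by lra.
by rewrite !mul0r.
Qed.

Lemma twoEnt_mass_zero (a c x y : R) : 0 <= a -> 0 <= c -> a + c = 0 ->
  twoEnt a c x y = 0.
Proof.
move=> a0 c0 ac; have -> : a = 0 by lra.
by rewrite twoEnt0.
Qed.

Lemma loc_condexp v f : pos_on_support f ->
  \sum_s gib s * (f s * ln (f s))
  - \sum_s gib s * (condexp v f s * ln (condexp v f s)) = loc v f.
Proof.
move=> f0; rewrite !(sum_split_spin v) -sumrB; apply: eq_bigr => s sv.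
rewrite condexp_setspin /condexp (setspin_false sv) /twoEnt.
set a := gib _; set c := gib s; set x := f _; set y := f s.
have [ac|ac] := eqVneq (a + c) 0; last first.
  by move: (ln x) (ln y) (ln (_ / _)) => l1 l2 l3; field.
have a0 : 0 <= a by apply: gib_ge0.
have c0 : 0 <= c by apply: gib_ge0.
have -> : a = 0 by lra.
have -> : c = 0 by lra.
by rewrite !mul0r; ring.
Qed.

Lemma breg_conv (x m : R) : 0 < x -> 0 < m -> x * ln m + x - m <= x * ln x.
Proof. by move=> x0 m0; have := breg_ge0 x0 m0; rewrite /breg; lra. Qed.

Definition Pf f s : R := \sum_t glb s t * f t.

Lemma avg_const (c : R) : n^-1 * \sum_(v : V) c = c.
Proof.
by rewrite sumr_const -[X in _ * X]mulr_natl mulrA mulVf ?mul1r// gt_eqF.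
Qed.

Lemma Pf_pos f : pos_on_support f -> pos_on_support (Pf f).
Proof.
move=> f0 s gs; rewrite /Pf glauber_sum mulr_gt0 ?invr_gt0//.
have /card_gt0P[v _] := V_gt0; rewrite (bigD1 v)//= ltr_pwDl ?condexp_gt0//.
by apply: sumr_ge0 => u _; rewrite ltW// condexp_gt0.
Qed.

Lemma expt_Pf f : expt (Pf f) = expt f.
Proof.
rewrite /expect; transitivity (n^-1 * \sum_v \sum_s gib s * condexp v f s).
  rewrite exchange_big/= mulr_sumr; apply: eq_bigr => s _.
  by rewrite /Pf glauber_sum mulrCA mulr_sumr.
under eq_bigr do rewrite expt_condexp.
exact: avg_const.
Qed.

(** [Pf f] is the average of [condexp v f] over [v], so convexity of [x * ln x], used as a tangent
    at the average, bounds its entropy by the average of theirs; by [loc_condexp] each [condexp v f]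
    has lost exactly [loc v f]. *)
Lemma entropy_Pf_le f : pos_on_support f ->
  ent (Pf f) <= ent f - n^-1 * \sum_v loc v f.
Proof.
move=> f0; rewrite /entropy expt_Pf addrAC lerD2r.
have -> : expt (fun s => f s * ln (f s)) - n^-1 * \sum_v loc v f =
    n^-1 * \sum_v \sum_s gib s * (condexp v f s * ln (condexp v f s)).
  rewrite -[expt _]avg_const -mulrBr -sumrB; congr (_ * _).
  by apply: eq_bigr => v _; rewrite -(loc_condexp v f0) /expect; ring.
rewrite /expect exchange_big/= mulr_sumr; apply: ler_sum => s _.
rewrite -mulr_sumr [leRHS]mulrCA.
have [gs|gs] := eqVneq (gib s) 0; first by rewrite gs !mul0r.
have gp : 0 < gib s by rewrite lt_neqAle eq_sym gs gib_ge0.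
rewrite ler_pM2l//; set m := Pf f s.
have m0 : 0 < m by apply: Pf_pos.
have mE : m = n^-1 * \sum_v condexp v f s by rewrite /m /Pf glauber_sum.
apply: le_trans (_ : n^-1 * \sum_v (condexp v f s * ln m + condexp v f s - m) <= _).
  rewrite big_split big_split/= sumrN -mulr_suml mulrDr mulrDr mulrN avg_const.
  by rewrite mulrA -mE addrK.
rewrite ler_pM2l ?invr_gt0//; apply: ler_sum => v _.
by apply: breg_conv => //; apply: condexp_gt0.
Qed.

(** Site by site this is Jensen's inequality: the conditional mean of [ln f] is at most the
    logarithm of the conditional mean of [f]. *)
Lemma dirichlet_ge f : pos_on_support f -> n^-1 * \sum_v loc v f <= dir f.
Proof.
move=> f0; rewrite /dirichlet.
have -> : \sum_s gib s * f s * (ln (f s) - \sum_t glb s t * ln (f t)) =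
    n^-1 * \sum_v \sum_s gib s * f s * (ln (f s) - condexp v (fun t => ln (f t)) s).
  rewrite exchange_big/= mulr_sumr; apply: eq_bigr => s _.
  rewrite glauber_sum -mulr_sumr mulrCA; congr (_ * _).
  by rewrite sumrB mulrBr avg_const.
rewrite ler_pM2l ?invr_gt0//; apply: ler_sum => v _.
rewrite (sum_split_spin v); apply: ler_sum => s sv.
rewrite condexp_setspin /condexp (setspin_false sv).
have a0 := gib_ge0 (setspin s v true); have c0 := gib_ge0 s.
have hx := f0 (setspin s v true); have hy := f0 s.
move: (gib _) (gib s) a0 c0 (f _) (f s) hx hy => a c a0 c0 x y hx hy.
have [ac|ac] := eqVneq (a + c) 0.
  rewrite twoEnt_mass_zero//.
  have -> : a = 0 by lra.
  have -> : c = 0 by lra.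
  by rewrite !mul0r addr0.
have ap : 0 < a + c by rewrite lt_neqAle eq_sym ac addr_ge0.
have [aE|aN] := eqVneq a 0.
  rewrite aE add0r in ac; rewrite aE twoEnt0 !mul0r !add0r.
  have -> : c * ln y / c = ln y by field.
  by rewrite subrr mulr0.
have [cE|cN] := eqVneq c 0.
  rewrite cE twoEnt0r !mul0r !addr0.
  have -> : a * ln x / a = ln x by field.
  by rewrite subrr mulr0.
have x0 : 0 < x by apply: hx; rewrite lt_neqAle eq_sym aN.
have y0 : 0 < y by apply: hy; rewrite lt_neqAle eq_sym cN.
rewrite /twoEnt; set F := a * x + c * y.
have F0 : 0 < F by apply: comb_gt0.
have m0 : 0 < F / (a + c) by rewrite divr_gt0.
set m := F / (a + c) in m0 *.
have lm : (a * ln x + c * ln y) / (a + c) <= ln m.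
  rewrite ler_pdivrMr//.
  have hlx : ln x <= ln m + (x / m - 1).
    have := ln_le_subr1 (x := x / m); rewrite divr_gt0// => /(_ isT).
    by rewrite ln_div ?posrE//; lra.
  have hly : ln y <= ln m + (y / m - 1).
    have := ln_le_subr1 (x := y / m); rewrite divr_gt0// => /(_ isT).
    by rewrite ln_div ?posrE//; lra.
  have := ler_wpM2l a0 hlx; have := ler_wpM2l c0 hly.
  have Em : a * (x / m - 1) + c * (y / m - 1) = 0.
    have -> : a * (x / m - 1) + c * (y / m - 1) = F / m - (a + c).
      by rewrite /F; field; rewrite gt_eqF.
    by rewrite /m; field; rewrite ac gt_eqF.
  lra.
have := ler_wpM2l (ltW F0) lm; rewrite /F.
by move: ((a * ln x + c * ln y) / (a + c)) (ln m) (ln x) (ln y) => *; lra.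
Qed.

Variable C : R.
Hypothesis C_gt0 : 0 < C.
Hypothesis tensor : forall f, (forall s, 0 < f s) ->
  ent f <= C * \sum_v loc v f.

Lemma tensor_support f : pos_on_support f -> ent f <= C * \sum_v loc v f.
Proof.
move=> f0; pose f' s := if 0 < gib s then f s else 1.
have f'0 s : 0 < f' s by rewrite /f'; case: ifP => // /f0.
have zero s : ~~ (0 < gib s) -> gib s = 0.
  by move=> h; apply/eqP; rewrite eq_le gib_ge0 andbT leNgt.
have E g h : (forall s, 0 < gib s -> g s = h s) ->
    expt g = expt h.
  move=> gh; apply: eq_bigr => s _; have [/gh->//|/zero ->] := boolP (0 < gib s).
  by rewrite !mul0r.
have f'E s : 0 < gib s -> f' s = f s by rewrite /f' => ->.
have -> : ent f = ent f'.
  by rewrite /entropy (E f f') ?(E (fun s => f s * ln (f s)) (fun s => f' s * ln (f' s)))//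
    => s /f'E ->.
have -> : \sum_v loc v f = \sum_v loc v f'.
  apply: eq_bigr => v _; apply: eq_bigr => s _.
  have [g1|/zero ->] := boolP (0 < gib (setspin s v true)); last by rewrite !twoEnt0.
  have [g2|/zero ->] := boolP (0 < gib s); last by rewrite !twoEnt0r.
  by rewrite !f'E.
exact: tensor.
Qed.

Lemma dirichlet_entropy f : pos_on_support f -> (C * n)^-1 * ent f <= dir f.
Proof.
move=> f0; apply: le_trans (dirichlet_ge f0).
rewrite invfM [C^-1 * _]mulrC -mulrA ler_pM2l ?invr_gt0//.
by rewrite ler_pdivrMl// tensor_support.
Qed.

Lemma entropy_contraction f : pos_on_support f ->
  ent (Pf f) <= (1 - (C * n)^-1) * ent f.
Proof.
move=> f0; apply: le_trans (entropy_Pf_le f0) _.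
rewrite mulrBl mul1r lerD2l lerN2 invfM [C^-1 * _]mulrC -mulrA.
by rewrite ler_pM2l ?invr_gt0// ler_pdivrMl// tensor_support.
Qed.

End GlauberEntropy.

(** * Modified log-Sobolev constant, entropy decay and mixing time *)

Section MixingTime.
Variables (R : realType) (V : finType) (e : rel V) (beta gamma lambda : R).
Implicit Types (s t x : config V) (f g : config V -> R) (v : V).

Local Notation gib := (gibbs e beta gamma lambda).
Local Notation glb := (glauber e beta gamma lambda).
Local Notation ent := (entropy e beta gamma lambda).
Local Notation expt := (expect e beta gamma lambda).
Local Notation dir := (dirichlet e beta gamma lambda).
Local Notation pos := (pos_on_support e beta gamma lambda).
Local Notation P := (Pf e beta gamma lambda).
Local Notation lw := (law e beta gamma lambda).

Hypothesis gib_ge0 : forall s, 0 <= gib s.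
Hypothesis gib_sum : \sum_s gib s = 1.
Hypothesis V_gt0 : (0 < #|V|)%N.
Variable C : R.
Hypothesis C_gt0 : 0 < C.
Hypothesis tensor : forall f, (forall s, 0 < f s) ->
  ent f <= C * \sum_v loc e beta gamma lambda v f.

Let n : R := #|V|%:R.
Let n0 : 0 < n. Proof. by rewrite ltr0n. Qed.

Let gib_zero s : ~~ (0 < gib s) -> gib s = 0.
Proof. by move=> h; apply/eqP; rewrite eq_le gib_ge0 andbT leNgt. Qed.

Lemma expt_gt0 f : pos f -> 0 < expt f.
Proof.
move=> f0; have [s gs] : exists s, 0 < gib s.
  apply/not_existsP => h; move: gib_sum; rewrite big1 => [/eqP|s _].
    by rewrite eq_sym oner_eq0.
  by apply: gib_zero; apply/negP/h.
rewrite /expect (bigD1 s)//=; apply: ltr_pwDl; first exact: mulr_gt0 gs (f0 s gs).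
apply: sumr_ge0 => t _; have [gt|/gib_zero ->] := boolP (0 < gib t).
  by rewrite mulr_ge0// ltW// f0.
by rewrite mul0r.
Qed.

Lemma entropyE f : pos f ->
  ent f = \sum_s gib s * breg (f s) (expt f).
Proof.
move=> f0; rewrite /entropy /breg; set m := expt f.
transitivity (\sum_s gib s * (f s * ln (f s)) - m * ln m - m + m * \sum_s gib s).
  by rewrite gib_sum /expect; ring.
transitivity (\sum_s gib s * (f s * ln (f s)) - (\sum_s gib s * f s) * ln m
    - \sum_s gib s * f s + m * \sum_s gib s); first by [].
rewrite mulr_suml mulr_sumr -!sumrB -big_split/=.
by apply: eq_bigr => s _; ring.
Qed.

Lemma entropy_ge0 f : pos f -> 0 <= ent f.
Proof.
move=> f0; rewrite entropyE//; apply: sumr_ge0 => s _.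
have [gs|/gib_zero ->] := boolP (0 < gib s); last by rewrite mul0r.
exact: mulr_ge0 (ltW gs) (breg_ge0 (f0 _ gs) (expt_gt0 f0)).
Qed.

Lemma xi_eq0 (y : R) : 0 <= y -> xi y = 0 -> y = 1.
Proof.
move=> y0 xi0; apply/eqP; rewrite -subr_eq0 -normr_le0 leNgt; apply/negP => h.
have : 0 < `|y - 1| / 2 by rewrite divr_gt0.
by move=> /(dist1_le_xi y0); rewrite xi0 mulr0; lra.
Qed.

(** Makes the set under the infimum in [mlsi_const] nonempty, without which no lower bound on it
    follows. *)
Lemma exists_entropy_neq0 x y : x != y -> 0 < gib x -> 0 < gib y ->
  exists f, pos f /\ ent f != 0.
Proof.
move=> xy gx gy; pose f s : R := if s == x then 2 else 1.
have f0 : pos f by move=> s _; rewrite /f; case: ifP.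
exists f; split=> //; apply/eqP => E; have m0 := expt_gt0 f0.
have b0 s : 0 <= gib s * breg (f s) (expt f).
  have [gs|/gib_zero ->] := boolP (0 < gib s); last by rewrite mul0r.
  exact: mulr_ge0 (ltW gs) (breg_ge0 (f0 _ gs) m0).
have fm s : 0 < gib s -> f s = expt f.
  move=> gs; move: E; rewrite entropyE// => /eqP.
  rewrite psumr_eq0; last by move=> t _.
  move=> /allP/(_ s); rewrite mem_index_enum => /(_ isT) /=.
  rewrite mulf_eq0 gt_eqF//= bregE ?f0// mulf_eq0 gt_eqF//= => /eqP.
  move=> /xi_eq0 h; apply: (divIf (lt0r_neq0 m0)); rewrite divff ?gt_eqF//.
  by apply: h; rewrite divr_ge0// ltW// f0.
have := fm x gx; rewrite -(fm y gy) /f eqxx eq_sym (negPf xy); lra.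
Qed.

Lemma mlsi_const_ge x y : x != y -> 0 < gib x -> 0 < gib y ->
  (C * n)^-1 <= mlsi_const e beta gamma lambda.
Proof.
move=> xy gx gy; apply: lb_le_inf.
  have [f [f0 f1]] := exists_entropy_neq0 xy gx gy.
  by exists (dir f / ent f); exists f; split.
move=> _ [f [f0 [f1 ->]]]; have e0 := entropy_ge0 f0.
rewrite ler_pdivlMr; last by rewrite lt_neqAle eq_sym f1.
exact: (dirichlet_entropy gib_ge0 V_gt0 C_gt0 tensor).
Qed.

Lemma glauber_balance s t : gib s * glb s t = gib t * glb t s.
Proof.
rewrite /glauber mulrCA [RHS]mulrCA; congr (_ * _); rewrite !mulr_sumr.
apply: eq_bigr => v _; rewrite -/(agree v s t) -/(agree v t s) agree_sym.
case: ifP => h; last by rewrite !mulr0.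
by rewrite !(agree_setspin _ h) mulrCA.
Qed.

Lemma glauber_row s : 0 < gib s -> \sum_t glb s t = 1.
Proof.
move=> gs; transitivity (\sum_t glb s t * (fun=> 1) t).
  by apply: eq_bigr => t _; rewrite mulr1.
rewrite glauber_sum -[RHS](avg_const V_gt0 1); congr (_ * _).
apply: eq_bigr => v _; rewrite /condexp !mulr1 divff// gt_eqF//.
exact: gib_pair_gt0.
Qed.

Lemma glauber_stationary t : \sum_s gib s * glb s t = gib t.
Proof.
under eq_bigr do rewrite glauber_balance.
rewrite -mulr_sumr; have [gt|/gib_zero ->] := boolP (0 < gib t).
  by rewrite glauber_row// mulr1.
by rewrite mul0r.
Qed.

(* Starting from [(delta_x + mu) / 2] instead of [delta_x] keeps densities
   positive and halves total variation distances. *)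
Definition start x s : R := ((s == x)%:R / gib x + 1) / 2.

Lemma start_pos x : 0 < gib x -> pos (start x).
Proof.
by move=> gx s _; rewrite divr_gt0// ltr_wpDl// divr_ge0// ltW.
Qed.

(** By reversibility, the density of the law at time [k] evolves under the same operator that acts
    on functions. *)
Lemma law_density x k s : 0 < gib x ->
  (lw x k s + gib s) / 2 = gib s * iter k P (start x) s.
Proof.
move=> gx; elim: k s => [|k IH] s /=.
  rewrite /start; have [->|_] := eqVneq s x; last by rewrite mul0r add0r; ring.
  by rewrite mulr1n; field; rewrite gt_eqF.
rewrite /Pf mulr_sumr.
transitivity (\sum_t (lw x k t + gib t) / 2 * glb t s); last first.
  apply: eq_bigr => t _; rewrite IH mulrAC [RHS]mulrA [gib s * _]glauber_balance.
  by [].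
rewrite -[in LHS](glauber_stationary s) -big_split mulr_suml.
apply: eq_bigr => t _ /=.
by ring.
Qed.

Lemma iter_pos x k : 0 < gib x -> pos (iter k P (start x)).
Proof.
move=> gx; elim: k => [|k IH]; first exact: start_pos.
by rewrite iterS; apply: Pf_pos.
Qed.

Lemma expt_iter x k : 0 < gib x -> expt (iter k P (start x)) = 1.
Proof.
move=> gx; elim: k => [|k IH]; last by rewrite iterS expt_Pf.
rewrite /= /expect /start.
transitivity ((\sum_s gib s * ((s == x)%:R / gib x) + \sum_s gib s) / 2).
  by rewrite -big_split mulr_suml; apply: eq_bigr => s _ /=; ring.
rewrite gib_sum (bigD1 x)//= eqxx mul1r mulfV ?gt_eqF// big1; first by field.
by move=> s /negPf ->; rewrite mul0r mulr0.
Qed.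

Lemma entropy_start_le x : 0 < gib x -> ent (start x) <= - ln (gib x).
Proof.
move=> gx; have E1 := expt_iter 0 gx; rewrite /= in E1.
have gx1 : gib x <= 1.
  rewrite -gib_sum (bigD1 x)//= lerDl sumr_ge0//.
have gi : 1 <= (gib x)^-1 by rewrite invf_ge1.
rewrite /entropy E1 ln1 mulr0 subr0 -lnV ?posrE// -[leRHS]mul1r -E1.
rewrite /expect mulr_suml; apply: ler_sum => s _.
have [gs|/gib_zero ->] := boolP (0 < gib s); last by rewrite !mul0r.
rewrite -mulrA ler_pM2l//; have sp := start_pos gx gs.
rewrite ler_pM2l// ler_ln ?posrE ?invr_gt0//.
rewrite /start ler_pdivrMr//.
have : (s == x)%:R / gib x <= (gib x)^-1.
  by rewrite ler_piMl ?invr_ge0// lern1 leq_b1.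
lra.
Qed.

Lemma entropy_iter_le x k : 0 < gib x ->
  ent (iter k P (start x)) <= expR (- ((C * n)^-1 * k%:R)) * - ln (gib x).
Proof.
move=> gx; elim: k => [|k IH].
  by rewrite mulr0 oppr0 expR0 mul1r entropy_start_le.
have ip := iter_pos k gx.
rewrite iterS; apply: le_trans (entropy_contraction gib_ge0 V_gt0 C_gt0 tensor ip) _.
apply: le_trans (_ : expR (- (C * n)^-1) * ent (iter k P (start x)) <= _).
  by rewrite ler_wpM2r ?entropy_ge0// expR_ge1Dx.
apply: le_trans (ler_wpM2l (expR_ge0 _) IH) _.
by rewrite mulrA -expRD -natr1 mulrDr mulr1 opprD addrC.
Qed.

(** Averaging [dist1_le_xi] at [a = eps / 2] replaces Pinsker's inequality: entropy at most
    [eps ^+ 2 / 6] adds [eps ^+ 2 / 6 + eps / 3 <= eps / 2]. The factor 2 lost by the halved start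
    cancels the 1/2 in [dTV]. *)
Lemma dTV_le x k (eps : R) : 0 < gib x -> 0 < eps < 1 ->
  expR (- ((C * n)^-1 * k%:R)) * - ln (gib x) <= eps ^+ 2 / 6 ->
  dTV (lw x k) gib <= eps.
Proof.
move=> gx /andP[e0 e1] h; have E := le_trans (entropy_iter_le k gx) h.
set g := iter k P (start x) in E.
have gp : pos g := iter_pos k gx.
have mg : expt g = 1 := expt_iter k gx.
have -> : dTV (lw x k) gib = \sum_s gib s * `|g s - 1|.
  rewrite /dTV mulr_sumr; apply: eq_bigr => s _.
  have -> : lw x k s - gib s = 2 * (gib s * (g s - 1)).
    by rewrite mulrBr mulr1 -law_density//; field.
  rewrite normrM normrM (ger0_norm (gib_ge0 s)) (@ger0_norm _ 2)//.
  by field.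
have e2 : 0 < eps / 2 by rewrite divr_gt0.
apply: le_trans (_ : \sum_s gib s * (eps / 2 + (1 + (eps / 2)^-1) * breg (g s) 1) <= _).
  apply: ler_sum => s _; have [gs|/gib_zero ->] := boolP (0 < gib s); last first.
    by rewrite !mul0r.
  rewrite ler_pM2l// bregE ?gp// mul1r divr1.
  by apply: dist1_le_xi => //; rewrite ltW// gp.
have -> : \sum_s gib s * (eps / 2 + (1 + (eps / 2)^-1) * breg (g s) 1)
    = eps / 2 * \sum_s gib s + (1 + (eps / 2)^-1) * ent g.
  rewrite entropyE// mg !mulr_sumr -big_split; apply: eq_bigr => s _ /=.
  by ring.
rewrite gib_sum mulr1.
have c0 : 0 <= 1 + (eps / 2)^-1 by apply: addr_ge0 => //; rewrite invr_ge0 ltW.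
have := ler_wpM2l c0 E.
have -> : (1 + (eps / 2)^-1) * (eps ^+ 2 / 6) = eps ^+ 2 / 6 + eps / 3.
  by field; rewrite gt_eqF.
have : eps ^+ 2 <= eps by rewrite expr2; apply: ler_piMl; apply: ltW.
lra.
Qed.

Lemma mixing_time_le (eps H : R) : 0 < eps < 1 -> 0 < H ->
  (exists x, 0 < gib x) -> (forall x, 0 < gib x -> - ln (gib x) <= H) ->
  0 <= ln H + ln (6 / eps ^+ 2) ->
  mixing_time e beta gamma lambda eps
  <= C * n * (ln H + ln (6 / eps ^+ 2)) + 1.
Proof.
move=> e01 H0 [x0 gx0] hH B0; have [e0 e1] := andP e01.
set B := ln H + _ in B0 *.
have CB : 0 <= C * n * B by rewrite (mulr_ge0 (mulr_ge0 (ltW C_gt0) (ltW n0)) B0).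
apply: ge_sup; first by exists (hit_time e beta gamma lambda eps x0); exists x0.
move=> _ [x gx <-]; rewrite /hit_time.
(* Rounding up to an integer time is the source of the additive 1. *)
pose k := (Num.truncn (C * n * B)).+1.
apply: le_trans (_ : k%:R <= _); last first.
  by rewrite /k -natr1 lerD2r truncn_le.
apply: ge_inf; first by exists 0 => _ [j _ <-].
suff h : dTV (lw x k) gib <= eps by exists k.
apply: (dTV_le gx e01).
have kB : B <= (C * n)^-1 * k%:R.
  rewrite ler_pdivlMl ?mulr_gt0//.
  by rewrite /k ltW// truncnS_gt.
apply: le_trans (_ : expR (- B) * H <= _).
  apply: ler_pM; rewrite ?expR_ge0 ?hH// ?ler_expR ?lerN2//.
  rewrite oppr_ge0 ln_le0// -gib_sum (bigD1 x)//= lerDl sumr_ge0//.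
have e2 : 0 < eps ^+ 2 by rewrite exprn_gt0.
rewrite /B opprD expRD !expRN !lnK ?posrE ?divr_gt0//.
by rewrite mulrAC mulVf ?gt_eqF// mul1r invf_div.
Qed.

End MixingTime.

(** * Two-spin systems as lattice gases *)

Section SpinsAsGas.
Variables (R : realType) (V : finType) (e : rel V).
Hypotheses (esym : symmetric e) (eirr : irreflexive e).
Implicit Types (A : {set V}) (v : V).

(** Both sides count edges inside [A] twice, and edges across or outside once. *)
Lemma edges_inC A :
  (#|edges e| + edges_in e A = \sum_(v in A) deg e v + edges_in e (~: A))%N.
Proof.
have [k] := ubnP #|A|; elim: k A => // k IHk A Ak.
have [->|[v vA]] := set_0Vmem A.
  rewrite edges_in0 // big_set0 addn0 finset.setC0 add0n; apply: eq_card => E.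
  by rewrite !inE subsetT andbT.
have := IHk (A :\ v); rewrite (cardsD1 v A) vA in Ak => /(_ Ak).
have : v \notin A :\ v by rewrite !inE eqxx.
move: (A :\ v) (setD1K vA) => B <- {A vA Ak} vA IH; rename B into A.
have vC : v \notin ~: (v |: A) by rewrite !inE eqxx.
have CE : v |: ~: (v |: A) = ~: A.
  apply/setP => u; rewrite !inE; have [->|_] := eqVneq u v; last by [].
  by rewrite vA.
have := edges_inU esym eirr vC; rewrite CE => EC.
have dE : deg e v = (nbrs_in e A v + nbrs_in e (~: (v |: A)) v)%N.
  rewrite /deg /nbrs_in -cardsUI; set I := (_ :&: _).
  have -> : I = finset.set0.
    by apply/setP => u; rewrite !inE; case: (u \in A); rewrite ?orbT ?andbF.
  rewrite cards0 addn0; apply: eq_card => u; rewrite !inE.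
  have [->|_] := eqVneq u v; first by rewrite eirr !andbF.
  by case: (u \in A); rewrite ?orbF.
by rewrite big_setU1//= edges_inU// addnA IH EC dE; ring.
Qed.

(** By [edges_inC], the weight [x] of the edges outside [A] is traded for a factor [x] on each edge
    inside [A] and a division of each activity by [x ^+ deg e v]. *)
Lemma gasW_external (x y l : R) A : x != 0 ->
  x ^+ edges_in e (~: A) * y ^+ edges_in e A * l ^+ #|A|
  = x ^+ #|edges e| * gasW e (x * y) (fun v => l / x ^+ deg e v) A.
Proof.
move=> x0; have := congr1 (fun k => x ^+ k) (edges_inC A).
rewrite /= !exprD /gasW big_split /= prodr_const exprMn prodfV -expr_sum.
have : x ^+ (\sum_(v in A) deg e v) != 0 by rewrite expf_neq0.
move: (x ^+ edges_in e _) (y ^+ _) (l ^+ _) (x ^+ #|_|) (x ^+ edges_in e A).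
move: (x ^+ _) => d c y' l' t a d0 E.
have -> : t * (l' / d * (a * y')) = (t * a) * l' * y' / d by field.
by rewrite E; field.
Qed.

(* [c] is the spin read as an occupied site: [true] for [+1]. *)
Definition spins (c : bool) A : config V := [ffun v => (v \in A) == c].

Lemma spins_bij c : bijective (spins c).
Proof.
exists (fun s : config V => [set v | s v == c]) => [A|s].
  by apply/setP => v; rewrite inE ffunE; case: (v \in A); case: c.
by apply/ffunP => v; rewrite ffunE inE; case: (s v); case: c.
Qed.

Lemma setspin_spins c A v : setspin (spins c A) v c = spins c (v |: A).
Proof.
apply/ffunP => u; rewrite !ffunE !inE; by case: eqP => // _; case: c.
Qed.

Lemma weight_spins_plus (beta gamma lambda : R) A : gamma != 0 ->
  weight e beta gamma lambda (spins true A) =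
  gamma ^+ #|edges e|
  * gasW e (gamma * beta) (fun v => lambda / gamma ^+ deg e v) A.
Proof.
move=> g0; have pE : plus_set (spins true A) = A.
  by apply/setP => v; rewrite inE ffunE eqb_id.
have mE : minus_set (spins true A) = ~: A.
  by apply/setP => v; rewrite !inE ffunE eqb_id.
rewrite /weight /m_plus /m_minus /n_plus pE mE -gasW_external//.
by rewrite [_ * gamma ^+ _]mulrC.
Qed.

Lemma weight_spins_minus (beta gamma lambda : R) A : beta != 0 -> lambda != 0 ->
  weight e beta gamma lambda (spins false A) =
  beta ^+ #|edges e| * lambda ^+ #|V|
  * gasW e (beta * gamma) (fun v => lambda^-1 / beta ^+ deg e v) A.
Proof.
move=> b0 l0; have pE : plus_set (spins false A) = ~: A.
  by apply/setP => v; rewrite !inE ffunE; case: (v \in A).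
have mE : minus_set (spins false A) = A.
  by apply/setP => v; rewrite !inE ffunE; case: (v \in A).
rewrite /weight /m_plus /m_minus /n_plus pE mE [RHS]mulrAC -gasW_external//.
rewrite -[RHS]mulrA; congr (_ * _).
apply: (mulIf (expf_neq0 #|A| l0)); rewrite -exprD addnC cardsC.
by rewrite exprVn mulrAC mulVf ?mul1r// expf_neq0.
Qed.

Section Transfer.
Variables (beta gamma lambda : R) (c : bool) (b k : R) (r : V -> R).
Hypothesis weightE : forall A,
  weight e beta gamma lambda (spins c A) = k * gasW e b r A.
Hypothesis gib_sum : \sum_s gibbs e beta gamma lambda s = 1.

Let k' := k / partition_fn e beta gamma lambda.

Let gibE A : gibbs e beta gamma lambda (spins c A) = k' * gasW e b r A.
Proof. by rewrite /gibbs weightE mulrAC. Qed.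

Let expectE f :
  expect e beta gamma lambda f = k' * gasM e b r (fun A => f (spins c A)).
Proof.
rewrite /expect (reindex (spins c)); last exact: onW_bij (spins_bij c).
by rewrite /gasM mulr_sumr; apply: eq_bigr => A _; rewrite gibE mulrA.
Qed.

Let k'Z : k' * gasZ e b r = 1.
Proof.
rewrite -gib_sum (reindex (spins c)); last exact: onW_bij (spins_bij c).
by rewrite /gasZ mulr_sumr; apply: eq_bigr => A _; rewrite gibE.
Qed.

Let entropyE f :
  entropy e beta gamma lambda f = k' * gasEnt e b r (fun A => f (spins c A)).
Proof.
have k'E : k' = (gasZ e b r)^-1.
  have Z0 : gasZ e b r != 0.
    by apply: contra_eq_neq k'Z => ->; rewrite mulr0 eq_sym oner_neq0.
  by apply: (mulIf Z0); rewrite k'Z mulVf.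
rewrite /entropy /gasEnt !expectE mulrBr; congr (_ - _).
by rewrite -mulrA {2}k'E [_^-1 * _]mulrC.
Qed.

Let locE f v :
  loc e beta gamma lambda v f = k' * locEnt e b r v (fun A => f (spins c A)).
Proof.
pose g := gibbs e beta gamma lambda.
transitivity (\sum_(s : config V | s v == ~~ c)
    twoEnt (g (setspin s v c)) (g s) (f (setspin s v c)) (f s)).
  rewrite /loc; case: c; first by apply: eq_bigl => s; rewrite eqbF_neg.
  rewrite [RHS](reindex_onto (fun s => setspin s v true)
    (fun s => setspin s v false)); last first.
    by move=> s /eqP/= sv; rewrite setspin_setspin -sv setspin_id.
  apply: eq_big => [s|s /negPf sv].
    rewrite setspin_v eqxx setspin_setspin; apply/idP/eqP => [/negPf sv|<-].
      by rewrite -sv setspin_id.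
    by rewrite setspin_v.
  by rewrite twoEntC setspin_setspin -sv setspin_id.
rewrite (reindex (spins c)); last exact: onW_bij (spins_bij c).
rewrite /locEnt mulr_sumr; apply: eq_big => [A|A _].
  by rewrite ffunE; case: (v \in A); case: c.
by rewrite setspin_spins /g !gibE twoEnt_homog.
Qed.

Lemma gas_transfer (C : R) :
  0 <= k' ->
  (forall F, (forall A, 0 < F A) ->
    gasEnt e b r F <= C * \sum_v locEnt e b r v F) ->
  forall f, (forall s, 0 < f s) ->
  entropy e beta gamma lambda f <= C * \sum_v loc e beta gamma lambda v f.
Proof.
move=> k0 h f f0; rewrite entropyE.
under eq_bigr do rewrite locE.
by rewrite -mulr_sumr mulrCA ler_wpM2l// h.
Qed.

End Transfer.
End SpinsAsGas.

(** * The uniqueness criterion in the coordinates of the gas *)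

Section TwoSpinTensorization.
Variables (R : realType) (V : finType) (e : rel V).
Hypotheses (esym : symmetric e) (eirr : irreflexive e).
Variables (D : nat) (delta : R).
Hypotheses (D_ge2 : (2 <= D)%N) (delta01 : 0 < delta < 1).
Hypothesis deg_le : forall v, (deg e v <= D.+1)%N.

(** With plus spins as occupied sites, [x] is [gamma] and [y] is [beta]; after a flip the roles
    change and [z] is the inverse of [xh]. The fixed point of the gas is [z / x] and its activity
    bound [l / x ^+ D.+1]. The activities [l / x ^+ deg e v] respect it when [x <= 1], or when all
    degrees equal [D.+1]. *)
Lemma external_tensorization (x y l z : R) (f : {set V} -> R) :
  0 < x -> 0 <= y -> x * y < 1 -> 0 < l -> 0 < z ->
  z = l * ((y * z + 1) / (z + x)) ^+ D ->
  D%:R * (1 - x * y) * z / ((y * z + 1) * (z + x)) <= 1 - delta ->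
  y * z ^+ 2 <= x ->
  x <= 1 \/ (forall v, deg e v = D.+1) ->
  (forall A, 0 < f A) ->
  gasEnt e (x * y) (fun v => l / x ^+ deg e v) f <= expR (cGas R / delta)
    * \sum_w locEnt e (x * y) (fun v => l / x ^+ deg e v) w f.
Proof.
move=> x0 y0 xy1 l0 z0 zfix zgap zsmall xD f0.
have den : 0 < z + x by rewrite addr_gt0.
have num : 0 < y * z + 1 by rewrite ltr_wpDl// mulr_ge0// ltW.
have zx1 : z / x + 1 = (z + x) / x by field; rewrite gt_eqF.
have xyz : x * y * (z / x) + 1 = y * z + 1 by field; rewrite gt_eqF.
apply: (@gas_tensorization R V e (x * y) esym eirr _ xy1 D (l / x ^+ D.+1)
  (z / x) delta D_ge2 delta01) => //.
- by rewrite mulr_ge0// ltW.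
- by rewrite divr_gt0.
- by rewrite divr_gt0// exprn_gt0.
- rewrite zx1 xyz {1}zfix.
  have -> : (y * z + 1) / ((z + x) / x) = x * ((y * z + 1) / (z + x)).
    by field; rewrite !gt_eqF.
  rewrite [in RHS]exprMn exprS; have : x ^+ D != 0 by rewrite expf_neq0// gt_eqF.
  move: (x ^+ D) (_ ^+ D) => t s t0; field; rewrite t0 gt_eqF//.
- rewrite /hfun zx1 xyz; apply: le_trans zgap; rewrite le_eqVlt; apply/orP; left.
  by apply/eqP; field; rewrite !gt_eqF.
- have -> : x * y * (z / x) ^+ 2 = y * z ^+ 2 / x by field; rewrite gt_eqF.
  by rewrite ler_pdivrMr// mul1r.
- move=> u; apply/andP; split; first by rewrite divr_ge0 ?exprn_ge0 ?ltW.
  rewrite ler_pM2l// lef_pV2 ?posrE ?exprn_gt0//.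
  case: xD => [x1|->//]; exact: (ler_wiXn2l (ltW x0) x1 (deg_le u)).
Qed.

Variables (beta gamma lambda xh : R).
Hypothesis af : antiferro beta gamma lambda.
Hypothesis gib_sum : \sum_s gibbs e beta gamma lambda s = 1.
Hypothesis Z_gt0 : 0 < partition_fn e beta gamma lambda.
Hypothesis xh_gt0 : 0 < xh.
Hypothesis xh_fix : Fd beta gamma lambda D xh = xh.
Hypothesis xh_gap :
  D%:R * (1 - beta * gamma) * xh / ((beta * xh + 1) * (xh + gamma)) <= 1 - delta.
Hypothesis gamma_deg : gamma <= 1 \/ (forall v, deg e v = D.+1).

Lemma two_spin_tensorization (f : config V -> R) : (forall s, 0 < f s) ->
  entropy e beta gamma lambda f
  <= expR (cGas R / delta) * \sum_v loc e beta gamma lambda v f.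
Proof.
move=> f0; have [b0 bg g0 l0 bg1] := af.
have num : 0 < beta * xh + 1 by rewrite ltr_wpDl// mulr_ge0// ltW.
have den : 0 < xh + gamma by rewrite addr_gt0.
(* Flipping all spins replaces [xh] by [1 / xh], so one of the two readings
   satisfies the condition [b * xh ^+ 2 <= 1] of the gas. *)
have [small|] := leP (beta * xh ^+ 2) gamma.
  apply: (gas_transfer (fun A => weight_spins_plus esym eirr beta lambda A
    (lt0r_neq0 g0)) gib_sum) => //.
    by rewrite divr_ge0 ?exprn_ge0 ?ltW.
  move=> F F0; apply: (external_tensorization (z := xh)) => //.
  - by rewrite mulrC.
  - by rewrite [gamma * beta]mulrC.
move=> big.
have bpos : 0 < beta.
  rewrite lt_neqAle b0 andbT; apply: contraTneq big => <-.
  by rewrite mul0r -leNgt ltW.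
apply: (gas_transfer (fun A => weight_spins_minus esym eirr gamma A
    (lt0r_neq0 bpos) (lt0r_neq0 l0)) gib_sum) => //.
  by rewrite divr_ge0 ?mulr_ge0 ?exprn_ge0 ?ltW.
move=> F F0; apply: (external_tensorization (z := xh^-1)) => //.
- exact: ltW.
- by rewrite invr_gt0.
- by rewrite invr_gt0.
- have -> : (gamma / xh + 1) / (xh^-1 + beta) = ((beta * xh + 1) / (xh + gamma))^-1.
    by field; rewrite !gt_eqF// addrC.
  by rewrite exprVn -invfM -/(Fd beta gamma lambda D xh) xh_fix.
- apply: le_trans xh_gap; rewrite le_eqVlt; apply/orP; left; apply/eqP.
  by field; rewrite !gt_eqF// addrC.
- rewrite exprVn ler_pdivrMr ?exprn_gt0// ltW//.
(* In the flipped reading [x] is [beta], and [beta ^+ 2 <= beta * gamma < 1]. *)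
- left; rewrite -(@expr_le1 _ 2)// expr2; apply: le_trans (ltW bg1).
  exact: ler_wpM2l.
Qed.

End TwoSpinTensorization.

Lemma norm3_le (R : realDomainType) (x y z p t : R) :
  `|x| <= p -> `|y| <= p -> `|z| <= t -> `|x + y + z| <= 2 * p + t.
Proof.
move=> xp yp zt; apply: le_trans (ler_normD _ _) _.
by have := ler_normD x y; lra.
Qed.

(** As [a] and [q] are at least 1/2, both [N * a] and [N * q] are at most [2 * N * a * q]; hence 14
    = 2 + 8 + 4. *)
Lemma entropy_bound_arith (R : realFieldType) (n N l a q : R) :
  0 <= n -> n <= N -> 1 / 2 <= l -> l <= a -> l <= q ->
  n * l + (2 * N * a + n * q) + (2 * N * a + n * q) <= 14 * N * a * q.
Proof.
move=> n0 nN l2 la lq; have N0 : 0 <= N by lra.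
have h1 : n * l <= N * a by apply: ler_pM; lra.
have h2 : n * q <= N * q by apply: ler_wpM2r; lra.
have Na : 0 <= N * a * (2 * q - 1) by rewrite !mulr_ge0; lra.
have Nq : 0 <= N * q * (2 * a - 1) by rewrite !mulr_ge0; lra.
lra.
Qed.

(** * Support and smallest probability of the Gibbs distribution *)

Section GibbsFacts.
Variables (R : realType) (V : finType) (e : rel V).
Hypotheses (esym : symmetric e) (eirr : irreflexive e).
Variables (beta gamma lambda : R).
Hypothesis af : antiferro beta gamma lambda.
Implicit Types (s x : config V) (v : V).

Local Notation wt := (weight e beta gamma lambda).
Local Notation Zp := (partition_fn e beta gamma lambda).
Local Notation gib := (gibbs e beta gamma lambda).
Local Notation n := (#|V|%:R : R).

Let b_ge0 : 0 <= beta. Proof. by case: af. Qed.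
Let b_le_g : beta <= gamma. Proof. by case: af. Qed.
Let g_gt0 : 0 < gamma. Proof. by case: af. Qed.
Let l_gt0 : 0 < lambda. Proof. by case: af. Qed.
Let bg_lt1 : beta * gamma < 1. Proof. by case: af. Qed.

Lemma weight_ge0 s : 0 <= wt s.
Proof. by rewrite /weight !mulr_ge0// exprn_ge0// ltW. Qed.

Lemma weight_minus_gt0 : 0 < wt (spins true finset.set0).
Proof.
rewrite weight_spins_plus ?gt_eqF// gasW0// mulr1.
exact: exprn_gt0.
Qed.

Lemma weight_single_gt0 v : 0 < wt (spins true [set v]).
Proof.
rewrite weight_spins_plus ?gt_eqF// -[[set v]]finset.setU0 gasWU ?inE// gasW0//.
have -> : nbrs_in e finset.set0 v = 0%N.
  by rewrite /nbrs_in; apply/eqP; rewrite cards_eq0; apply/eqP/setP => u; rewrite !inE.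
by rewrite expr0 mulr1 mul1r mulr_gt0 ?divr_gt0 ?exprn_gt0.
Qed.

Lemma partition_fn_gt0 : 0 < Zp.
Proof.
rewrite /partition_fn (bigD1 (spins true finset.set0))//=.
by rewrite (ltr_pwDl weight_minus_gt0)// sumr_ge0// => s _; apply: weight_ge0.
Qed.

Lemma gibbs_ge0 s : 0 <= gib s.
Proof. exact: divr_ge0 (weight_ge0 s) (ltW partition_fn_gt0). Qed.

Lemma gibbs_sum : \sum_s gib s = 1.
Proof. by rewrite -mulr_suml divff// gt_eqF// partition_fn_gt0. Qed.

Lemma gibbs_minus_gt0 : 0 < gib (spins true finset.set0).
Proof. exact: divr_gt0 weight_minus_gt0 partition_fn_gt0. Qed.

Lemma gibbs_single_gt0 v : 0 < gib (spins true [set v]).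
Proof. exact: divr_gt0 (weight_single_gt0 v) partition_fn_gt0. Qed.

Lemma card_edges_le : (#|edges e| <= #|V| ^ 2)%N.
Proof.
apply: leq_trans (_ : #|[set [set p.1; p.2] | p : V * V]| <= _)%N.
  apply/subset_leq_card/subsetP => E; rewrite inE.
  by move=> /existsP[u /existsP[v /andP[_ /eqP ->]]]; apply/imsetP; exists (u, v).
by apply: leq_trans (leq_imset_card _ _) _; rewrite card_prod mulnn.
Qed.

Let al := alpha_param beta gamma.
Let q := lambda + lambda^-1.

Lemma half_le_ln2 : 1 / 2 <= ln 2 :> R.
Proof.
rewrite -[leLHS]expRK ler_ln ?posrE ?expR_gt0//.
rewrite -[leRHS]invrK -[leLHS]invrK lef_pV2 ?posrE ?invr_gt0 ?expR_gt0//.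
by rewrite -expRN; apply: le_trans (expR_ge1Dx _); lra.
Qed.

Lemma alpha_ge2 : 2 <= al.
Proof.
rewrite /al /alpha_param; case: ifP => _.
  have : 0 < gamma^-1 by rewrite invr_gt0.
  by move: g_gt0; lra.
have : 0 <= beta^-1 by rewrite invr_ge0.
by lra.
Qed.

Lemma alpha_ge_gamma : gamma <= al /\ gamma^-1 <= al.
Proof.
rewrite /al /alpha_param; have [b0|bn0] := eqVneq beta 0.
  have : 0 < gamma^-1 by rewrite invr_gt0.
  by move: g_gt0; lra.
have bp : 0 < beta by rewrite lt_neqAle eq_sym bn0.
have h1 : gamma <= beta^-1 by rewrite -[leRHS]mul1r ler_pdivlMr// mulrC ltW.
have h2 : gamma^-1 <= beta^-1 by rewrite lef_pV2.
by move: h1 h2; lra.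
Qed.

Lemma alpha_ge_beta : beta <= al /\ (beta != 0 -> beta^-1 <= al).
Proof.
split; first exact: le_trans b_le_g (alpha_ge_gamma.1).
by move=> /negPf bn0; rewrite /al /alpha_param bn0; lra.
Qed.

Lemma q_ge2 : 2 <= q.
Proof.
rewrite /q -subr_ge0.
have -> : lambda + lambda^-1 - 2 = (lambda - 1) ^+ 2 / lambda.
  by field; rewrite gt_eqF.
by rewrite divr_ge0 ?sqr_ge0// ltW.
Qed.

Lemma ln_bound (y c : R) : 0 < y -> y <= c -> y^-1 <= c -> `|ln y| <= ln c.
Proof.
move=> y0 yc yc'; have c0 := lt_le_trans y0 yc.
rewrite ler_norml; apply/andP; split; last by rewrite ler_ln ?posrE.
by rewrite lerNl -lnV ?posrE// ler_ln ?posrE ?invr_gt0.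
Qed.

(** A crude count of at most [n ^+ 2] edges for each of [beta] and [gamma] is enough, because only
    the logarithm of this bound enters the mixing time. *)
Lemma ln_weight_le s : 0 < wt s ->
  `|ln (wt s)| <= 2 * n ^+ 2 * ln al + n * ln q.
Proof.
move=> ws; have ln_al : 0 <= ln al by rewrite ln_ge0//; move: alpha_ge2; lra.
have ln_q : 0 <= ln q by rewrite ln_ge0//; move: q_ge2; lra.
have E2 (m : nat) : (m <= #|edges e|)%N -> m%:R * ln al <= n ^+ 2 * ln al.
  move=> h; apply: ler_wpM2r => //; rewrite -natrX ler_nat.
  exact: leq_trans h card_edges_le.
have sub (P : pred {set V}) : (#|[set A in edges e | P A]| <= #|edges e|)%N.
  by apply/subset_leq_card/subsetP => A; rewrite inE => /andP[].
have bP : `|ln (beta ^+ m_plus e s)| <= n ^+ 2 * ln al.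
  have [b0|bn0] := eqVneq beta 0.
    (* A configuration of positive weight has no plus edge when [beta = 0], which is why
       [alpha_param] then leaves out [beta^-1]. *)
    have -> : m_plus e s = 0%N.
      apply/eqP; apply: contraTT ws => /negPf h.
      by rewrite /weight b0 expr0n h !mul0r ltxx.
    by rewrite expr0 ln1 normr0 mulr_ge0 ?exprn_ge0.
  have bp : 0 < beta by rewrite lt_neqAle eq_sym bn0.
  rewrite lnXn// normrMn -[leLHS]mulr_natl.
  apply: le_trans (E2 _ (sub _)).
  by apply: ler_wpM2l => //; apply: ln_bound => //; [exact: alpha_ge_beta.1|exact: alpha_ge_beta.2].
have gP : `|ln (gamma ^+ m_minus e s)| <= n ^+ 2 * ln al.
  rewrite lnXn// normrMn -[leLHS]mulr_natl; apply: le_trans (E2 _ (sub _)).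
  by apply: ler_wpM2l => //; apply: ln_bound => //; [exact: alpha_ge_gamma.1|exact: alpha_ge_gamma.2].
have lP : `|ln (lambda ^+ n_plus s)| <= n * ln q.
  rewrite lnXn// normrMn -[leLHS]mulr_natl; apply: ler_pM => //.
    by rewrite ler_nat max_card.
  apply: ln_bound => //; rewrite /q; last by rewrite lerDr ltW.
  by rewrite lerDl invr_ge0 ltW.
have gp : 0 < gamma ^+ m_minus e s by rewrite exprn_gt0.
have lp : 0 < lambda ^+ n_plus s by rewrite exprn_gt0.
have bp : 0 < beta ^+ m_plus e s.
  by move: ws; rewrite /weight pmulr_lgt0// pmulr_lgt0.
rewrite /weight !lnM ?posrE ?mulr_gt0//.
by rewrite -mulrA; apply: norm3_le.
Qed.

Lemma ln_gibbs_ge x : 0 < gib x ->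
  - ln (gib x) <= 14 * n ^+ 2 * ln al * ln q.
Proof.
move=> gx; have Z0 := partition_fn_gt0.
have wx : 0 < wt x by move: gx; rewrite /gibbs pmulr_lgt0 ?invr_gt0.
set T := 2 * n ^+ 2 * ln al + n * ln q.
have wlow : - ln (wt x) <= T.
  by apply: le_trans (ln_weight_le wx); rewrite -normrN ler_norm.
have Zle : ln Zp <= n * ln 2 + T.
  rewrite -[leRHS]expRK ler_ln ?posrE ?expR_gt0//.
  rewrite expRD [n * _]mulrC expRM_natr lnK ?posrE//.
  apply: le_trans (_ : \sum_(s : config V) expR T <= _).
    apply: ler_sum => s _; have [ws|] := ltP 0 (wt s).
      rewrite -[leLHS](@lnK _ (wt s)) ?posrE// ler_expR.
      exact: le_trans (ler_norm _) (ln_weight_le ws).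
    by move=> ws; apply: le_trans ws (expR_ge0 _).
  rewrite sumr_const card_ffun card_bool -[X in X <= _]mulr_natr natrX mulrC.
  by rewrite lexx.
have nN : n <= n ^+ 2 by rewrite -natrX ler_nat; case: #|V| => // m; rewrite leq_pmulr.
have a2 : ln 2 <= ln al by rewrite ler_ln ?posrE// ?alpha_ge2//; move: alpha_ge2; lra.
have q2 : ln 2 <= ln q by rewrite ler_ln ?posrE// ?q_ge2//; move: q_ge2; lra.
have l2 := half_le_ln2.
rewrite /gibbs ln_div ?posrE// opprB; apply: le_trans (lerD Zle wlow) _.
exact: entropy_bound_arith.
Qed.

End GibbsFacts.

(** The sum of logarithms exceeds [B] by [ln 168], where 168 = 14 * 6 * 2 is below [2 ^ 8]. Moreover
    [ln 2 <= B], because [n ^+ 2 * a * q >= 4] and [2 * eps ^+ 2 <= 2]. *)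
Lemma bracket_bound (R : realType) (n a q eps : R) :
  4 <= n -> 1 / 2 <= a -> 1 / 2 <= q -> 0 < eps < 1 ->
  let B := 2 * ln n + ln a + ln q + ln ((2 * eps ^+ 2)^-1) in
  1 / 2 <= B /\
  0 <= ln (14 * n ^+ 2 * a * q) + ln (6 / eps ^+ 2) <= 9 * B.
Proof.
move=> n4 a2 q2 /andP[e0 e1] B.
have n0 : 0 < n by lra.
have a0 : 0 < a by lra.
have q0 : 0 < q by lra.
have e20 : 0 < eps ^+ 2 by rewrite exprn_gt0.
have BE : B = ln (n ^+ 2 * a * q * (2 * eps ^+ 2)^-1).
  rewrite !lnM ?posrE ?invr_gt0 ?mulr_gt0 ?exprn_gt0//.
  by rewrite /B; ring.
have l2 := half_le_ln2 R.
have B2 : ln 2 <= B.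
  rewrite BE ler_ln ?posrE ?mulr_gt0 ?invr_gt0 ?mulr_gt0 ?exprn_gt0//.
  rewrite ler_pdivlMr ?mulr_gt0//.
  have h1 : eps ^+ 2 <= 1 by rewrite exprn_ile1// ltW.
  have h2 : 16 <= n ^+ 2.
    have -> : 16 = 4 * 4 :> R by lra.
    rewrite expr2; apply: ler_pM; lra.
  have h3 : 16 * (1 / 2) <= n ^+ 2 * a by apply: ler_pM => //; lra.
  have h4 : 16 * (1 / 2) * (1 / 2) <= n ^+ 2 * a * q by apply: ler_pM => //; lra.
  move: h1 h4; move: (eps ^+ 2) (n ^+ 2 * a * q) => x y; lra.
split; first by move: l2 B2; lra.
have -> : ln (14 * n ^+ 2 * a * q) + ln (6 / eps ^+ 2) = ln 168 + B.
  rewrite BE -!lnM ?posrE ?mulr_gt0 ?invr_gt0 ?mulr_gt0 ?exprn_gt0//.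
  by congr ln; field; rewrite gt_eqF.
have l168 : 0 <= ln 168 :> R by rewrite ln_ge0//; lra.
have : ln 168 <= 8 * ln 2 :> R.
  by rewrite mulr_natl -lnXn// ler_ln ?posrE ?exprn_gt0//; rewrite -natrX ler_nat.
by move: B2 l2 l168; lra.
Qed.

Theorem theorem1p3 (R : realType) :
  exists K : R, 0 < K /\
  forall delta : R, 0 < delta < 1 ->
  exists C : R, 0 < C /\ C <= expR (K / delta) /\
  forall (V : finType) (e : rel V) (beta gamma lambda : R),
    simple_graph e -> antiferro beta gamma lambda ->
    uniqueness_criterion e beta gamma lambda delta ->
    let n : R := #|V|%:R in
    (C * n)^-1 <= mlsi_const e beta gamma lambda /\
    forall eps : R, 0 < eps < 1 ->
      mixing_time e beta gamma lambda eps <=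
        C * n * (2 * ln n + ln (ln (alpha_param beta gamma))
                 + ln (ln (lambda + lambda^-1)) + ln ((2 * eps ^+ 2)^-1)).
Proof.
have cG0 := cGas_gt0 R.
exists (cGas R + 11); split; first by lra.
move=> delta d01; have [d0 d1] := andP d01.
pose C0 := expR (cGas R / delta).
have C01 : 1 <= C0 by rewrite -[leLHS]expR0 ler_expR divr_ge0 ?ltW.
have C0p : 0 < C0 by exact: expR_gt0.
(* 11 is 9 + 2: nine brackets come from [bracket_bound], and two absorb the rounding [+ 1], as the
   bracket is at least 1/2 and [1 <= C0 * n]. The factor itself is at most [expR (11 / delta)]. *)
exists (11 * C0); split; first by lra.
split.
  rewrite [X in expR X]mulrDl expRD [leLHS]mulrC ler_pM2l//.
  apply: le_trans (_ : expR 11 <= _).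
    by apply: le_trans (expR_ge1Dx _); lra.
  by rewrite ler_expR ler_pdivlMr// ler_piMr// ltW.
move=> V e beta gamma lambda [es ei] af [D3 uniq].
set D := (max_deg e).-1.
have DE : max_deg e = D.+1 by rewrite /D; case: (max_deg e) D3.
have deg_le v : (deg e v <= D.+1)%N by rewrite -DE; apply: leq_bigmax.
have D2 : (2 <= D)%N by rewrite -ltnS -DE.
have [[xh [xh0 xfix _ xgap]] gdeg] : d_unique beta gamma lambda D delta /\
    (gamma <= 1 \/ forall v, deg e v = D.+1).
  by case: uniq => [[g1 u]|[_ [u reg]]]; split => //; [left|right=> v; rewrite reg].
have gsum := gibbs_sum es ei af.
have gge0 := gibbs_ge0 es ei af.
have tensor f : (forall s, 0 < f s) -> entropy e beta gamma lambda f
    <= C0 * \sum_v loc e beta gamma lambda v f.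
  exact: (two_spin_tensorization es ei D2 d01 deg_le af gsum
    (partition_fn_gt0 es ei af) xh0 xfix xgap gdeg).
have [v0 dv0] : exists v, deg e v = max_deg e.
  have V0 : (0 < #|V|)%N.
    rewrite lt0n; apply/negP => /eqP/card0_eq V0.
    by move: D3; rewrite /max_deg big_pred0.
  by have [v h] := bigop.eq_bigmax (deg e) V0; exists v.
(* A vertex of maximum degree, at least 3, together with its neighbours; this keeps the bracket
   above 1/2 for every [eps]. *)
have n4 : (4 <= #|V|)%N.
  have := max_card (mem (v0 |: [set u | e v0 u])).
  rewrite cardsU1 inE ei /= -/(deg e v0) dv0; exact: leq_trans.
have V0 : (0 < #|V|)%N by exact: leq_trans n4.
have n0 : 0 < #|V|%:R :> R by rewrite ltr0n.
split.
  apply: le_trans (_ : (C0 * #|V|%:R)^-1 <= _).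
    rewrite lef_pV2 ?posrE ?mulr_gt0// ler_pM2r//; lra.
  (* All minus and a single plus are two points of the support even when [beta = 0], since neither
     has a plus edge. *)
  apply: (mlsi_const_ge gge0 gsum V0 C0p tensor _ (gibbs_minus_gt0 es ei af)
    (gibbs_single_gt0 es ei af v0)).
  by apply/eqP => /ffunP/(_ v0); rewrite !ffunE !inE eqxx.
move=> eps e01.
have n4R : 4 <= #|V|%:R :> R by rewrite ler_nat.
have l2 := half_le_ln2 R.
have a2 : 1 / 2 <= ln (alpha_param beta gamma).
  apply: le_trans l2 _; have h := alpha_ge2 af.
  by rewrite ler_ln ?posrE//; apply: lt_le_trans h.
have q2 : 1 / 2 <= ln (lambda + lambda^-1).
  apply: le_trans l2 _; have h := q_ge2 af.
  by rewrite ler_ln ?posrE//; apply: lt_le_trans h.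
have [B2 /andP[X0 HB]] := bracket_bound n4R a2 q2 e01.
set B := _ + _ + _ + _ in B2 X0 HB *.
have H0 : 0 < 14 * #|V|%:R ^+ 2 * ln (alpha_param beta gamma)
    * ln (lambda + lambda^-1).
  rewrite !mulr_gt0 ?exprn_gt0//; try lra.
apply: le_trans (mixing_time_le gge0 gsum V0 C0p tensor e01 H0 _
  (ln_gibbs_ge es ei af) _) _.
- by exists (spins true finset.set0); exact: gibbs_minus_gt0.
- exact: X0.
have Cn : 1 <= C0 * #|V|%:R by apply: mulr_ege1 => //; lra.
have split_const (m t : R) :
    11 * C0 * m * t = C0 * m * (9 * t) + C0 * m * (2 * t) by ring.
rewrite split_const; apply: lerD; first exact: (ler_wpM2l (le_trans ler01 Cn) HB).
by apply: mulr_ege1 => //; lra.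
Qed.
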